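(* Let $(A,G,\alpha)$ be a $C^*$-dynamical system with $G$ a (countable) discrete group and $A$ a unital separable $C^*$-algebra. The following are equivalent: (i) $(A,G,\alpha)$ is weakly amenable; (ii) the reduced crossed product $A\rtimes_{\alpha,r}G$ has the completely bounded approximation property. Moreover, if these conditions hold then $\Lambda_{\mathrm{cb}}(A,G,\alpha)=\Lambda_{\mathrm{cb}}(A\rtimes_{\alpha,r}G)$.
   Context: A $C^*$-dynamical system $(A,G,\alpha)$ with $G$ discrete consists of a $C^*$-algebra $A$, the group $G$, and a group homomorphism $\alpha:G\to\mathrm{Aut}(A)$. Reduced crossed product: fix a faithful representation of $A$ on a separable Hilbert space $\mathcal H$ (regard $A\subseteq\mathcal B(\mathcal H)$). On $\ell^2(G,\mathcal H)$ define $(\pi(a)\xi)(s)=\alpha_{s^{-1}}(a)(\xi(s))$ and $(\lambda_t\xi)(s)=\xi(t^{-1}s)$ for $a\in A$, $s,t\in G$. For $f\in\ell^1(G,A)$ put $(\pi\rtimes\lambda)(f)=\sum_{s\in G}\pi(f(s))\lambda_s$. The reduced crossed product $A\rtimes_{\alpha,r}G$ is the operator-norm closure of $(\pi\rtimes\lambda)(\ell^1(G,A))$ in $\mathcal B(\ell^2(G,\mathcal H))$; up to isomorphism it does not depend on the faithful representation. $\mathcal{CB}(A)$ denotes the space of completely bounded linear maps $A\to A$. A bounded function $F:G\to\mathcal{CB}(A)$ is a Herz--Schur $(A,G,\alpha)$-multiplier if the map $S_F:(\pi\rtimes\lambda)(f)\mapsto(\pi\rtimes\lambda)(F\cdot f)$,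 where $(F\cdot f)(s)=F(s)(f(s))$ and $f\in\ell^1(G,A)$, is completely bounded on $(\pi\rtimes\lambda)(\ell^1(G,A))$; it then extends uniquely to a completely bounded map $S_F$ on $A\rtimes_{\alpha,r}G$, and $\|F\|_{\mathrm{HS}}:=\|S_F\|_{\mathrm{cb}}$. This notion does not depend on the faithful representation. $(A,G,\alpha)$ is weakly amenable if there is a net $(F_i)$ of finitely supported Herz--Schur $(A,G,\alpha)$-multipliers such that $F_i(t)$ is a finite rank completely bounded map on $A$ for every $t\in G$, $\|F_i(t)(a)-a\|\to0$ for all $t\in G$, $a\in A$, and $\sup_i\|F_i\|_{\mathrm{HS}}=K<\infty$. The infimum of all such $K$ is denoted $\Lambda_{\mathrm{cb}}(A,G,\alpha)$. A $C^*$-algebra $B$ has the completely bounded approximation property if there is a net $(T_\gamma)$ of finite rank completely bounded maps on $B$ such that $T_\gamma\to\mathrm{id}_B$ in the point-norm topology and $\sup_\gamma\|T_\gamma\|_{\mathrm{cb}}=C<\infty$; the infimum of all such $C$ is denoted $\Lambda_{\mathrm{cb}}(B)$. *)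

(* Defs.v *)
From HB Require Import structures.
From mathcomp Require Import all_boot all_order all_algebra.
From mathcomp Require Import all_classical all_reals all_analysis.
From mathcomp Require Import complex ring finmap.

Set Implicit Arguments.
Unset Strict Implicit.
Unset Printing Implicit Defensive.
Import Order.TTheory GRing.Theory Num.Theory.
Import numFieldNormedType.Exports.

Local Open Scope classical_set_scope.
Local Open Scope ring_scope.
Local Open Scope complex_scope.

(* The norm of a normed module over [R[i]] takes its values in [R[i]]; rnorm is
   the same number seen in [R]. *)
Definition rnorm (R : realType) (V : normedZmodType R[i]) (x : V) : R :=
  complex.Re `|x|.

HB.mixin Record CompleteNormedModule_isHilbert (R : realType) H
    of CompleteNormedModule R[i] H := {
  hdot : {dot H for Num.conj};
  hdotxx : forall x : H, hdot x x = `|x| ^+ 2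
}.

#[short(type="hilbertType")]
HB.structure Definition Hilbert (R : realType) :=
  {H of CompleteNormedModule R[i] H & CompleteNormedModule_isHilbert R H}.

(* The norm is a field here, because Hierarchy Builder has no join of the
   algebra and normed-module hierarchies.  The unit is that of [algType]; the
   zero algebra (1 = 0) is allowed. *)
HB.mixin Record Algebra_isCStar (R : realType) A of GRing.Algebra R[i] A := {
  cnorm : A -> R;
  cnormD : forall x y, cnorm (x + y) <= cnorm x + cnorm y;
  cnormZ : forall (c : R[i]) x, cnorm (c *: x) = rnorm c * cnorm x;
  cnorm0_eq0 : forall x, cnorm x = 0 -> x = 0;
  cnormM : forall x y, cnorm (x * y) <= cnorm x * cnorm y;
  cnorm_complete : forall u : nat -> A,
    (forall e, 0 < e -> exists N, forall m n, (N <= m)%N -> (N <= n)%N ->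
       cnorm (u m - u n) < e) ->
    exists l, forall e, 0 < e -> exists N, forall n, (N <= n)%N ->
      cnorm (u n - l) < e;
  star : A -> A;
  starK : involutive star;
  starD : {morph star : x y / x + y};
  starZ : forall (c : R[i]) x, star (c *: x) = Num.conj c *: star x;
  starM : forall x y, star (x * y) = star y * star x;
  cnorm_star : forall x, cnorm (star x * x) = cnorm x ^+ 2
}.

#[short(type="unitalCStarType")]
HB.structure Definition UnitalCStar (R : realType) :=
  {A of GRing.Algebra R[i] A & Algebra_isCStar R A}.

Definition separable_space (T : topologicalType) :=
  exists D : set T, countable D /\ dense D.

Definition separable_cstar (R : realType) (A : unitalCStarType R) :=
  exists D : set A, countable D /\
    forall a e, 0 < e -> exists2 d, D d & cnorm (a - d) < e.

Section L2.
Variables (R : realType) (I : choiceType) (H : normedModType R[i]).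
Implicit Types x y : I -> H.

Definition l2_sqnorm x : \bar R := \esum_(s in setT) (rnorm (x s) ^+ 2)%:E.

Definition l2_pred : {pred I -> H} := fun x => `[< (l2_sqnorm x < +oo)%E >].

Lemma rnorm_ge0 (V : normedZmodType R[i]) (v : V) : 0 <= rnorm v.
Proof.
rewrite /rnorm; have := normr_ge0 v.
by case: `|v| => a b; rewrite lecE /= => /andP[].
Qed.

Lemma rnormE (V : normedZmodType R[i]) (v : V) : (rnorm v)%:C = `|v|.
Proof.
rewrite /rnorm; have := normr_ge0 v.
by case: `|v| => a b; rewrite lecE /= => /andP[/eqP->].
Qed.

Lemma rnormZ (c : R[i]) (v : H) : rnorm (c *: v) = rnorm c * rnorm v.
Proof.
suff: (rnorm (c *: v))%:C = (rnorm c * rnorm v)%:C by move/complexI.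
by rewrite rmorphM /= !rnormE normrZ.
Qed.

Lemma rnorm_eq0 (v : H) : rnorm v = 0 -> v = 0.
Proof. by move=> v0; apply: normr0_eq0; rewrite -rnormE v0. Qed.

Lemma ler_rnormD (v w : H) : rnorm (v + w) <= rnorm v + rnorm w.
Proof. by rewrite -lecR rmorphD /= !rnormE ler_normD. Qed.

Lemma l2_sqnorm_ge0 x : (0 <= l2_sqnorm x)%E.
Proof. by apply: esum_ge0 => s _; rewrite lee_fin sqr_ge0. Qed.

Lemma l2_sqnormZ_le (c : R[i]) x :
  (l2_sqnorm (c *: x) <= (rnorm c ^+ 2)%:E * l2_sqnorm x)%E.
Proof.
apply: ub_ereal_sup => _ [A [finA _] <-].
have -> : \sum_(s \in A) (rnorm ((c *: x) s) ^+ 2)%:E =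
    ((rnorm c ^+ 2)%:E * \sum_(s \in A) (rnorm (x s) ^+ 2)%:E)%E.
  rewrite ge0_mule_fsumr; last by move=> s; rewrite lee_fin sqr_ge0.
  by apply: eq_fsbigr => s _; rewrite rnormZ exprMn EFinM.
rewrite lee_wpmul2l ?lee_fin ?sqr_ge0//.
by apply: ereal_sup_ubound; exists A.
Qed.

Lemma l2_sqnormD_le (t : R) x y : 0 < t ->
  (l2_sqnorm (x + y)%R <=
     (1 + t)%:E * l2_sqnorm x + (1 + t^-1)%:E * l2_sqnorm y)%E.
Proof.
move=> t0; apply: ub_ereal_sup => _ [A [finA _] <-].
have sub z : (\sum_(s \in A) (rnorm (z s) ^+ 2)%:E <= l2_sqnorm z)%E.
  by apply: ereal_sup_ubound; exists A.
have t1 : 0 < t^-1 by rewrite invr_gt0.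
apply: (@le_trans _ _ ((1 + t)%:E * \sum_(s \in A) (rnorm (x s) ^+ 2)%:E +
    (1 + t^-1)%:E * \sum_(s \in A) (rnorm (y s) ^+ 2)%:E)%E); last first.
  by apply: leeD; rewrite lee_wpmul2l ?lee_fin ?addr_ge0// ltW.
rewrite !ge0_mule_fsumr; try by move=> s; rewrite lee_fin sqr_ge0.
rewrite -fsbig_split//; apply: lee_fsum => //= s _.
rewrite -!EFinM -EFinD lee_fin.
apply: (@le_trans _ _ ((rnorm (x s) + rnorm (y s)) ^+ 2)).
  by rewrite ler_sqr ?nnegrE ?addr_ge0 ?rnorm_ge0 ?ler_rnormD.
set a := rnorm (x s); set b := rnorm (y s); rewrite -subr_ge0.
suff -> : (1 + t) * a ^+ 2 + (1 + t^-1) * b ^+ 2 - (a + b) ^+ 2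
    = t * (a - t^-1 * b) ^+ 2 by rewrite mulr_ge0 ?sqr_ge0 ?ltW.
by field; rewrite gt_eqF.
Qed.

Lemma l2_submod_closed : submod_closed l2_pred.
Proof.
split=> [|c x y].
  rewrite unfold_in; apply/asboolP; rewrite /l2_sqnorm esum1 ?ltry// => s _.
  by rewrite /rnorm normr0 expr0n.
rewrite !unfold_in => /asboolP xf /asboolP yf; apply/asboolP.
apply: (le_lt_trans (@l2_sqnormD_le 1 _ _ ltr01)).
rewrite lte_add_pinfty// lte_mul_pinfty ?l2_sqnorm_ge0 ?lee_fin//.
apply: (le_lt_trans (l2_sqnormZ_le _ _)).
by rewrite lte_mul_pinfty ?lee_fin ?sqr_ge0.
Qed.

HB.instance Definition _ :=
  GRing.isSubmodClosed.Build R[i] (I -> H) l2_pred l2_submod_closed.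

Record l2 := L2 { l2val :> I -> H; _ : l2val \in l2_pred }.

HB.instance Definition _ := [isSub for l2val].
HB.instance Definition _ := [Choice of l2 by <:].
HB.instance Definition _ := [SubChoice_isSubLmodule of l2 by <:].

Definition l2_norm (x : l2) : R[i] := (Num.sqrt (fine (l2_sqnorm x)))%:C.

Lemma l2_sqnorm_fin (x : l2) : l2_sqnorm x \is a fin_num.
Proof.
rewrite ge0_fin_numE ?l2_sqnorm_ge0//.
by have := valP x; rewrite unfold_in => /asboolP.
Qed.

Lemma l2_fine_ge0 (x : l2) : 0 <= fine (l2_sqnorm x).
Proof. by rewrite fine_ge0 ?l2_sqnorm_ge0. Qed.

Lemma l2_norm0_eq0 (x : l2) : l2_norm x = 0 -> x = 0.
Proof.
move=> /complexI/eqP; rewrite sqrtr_eq0 => x0.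
have {x0}Sx0 : l2_sqnorm x = 0.
  rewrite -(fineK (l2_sqnorm_fin x)); congr (_%:E); apply/eqP.
  by rewrite eq_le x0 l2_fine_ge0.
apply: val_inj; apply/funext => s /=; apply: rnorm_eq0; apply/eqP.
rewrite -sqrf_eq0 eq_le sqr_ge0 andbT -lee_fin -[0%:E]Sx0.
rewrite -[leLHS](@esum_set1 _ _ s (fun s => (rnorm (x s) ^+ 2)%:E)); last first.
  by rewrite lee_fin sqr_ge0.
rewrite esum_mkcond; apply: le_esum => r _.
by case: ifP => // _; rewrite lee_fin sqr_ge0.
Qed.

Lemma l2_normZ (c : R[i]) (x : l2) : l2_norm (c *: x) = `|c| * l2_norm x.
Proof.
rewrite -rnormE -[rnorm c]ger0_norm ?rnorm_ge0// -sqrtr_sqr -rmorphM /=.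
rewrite -sqrtrM ?sqr_ge0//; congr (Num.sqrt _)%:C.
apply: EFin_inj; rewrite EFinM !fineK ?l2_sqnorm_fin//; apply/eqP.
rewrite eq_le l2_sqnormZ_le/=.
have [->|c0] := eqVneq c 0.
  by rewrite /rnorm normr0 expr0n mul0e l2_sqnorm_ge0.
have c0' : 0 < rnorm c ^+ 2.
  rewrite exprn_gt0// lt_def rnorm_ge0 andbT.
  by apply: contra_neq c0 => c0; apply: normr0_eq0; rewrite -rnormE c0.
have := l2_sqnormZ_le c^-1 (c *: (x : I -> H)).
rewrite scalerA mulVf// scale1r => /(lee_wpmul2l (ltW c0' : 0 <= _%:E)%E).
move=> /le_trans; apply; rewrite muleA -EFinM -exprMn.
suff -> : rnorm c * rnorm c^-1 = 1 by rewrite expr1n mul1e.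
suff: (rnorm c * rnorm c^-1)%:C = 1%:C by move/complexI.
by rewrite rmorphM /= !rnormE -normrM divff// normr1.
Qed.

Lemma ler_l2_normD (x y : l2) : l2_norm (x + y) <= l2_norm x + l2_norm y.
Proof.
have [/l2_norm0_eq0->|x0] := eqVneq (l2_norm x) 0.
  by rewrite add0r lerDr /l2_norm ler0c sqrtr_ge0.
have [/l2_norm0_eq0->|y0] := eqVneq (l2_norm y) 0.
  by rewrite addr0 lerDl /l2_norm ler0c sqrtr_ge0.
rewrite /l2_norm -rmorphD lecR /=.
have Nx := sqr_sqrtr (l2_fine_ge0 x); have Ny := sqr_sqrtr (l2_fine_ge0 y).
have Sx := fineK (l2_sqnorm_fin x); have Sy := fineK (l2_sqnorm_fin y).
move: x0 y0 Nx Ny; rewrite /l2_norm.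
set N := Num.sqrt (fine (l2_sqnorm x)); set M := Num.sqrt (fine (l2_sqnorm y)).
move=> x0 y0 Nx Ny.
have N0 : 0 < N.
  by rewrite lt_def sqrtr_ge0 andbT; apply: contra_neq x0 => ->.
have M0 : 0 < M.
  by rewrite lt_def sqrtr_ge0 andbT; apply: contra_neq y0 => ->.
rewrite -(ger0_norm (addr_ge0 (ltW N0) (ltW M0))) -sqrtr_sqr ler_wsqrtr//.
have := l2_sqnormD_le x y (divr_gt0 M0 N0).
rewrite -(fineK (l2_sqnorm_fin (x + y))) -Sx -Sy -!EFinM -EFinD lee_fin.
move=> /le_trans; apply; rewrite -Nx -Ny.
suff -> : (1 + M / N) * N ^+ 2 + (1 + (M / N)^-1) * M ^+ 2 = (N + M) ^+ 2 by [].
by field; rewrite !gt_eqF.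
Qed.

HB.instance Definition _ := Lmodule_isNormed.Build R[i] l2
  ler_l2_normD l2_normZ l2_norm0_eq0.

End L2.

Section Operators.
Variables (R : realType) (K : normedModType R[i]).

Definition opnorm (T : K -> K) : \bar R :=
  ereal_sup [set (rnorm (T x))%:E | x in [set x | rnorm x <= 1]].

Definition bounded_op (T : K -> K) := linear T /\ (opnorm T < +oo)%E.

(* The norm of K^n = K (+) ... (+) K, and of an n x n matrix of operators on K
   acting on K^n. *)
Definition colnorm n (x : 'I_n -> K) : R :=
  Num.sqrt (\sum_i rnorm (x i) ^+ 2).

Definition mxnorm n (T : 'M[K -> K]_n) : \bar R :=
  ereal_sup [set (colnorm (fun i => \sum_k T i k (x k)))%:E
            | x in [set x : 'I_n -> K | colnorm x <= 1]].

(* T is the sum, in operator norm, of the unordered family (u s). *)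
Definition op_has_sum (G : choiceType) (u : G -> K -> K) (T : K -> K) :=
  bounded_op T /\
  forall e : R, 0 < e -> exists F0 : {fset G}, forall F : {fset G},
    (F0 `<=` F)%fset -> (opnorm (T - \sum_(s <- F) u s)%R <= e%:E)%E.

Definition op_sum (G : choiceType) (u : G -> K -> K) : K -> K :=
  xget 0 [set T | op_has_sum u T].

Definition op_closure (D : set (K -> K)) : set (K -> K) :=
  [set T | bounded_op T /\
     forall e : R, 0 < e -> exists2 S, D S & (opnorm (T - S)%R <= e%:E)%E].

(* In what follows a linear space D of operators on K is given as the image of
   a subset D of a vector space X under a linear j : X -> (K -> K) which is
   injective on D; D = setT and j = rho for a represented C*-algebra, j = id
   for a space of operators.  Maps on D are functions X -> X, the values of
   which outside D are irrelevant. *)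
Section CB.
Variables (X : lmodType R[i]) (j : X -> K -> K) (D : set X).
Implicit Type phi : X -> X.

Definition cbnorm phi : \bar R :=
  ereal_sup [set r | exists n (x : 'M[X]_n),
    [/\ forall i k, D (x i k), (mxnorm (map_mx j x) <= 1)%E
      & r = mxnorm (map_mx j (map_mx phi x))]].

Definition linear_on phi :=
  (forall x, D x -> D (phi x)) /\
  (forall (c : R[i]) x y, D x -> D y -> phi (c *: x + y) = c *: phi x + phi y).

Definition cb_map phi := linear_on phi /\ (cbnorm phi < +oo)%E.

Definition finite_rank phi := exists n (b : 'I_n -> X),
  forall x, D x -> exists c : 'I_n -> R[i], phi x = \sum_i c i *: b i.

End CB.
End Operators.

Definition directed (I : Type) (le : I -> I -> Prop) :=
  [/\ inhabited I, forall i, le i i,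
      forall i k l, le i k -> le k l -> le i l
    & forall i k, exists l, le i l /\ le k l].

Definition net_to0 (R : realType) (I : Type) (le : I -> I -> Prop)
    (u : I -> \bar R) :=
  forall e : R, 0 < e -> exists i0, forall i, le i0 i -> (u i < e%:E)%E.

Section CBAP.
Variables (R : realType) (K : normedModType R[i]) (B : set (K -> K)).

Definition cbap_with (C : \bar R) :=
  exists (I : Type) (le : I -> I -> Prop) (T : I -> (K -> K) -> (K -> K)),
    [/\ directed le,
        forall i, cb_map id B (T i) /\ finite_rank B (T i),
        forall b, B b -> net_to0 le (fun i => opnorm (T i b - b)),
        C = ereal_sup [set cbnorm id B (T i) | i in setT]
      & (C < +oo)%E].

Definition cbap := exists C, cbap_with C.

Definition Lambda_cb : \bar R := ereal_inf [set C | cbap_with C].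

End CBAP.

Record is_automorphism (R : realType) (A : unitalCStarType R) (f : A -> A) :
    Prop := {
  automorphism_linear : linear f;
  automorphismM : {morph f : a b / a * b};
  automorphism_star : {morph f : a / star a};
  automorphism_bij : bijective f
}.

Record is_action (R : realType) (A : unitalCStarType R) (G : groupType)
    (alpha : G -> A -> A) : Prop := {
  action_automorphism : forall t, is_automorphism (alpha t);
  actionM : forall s t, alpha (s * t)%g = alpha s \o alpha t
}.

(* The representation is not assumed to map 1 to the identity. *)
Record is_faithful_rep (R : realType) (A : unitalCStarType R)
    (H : hilbertType R) (rho : A -> H -> H) : Prop := {
  rep_bounded : forall a, bounded_op (rho a);
  rep_linear : linear rho;
  repM : forall a b, rho (a * b) = rho a \o rho b;
  rep_star : forall a x y, hdot (rho a x) y = hdot x (rho (star a) y);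
  rep_inj : injective rho
}.

Section CrossedProduct.
Variables (R : realType) (A : unitalCStarType R) (G : groupType).
Variables (alpha : G -> A -> A) (H : hilbertType R) (rho : A -> H -> H).

Local Notation L2GH := (l2 G H).

(* For an action and a faithful representation the functions below are square
   summable whenever xi is, so that the default value 0 is never used. *)
Definition to_l2 (x : G -> H) : L2GH := insubd (0 : L2GH) x.

Definition pi_rep (a : A) (xi : L2GH) : L2GH :=
  to_l2 (fun s => rho (alpha s^-1%g a) (xi s)).

Definition lambda_rep (t : G) (xi : L2GH) : L2GH :=
  to_l2 (fun s => xi (t^-1 * s)%g).

Definition l1 : set (G -> A) :=
  [set f | (\esum_(s in setT) (cnorm (f s))%:E < +oo)%E].

Definition integrated (f : G -> A) : L2GH -> L2GH :=
  op_sum (fun s => pi_rep (f s) \o lambda_rep s).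

Definition l1_image : set (L2GH -> L2GH) := integrated @` l1.

Definition crossed_product : set (L2GH -> L2GH) := op_closure l1_image.

Definition pw_act (F : G -> A -> A) (f : G -> A) : G -> A :=
  fun s => F s (f s).

Definition bounded_into_CB (F : G -> A -> A) :=
  (forall t, cb_map rho setT (F t)) /\
  (ereal_sup [set cbnorm rho setT (F t) | t in setT] < +oo)%E.

(* S is a completely bounded map on D inducing f |-> F . f. *)
Definition is_S_on (D : set (L2GH -> L2GH)) (F : G -> A -> A)
    (S : (L2GH -> L2GH) -> (L2GH -> L2GH)) :=
  cb_map id D S /\
  forall f, l1 f -> S (integrated f) = integrated (pw_act F f).

Definition herz_schur (F : G -> A -> A) :=
  bounded_into_CB F /\ exists S, is_S_on l1_image F S.

(* The completely bounded extension of S_F to the crossed product, which is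
   unique there. *)
Definition S_ext (F : G -> A -> A) : (L2GH -> L2GH) -> (L2GH -> L2GH) :=
  xget 0 [set S | is_S_on crossed_product F S].

Definition HSnorm (F : G -> A -> A) : \bar R :=
  cbnorm id crossed_product (S_ext F).

Definition weakly_amenable_with (C : \bar R) :=
  exists (I : Type) (le : I -> I -> Prop) (F : I -> G -> A -> A),
    [/\ directed le,
        forall i, [/\ herz_schur (F i), finite_set [set t | F i t <> 0]
          & forall t, finite_rank setT (F i t)],
        forall t a, net_to0 le (fun i => (cnorm (F i t a - a))%:E),
        C = ereal_sup [set HSnorm (F i) | i in setT]
      & (C < +oo)%E].

Definition weakly_amenable := exists C, weakly_amenable_with C.

Definition Lambda_cb_system : \bar R :=
  ereal_inf [set C | weakly_amenable_with C].

End CrossedProduct.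

(* Main.v *)
(* Multipliers to maps: for a finitely supported multiplier F with finite rank
   values, the map S_F is y |-> sum_t pi(F t (E_t y)) lambda_t, where E_t y is
   the t-th Fourier coefficient of y; it has finite rank, and converges to the
   identity on finitely supported sums, hence everywhere by boundedness.  E_t is
   defined on the whole crossed product because rho is bounded below.

   Maps to multipliers: a finite rank map T is perturbed to T' whose range
   consists of finitely supported sums, and F t a := E_t (T' (pi(a) lambda_t)).
   For any finite set P of G, the matrix [y_(s r^-1)] indexed by s, r in P, with
   y_t = pi(E_t y) lambda_t, has norm at most that of y; applying T' to it and
   evaluating at the vectors delta_r (xi r) gives the values (S_F y xi) s.
   Hence the multiplier norm of F is at most the completely bounded norm of T'. *)

Require Import Defs.
From HB Require Import structures.
From mathcomp Require Import all_boot all_order all_algebra.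
From mathcomp Require Import all_classical all_reals all_analysis.
From mathcomp Require Import complex finmap.
From mathcomp Require Import ring lra.
Set Implicit Arguments.
Unset Strict Implicit.
Unset Printing Implicit Defensive.
Import Order.TTheory GRing.Theory Num.Theory.
Import numFieldNormedType.Exports.
Local Open Scope classical_set_scope.
Local Open Scope ring_scope.
Local Open Scope complex_scope.

(** * Norms and finite sums *)

(** That [rho] is bounded below is proved with the constant 2 in place of isometry: square roots
    obtained by iteration do the work of spectral theory. The loss is harmless, because the 2 enters
    only statements of boundedness and convergence and never reaches a multiplier norm.

    The range of T has to be moved into the finitely supported sums, since otherwise F would have
    infinite support. The displacement must be small in the completely bounded norm, not only in
    norm. The coordinates on the range of T are therefore combinations of vector functionals y |->
    <y xi (s), w>: applied entrywise, these turn a matrix of operators into a scalar matrix of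
    controlled norm, and a scalar matrix keeps its norm when it acts on vectors. The constants of
    the basis are fixed before the approximation, so the displacement can be made arbitrarily small.

    The finite matrices indexed by P are compressions of the coaction y |-> sum_t y_t (x) lambda_t.
    Finite supports make such compressions sufficient, so no tensor product has to be formed. *)

Section FiniteSums.
Variable R : realType.

Lemma ler_sum_subset (G : eqType) (h : G -> R) (W Q : seq G) :
  uniq W -> uniq Q -> {subset W <= Q} -> (forall q, 0 <= h q) ->
  \sum_(q <- W) h q <= \sum_(q <- Q) h q.
Proof.
move=> uW uQ WQ h0.
rewrite [leRHS](bigID (fun q => q \in W))/= -[X in _ <= X + _]big_filter.
rewrite [X in _ <= X + _](perm_big W); first by rewrite lerDl sumr_ge0.
apply: uniq_perm; rewrite ?filter_uniq// => q.
by rewrite mem_filter; case: (boolP (q \in W)) => //= /WQ.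
Qed.

Lemma ler_sum_inj (G G' : eqType) (h : G -> R) (k : G' -> G) (W : seq G') (Q : seq G) :
  uniq W -> uniq Q -> injective k -> {in W, forall u, k u \in Q} ->
  (forall q, 0 <= h q) -> \sum_(u <- W) h (k u) <= \sum_(q <- Q) h q.
Proof.
move=> uW uQ kI kW h0; rewrite -(big_map k xpredT h); apply: ler_sum_subset => //.
  by rewrite map_inj_uniq.
by move=> _ /mapP[u uWq ->]; exact: kW.
Qed.

Lemma fset_sum_split (G : choiceType) (V : nmodType) (f : G -> V) (F0 F : {fset G}) :
  (F0 `<=` F)%fset ->
  \sum_(s <- F) f s = \sum_(s <- F0) f s + \sum_(s <- F | s \notin F0) f s.
Proof.
move=> F0F; rewrite (bigID (fun s => s \in F0))/=; congr (_ + _).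
rewrite -big_filter; apply: perm_big; apply: uniq_perm.
- by rewrite filter_uniq ?fset_uniq.
- exact: fset_uniq.
- by move=> s; rewrite mem_filter; case: (boolP (s \in F0)) => //= /(fsubsetP F0F).
Qed.

Lemma sum_prod_type (V : nmodType) (I J : finType) (F : I * J -> V) :
  \sum_p F p = \sum_l \sum_r F (l, r).
Proof. by rewrite pair_bigA; apply: eq_bigr => -[]. Qed.

End FiniteSums.

Section RnormTheory.
Variable R : realType.

Lemma rnorm0 (V : normedZmodType R[i]) : rnorm (0 : V) = 0.
Proof. by rewrite /rnorm normr0. Qed.

Lemma rnormN (V : normedZmodType R[i]) (v : V) : rnorm (- v) = rnorm v.
Proof. by rewrite /rnorm normrN. Qed.

Lemma rnormB_sym (V : normedZmodType R[i]) (v w : V) : rnorm (v - w) = rnorm (w - v).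
Proof. by rewrite -rnormN opprB. Qed.

Lemma ler_rnorm_add (V : normedZmodType R[i]) (v w : V) :
  rnorm (v + w) <= rnorm v + rnorm w.
Proof. by rewrite -lecR rmorphD /= !rnormE ler_normD. Qed.

Lemma rnorm_real (r : R) : rnorm (r%:C : R[i]) = `|r|.
Proof. by rewrite /rnorm normc_def /= expr0n /= addr0 sqrtr_sqr. Qed.

Lemma rnormM (c d : R[i]) : rnorm (c * d) = rnorm c * rnorm d.
Proof. by apply: complexI; rewrite rmorphM /= !rnormE normrM. Qed.

Lemma rnorm1 : rnorm (1 : R[i]) = 1.
Proof. by rewrite -(rmorph1 (real_complex R)) rnorm_real normr1. Qed.

Lemma rnorm_conj (c : R[i]) : rnorm (Num.conj c) = rnorm c.
Proof. by rewrite /rnorm norm_conjC. Qed.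

Lemma conj_real (r : R) : Num.conj (r%:C : R[i]) = r%:C.
Proof. exact: conjc_real. Qed.

Lemma rnorm_sum (V : normedZmodType R[i]) (I : Type) (r : seq I) (P : pred I)
    (F : I -> V) :
  rnorm (\sum_(i <- r | P i) F i) <= \sum_(i <- r | P i) rnorm (F i).
Proof.
elim/big_ind2 : _ => //; first by rewrite rnorm0.
move=> a b c d ab cd; apply: (le_trans (ler_rnorm_add _ _)); exact: lerD.
Qed.

Lemma rnorm_scale_inv (V : normedModType R[i]) (v : V) :
  rnorm v != 0 -> rnorm ((rnorm v)^-1%:C *: v) = 1.
Proof.
by move=> v0; rewrite rnormZ rnorm_real ger0_norm ?invr_ge0 ?rnorm_ge0// mulVf.
Qed.

End RnormTheory.

(** * Square roots and unitaries in a C*-algebra *)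

Section CStarAlgebra.
Variables (R : realType) (A : unitalCStarType R).
Implicit Types x y z h g : A.

Lemma cnorm0 : cnorm (0 : A) = 0.
Proof. by rewrite -(scale0r (0 : A)) cnormZ rnorm0 mul0r. Qed.

Lemma cnormN x : cnorm (- x) = cnorm x.
Proof.
by rewrite -scaleN1r cnormZ -(rmorph1 (real_complex R)) rnormN rnorm_real normr1 mul1r.
Qed.

Lemma cnormB_sym x y : cnorm (x - y) = cnorm (y - x).
Proof. by rewrite -cnormN opprB. Qed.

Lemma cnormB x y : cnorm (x - y) <= cnorm x + cnorm y.
Proof. by rewrite -(cnormN y) cnormD. Qed.

Lemma cnorm_ge0 x : 0 <= cnorm x.
Proof. by have := cnormB x x; rewrite subrr cnorm0; lra. Qed.

Lemma cnormZR (r : R) x : 0 <= r -> cnorm (r%:C *: x) = r * cnorm x.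
Proof. by move=> r0; rewrite cnormZ rnorm_real ger0_norm. Qed.

Lemma star1 : star (1 : A) = 1.
Proof. by rewrite -[LHS](mulr1) -[X in _ * X]starK -starM mulr1 starK. Qed.

Lemma star0 : star (0 : A) = 0.
Proof. by apply: (@addIr _ (star 0)); rewrite -starD !add0r. Qed.

Lemma starN x : star (- x) = - star x.
Proof. by apply: (@addIr _ (star x)); rewrite -starD !addNr star0. Qed.

Lemma starB x y : star (x - y) = star x - star y.
Proof. by rewrite starD starN. Qed.

Lemma starZR (r : R) x : star (r%:C *: x) = r%:C *: star x.
Proof. by rewrite starZ conj_real. Qed.

Lemma cnorm_starE x : cnorm (star x) = cnorm x.
Proof.
have le y : cnorm y <= cnorm (star y).
  have := cnormM (star y) y; rewrite cnorm_star expr2.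
  have := cnorm_ge0 y; rewrite le_eqVlt => /orP[/eqP<- _|y0]; first exact: cnorm_ge0.
  by rewrite ler_pM2r.
by apply/le_anti; rewrite le andbT -{2}(starK x) le.
Qed.

Lemma cnorm1_le1 : cnorm (1 : A) <= 1.
Proof.
have := cnorm_star (1 : A); rewrite star1 mulr1 expr2.
have := cnorm_ge0 (1 : A); rewrite le_eqVlt => /orP[/eqP<- _|y0]; first exact: ler01.
by rewrite -{1}(mulr1 (cnorm 1)) => /(mulfI (lt0r_neq0 y0)) <-.
Qed.

Lemma cnorm_small0 (c : R) x : 0 <= c -> (forall e, 0 < e -> cnorm x <= c * e) -> x = 0.
Proof.
move=> c0 H; apply: cnorm0_eq0; apply/le_anti; rewrite cnorm_ge0 andbT.
apply/ler_addgt0Pr => e e0; rewrite add0r.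
have c1 : 0 < c + 1 by lra.
apply: (le_trans (H (e / (c + 1)) _)); first exact: divr_gt0.
by rewrite mulrCA ger_pMr// ler_pdivrMr// mul1r; lra.
Qed.

Fixpoint sqrt_maj (n : nat) : R := if n is m.+1 then (1 + sqrt_maj m ^+ 2) / 2 else 0.

Lemma sqrt_maj_bounds n : 0 <= sqrt_maj n <= 1.
Proof. by elim: n => [|n /andP[a b]] /=; [rewrite lexx ler01|apply/andP; split; nra]. Qed.

(** One-sided, straight from the supremum: these differences will dominate norms in
    [cnorm_sqrt_iterB], so an upper bound is what the Cauchy property of the iterates asks for. *)
Lemma sqrt_maj_cauchy e : 0 < e ->
  exists N, forall n, (N <= n)%N -> sqrt_maj n - sqrt_maj N < e.
Proof.
move=> e0; set E := [set sqrt_maj n | n in setT].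
have supE : has_sup E.
  split; first by exists (sqrt_maj 0); exists 0%N.
  by exists 1 => _ [n _ <-]; have /andP[] := sqrt_maj_bounds n.
have [_ [N _ <-] sN] := sup_adherent e0 supE.
exists N => n Nn.
have : sqrt_maj n <= sup E by apply: sup_upper_bound => //; exists n.
lra.
Qed.

(* The Picard iteration for [1 - sqrt (1 - x)], the fixed point of
   [y |-> (x + y ^+ 2) / 2]; [sqrt_maj] is the same iteration at [x = 1]. *)
Fixpoint sqrt_iter x (n : nat) : A :=
  if n is m.+1 then (2^-1 : R)%:C *: (x + sqrt_iter x m * sqrt_iter x m) else 0.

Lemma sqrt_iterS x n :
  sqrt_iter x n.+1 = (2^-1 : R)%:C *: (x + sqrt_iter x n * sqrt_iter x n).
Proof. by []. Qed.

Lemma sqrt_majS n : sqrt_maj n.+1 = (1 + sqrt_maj n ^+ 2) / 2.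
Proof. by []. Qed.

Lemma addlKB (a b c : A) : (a + b) - (a + c) = b - c.
Proof. by rewrite opprD addrACA subrr add0r. Qed.

Lemma cnorm_sqrt_iter x n : cnorm x <= 1 -> cnorm (sqrt_iter x n) <= sqrt_maj n.
Proof.
move=> x1; elim: n => [|n IH] /=; first by rewrite cnorm0.
rewrite cnormZR ?invr_ge0// mulrC ler_wpM2r ?invr_ge0//.
apply: (le_trans (cnormD _ _)); apply: lerD => //.
by apply: (le_trans (cnormM _ _)); rewrite expr2 ler_pM ?cnorm_ge0.
Qed.

Lemma cnorm_sqrB a b :
  cnorm (a * a - b * b : A) <= (cnorm a + cnorm b) * cnorm (a - b).
Proof.
have -> : a * a - b * b = a * (a - b) + (a - b) * b.
  by rewrite mulrBr mulrBl addrA subrK.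
apply: (le_trans (cnormD _ _)).
rewrite [leRHS]mulrDl lerD //; first exact: cnormM.
by rewrite [leRHS]mulrC cnormM.
Qed.

(** By [a * a - b * b = a * (a - b) + (a - b) * b], one step of the iteration multiplies differences
    by at most half the sum of the norms. For [sqrt_maj] the same recursion holds with equality, so
    its increments dominate. *)
Lemma cnorm_sqrt_iterB x m n : cnorm x <= 1 -> (m <= n)%N ->
  cnorm (sqrt_iter x n - sqrt_iter x m) <= sqrt_maj n - sqrt_maj m.
Proof.
move=> x1; have step k : cnorm (sqrt_iter x k.+1 - sqrt_iter x k) <=
    sqrt_maj k.+1 - sqrt_maj k.
  elim: k => [|k IH]; first by rewrite !subr0 (cnorm_sqrt_iter 1).
  rewrite (sqrt_iterS x k.+1) {2}(sqrt_iterS x k).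
  rewrite -scalerBr addlKB cnormZR ?invr_ge0//.
  apply: (@le_trans _ _ (2^-1 * ((sqrt_maj k.+1 + sqrt_maj k) *
     (sqrt_maj k.+1 - sqrt_maj k)))).
    rewrite ler_wpM2l ?invr_ge0//; apply: (le_trans (cnorm_sqrB _ _)).
    by rewrite ler_pM ?addr_ge0 ?cnorm_ge0// lerD// cnorm_sqrt_iter.
  by rewrite (sqrt_majS k.+1); have := sqrt_majS k; lra.
move=> mn; rewrite -(subnK mn); elim: (n - m)%N => [|k IH].
  by rewrite !subrr cnorm0.
rewrite addSn -(subrKA (sqrt_iter x (k + m))).
apply: (le_trans (cnormD _ _)); have := step (k + m)%N; lra.
Qed.

(** The limit [y] of the iterates is [1 - sqrt (1 - x)]. As a limit of polynomials in [x] it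
    commutes with whatever commutes with [x], and is self-adjoint when [x] is. The boundary case
    [cnorm x = 1] is covered, since the majorant never exceeds 1. *)
Lemma cstar_sqrt x : cnorm x <= 1 -> exists y,
  [/\ (1 - y) * (1 - y) = 1 - x, cnorm y <= 1,
      star x = x -> star y = y
    & forall z, z * x = x * z -> z * y = y * z].
Proof.
move=> x1.
have n1 n : cnorm (sqrt_iter x n) <= 1.
  by apply: (le_trans (cnorm_sqrt_iter n x1)); have /andP[] := sqrt_maj_bounds n.
have [] := @cnorm_complete _ _ (sqrt_iter x).
  move=> e e0; have [N HN] := @sqrt_maj_cauchy (e / 2) ltac:(by rewrite divr_gt0).
  exists N => m n Nm Nn.
  rewrite -(subrKA (sqrt_iter x N)); apply: (le_lt_trans (cnormD _ _)).
  rewrite (cnormB_sym (sqrt_iter x N)).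
  have := cnorm_sqrt_iterB x1 Nm; have := cnorm_sqrt_iterB x1 Nn.
  by have := HN _ Nm; have := HN _ Nn; lra.
move=> y yl; exists y.
(* Two consecutive iterates near [y] let the recursion pass to the limit. *)
have near e : 0 < e -> exists n, cnorm (sqrt_iter x n - y) < e /\
    cnorm (sqrt_iter x n.+1 - y) < e.
  by move=> /yl[N HN]; exists N; rewrite !HN.
have y1 : cnorm y <= 1.
  apply/ler_addgt0Pr => e /near[n [yn _]].
  rewrite -(subrK (sqrt_iter x n) y); apply: (le_trans (cnormD _ _)).
  by have := n1 n; rewrite cnormB_sym; lra.
split => //.
- have fixy : y = (2^-1 : R)%:C *: (x + y * y).
    apply/subr0_eq; apply: (@cnorm_small0 2) => // e /near[n [yn yn1]].
    rewrite -(subrKA (sqrt_iter x n.+1)) {2}sqrt_iterS.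
    rewrite -scalerBr addlKB; apply: (le_trans (cnormD _ _)).
    rewrite cnormZR ?invr_ge0// (cnormB_sym y).
    have := cnorm_sqrB (sqrt_iter x n) y.
    have : (cnorm (sqrt_iter x n) + cnorm y) * cnorm (sqrt_iter x n - y) <=
        2 * cnorm (sqrt_iter x n - y).
      by rewrite ler_wpM2r ?cnorm_ge0//; have := n1 n; lra.
    by move: yn yn1; lra.
  have : y + y = x + y * y.
    rewrite {1 2}fixy -scalerDl -rmorphD /=.
    by rewrite -[2^-1]mul1r -splitr scale1r.
  move=> yy; rewrite mulrBr mulr1 mulrBl mul1r.
  have -> : y * y = y + y - x by rewrite yy addrC addKr.
  have -> : y - (y + y - x) = x - y by rewrite opprB opprD addrCA addNKr.
  by rewrite opprB subrKA.
- move=> sx; apply/subr0_eq; apply: (@cnorm_small0 2) => // e /near[n [yn _]].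
  have sn : star (sqrt_iter x n) = sqrt_iter x n.
    by elim: n {yn} => [|n IH] /=; rewrite ?star0// starZR starD starM sx IH.
  rewrite -(subrKA (sqrt_iter x n)) -{1}sn -starB.
  apply: (le_trans (cnormD _ _)); rewrite cnorm_starE cnormB_sym; lra.
- move=> z zx; apply/subr0_eq; apply: (@cnorm_small0 (2 * cnorm z)).
    by rewrite mulr_ge0 ?cnorm_ge0.
  move=> e /near[n [yn _]].
  have zn : z * sqrt_iter x n = sqrt_iter x n * z.
    elim: n {yn} => [|n IH] /=; first by rewrite mulr0 mul0r.
    by rewrite -scalerAr -scalerAl mulrDr mulrDl zx mulrA IH -mulrA IH mulrA.
  have -> : z * y - y * z = z * (y - sqrt_iter x n) + (sqrt_iter x n - y) * z.
    by rewrite mulrBr mulrBl zn addrA subrK.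
  apply: (le_trans (cnormD _ _)).
  have := cnormM z (y - sqrt_iter x n); have := cnormM (sqrt_iter x n - y) z.
  have : cnorm z * cnorm (sqrt_iter x n - y) <= cnorm z * e.
    by rewrite ler_wpM2l ?cnorm_ge0 ?ltW.
  by rewrite (cnormB_sym y) [cnorm (_ - y) * _]mulrC; lra.
Qed.

End CStarAlgebra.

Section Unitaries.
Variables (R : realType) (A : unitalCStarType R).
Implicit Types x y z h g c f u : A.

Lemma cnorm_isometry u : star u * u = 1 -> cnorm u <= 1.
Proof.
move=> u1; have := cnorm_star u; rewrite u1 => u2.
have := cnorm1_le1 A; rewrite u2 => H.
by rewrite -(@ler_pXn2r _ 2%N) ?nnegrE ?cnorm_ge0 ?expr1n.
Qed.

Lemma half_double x : (2^-1 : R)%:C *: (x + x) = x.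
Proof.
by rewrite scalerDr -scalerDl -rmorphD /= -[2^-1]mul1r -splitr scale1r.
Qed.

(** [c] and [f] are the cosine and sine of one angle, and [u] is the corresponding exponential
    [c + 'i *: f]. *)
Lemma unitary_pair c f : star c = c -> star f = f -> c * f = f * c ->
  c * c + f * f = 1 -> exists u,
  [/\ star u * u = 1, u * star u = 1 & c = (2^-1 : R)%:C *: (u + star u)].
Proof.
move=> sc sf cf cff; exists (c + 'i *: f).
have -> : star (c + 'i *: f) = c - 'i *: f.
  by rewrite starD sc starZ sf conjCi scaleNr.
have i2 : ('i * 'i : R[i]) = -1 by rewrite -expr2 sqrCi.
split.
- rewrite mulrBl !mulrDr -!scalerAr -!scalerAl scalerA i2 scaleN1r cf.
  by rewrite opprD opprK addrA addrK.
- rewrite mulrDl !mulrBr -!scalerAr -!scalerAl scalerA i2 scaleN1r cf.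
  by rewrite opprK addrA subrK.
- by rewrite addrACA subrr addr0 half_double.
Qed.

(** Stands in for the order argument from [c * c <= 1]: the complement [f * f] exhibits [c] as the
    mean of a unitary and its adjoint. *)
Lemma cnorm_le1_pair c f : star c = c -> star f = f -> c * f = f * c ->
  c * c + f * f = 1 -> cnorm c <= 1.
Proof.
move=> sc sf cf cff; have [u [u1 u2 ->]] := unitary_pair sc sf cf cff.
rewrite cnormZR ?invr_ge0//; have := cnormD u (star u).
by rewrite cnorm_starE; have := cnorm_isometry u1; lra.
Qed.

(** [w] is [sqrt (1 - h * h)]. The commutation clause is what allows [w] to be paired with [h], and
    with square roots formed later. *)
Lemma cosqrt h : star h = h -> cnorm h <= 1 -> exists w,
  [/\ star w = w, h * h + w * w = 1
    & forall z, z * h = h * z -> z * w = w * z].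
Proof.
move=> sh h1; have [|y [y2 y1 sy cy]] := @cstar_sqrt _ _ (h * h).
  by apply: (le_trans (cnormM _ _)); have := cnorm_ge0 h; nra.
exists (1 - y); split.
- by rewrite starB star1 sy// starM sh.
- by rewrite y2 addrC subrK.
- move=> z zh; rewrite mulrBr mulr1 mulrBl mul1r cy//.
  by rewrite mulrA zh -mulrA zh mulrA.
Qed.

Lemma selfadjoint_unitary h : star h = h -> cnorm h <= 1 -> exists u,
  [/\ star u * u = 1, u * star u = 1 & h = (2^-1 : R)%:C *: (u + star u)].
Proof.
move=> sh h1; have [w [sw hw cw]] := cosqrt sh h1.
by apply: (unitary_pair sh sw) => //; rewrite cw.
Qed.

(** [1 - h * h] is the square of [w], and [w] has norm at most 1 because [h] completes it to a pair
    whose squares sum to 1. *)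
Lemma cnorm_1Bsqr h : star h = h -> cnorm h <= 1 -> cnorm (1 - h * h) <= 1.
Proof.
move=> sh h1; have [w [sw hw cw]] := cosqrt sh h1.
have -> : 1 - h * h = w * w by rewrite -hw addrC addKr.
have w1 : cnorm w <= 1.
  by apply: (@cnorm_le1_pair w h) => //; rewrite ?cw// addrC.
by apply: (le_trans (cnormM _ _)); have := cnorm_ge0 w; nra.
Qed.

(** A sum of two squares is twice a square. The factor keeps the argument of [cstar_sqrt] in the
    unit ball: it is the mean of [1 - g * g] and [1 - w * w]. *)
Lemma sqrt_sum_squares g w : star g = g -> star w = w ->
  cnorm g <= 1 -> cnorm w <= 1 -> exists f,
  [/\ star f = f, f * f + f * f = g * g + w * w
    & forall z, z * g = g * z -> z * w = w * z -> z * f = f * z].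
Proof.
move=> sg sw g1 w1.
set x := (2^-1 : R)%:C *: ((1 - g * g) + (1 - w * w)).
have [|y [y2 y1 sy cy]] := @cstar_sqrt _ _ x.
  rewrite cnormZR ?invr_ge0//; have := cnormD (1 - g * g) (1 - w * w).
  by have := cnorm_1Bsqr sg g1; have := cnorm_1Bsqr sw w1; lra.
exists (1 - y); split.
- by rewrite starB star1 sy// /x starZR starD !starB star1 !starM sg sw.
- have xx : x + x = (1 - g * g) + (1 - w * w).
    by rewrite /x -scalerDr half_double.
  rewrite y2 addrACA -opprD xx [(1 - _) + _]addrACA.
  by rewrite opprD addrA subrr add0r opprD !opprK.
- move=> z zg zw; rewrite mulrBr mulr1 mulrBl mul1r cy//.
  rewrite /x -scalerAr -scalerAl; congr (_ *: _).
  rewrite mulrDr mulrDl !mulrBr !mulrBl mulr1 mul1r.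
  by rewrite !mulrA zg zw -!mulrA zg zw.
Qed.

(** Spectrally, [g * g + 1/2 <= 1]. With [h = g * g] and [y * y + w * w = 1], expanding [y * y]
    gives [h * h + (g * g + w * w) = 3/4]. The bracket equals [f * f + f * f], so after
    multiplication by 4/3 [cnorm_le1_pair] yields [sqrt (4/3) * cnorm h <= 1]. *)
Lemma cnorm_lt1_of_half g y : star g = g -> cnorm g <= 1 -> cnorm y <= 1 ->
  y = g * g + (2^-1 : R)%:C%:A -> cnorm (g * g) < 1.
Proof.
move=> sg g1 y1 yE.
have sy : star y = y.
  by rewrite yE starD starM sg starZR star1.
have [w [sw yw cw]] := cosqrt sy y1.
have gy : g * y = y * g.
  by rewrite yE mulrDr mulrDl mulrA -scalerAr -scalerAl mulr1 mul1r.
have w1 : cnorm w <= 1.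
  by apply: (@cnorm_le1_pair w y) => //; rewrite ?cw// addrC.
have [f [sf fE cf]] := sqrt_sum_squares sg sw g1 w1.
set h := g * g in yE *.
have E : h * h + (f * f + f * f) = (3 / 4 : R)%:C%:A.
  rewrite fE -/h.
  have : y * y = h * h + h + (4^-1 : R)%:C%:A.
    rewrite yE mulrDl !mulrDr -!scalerAr -!scalerAl !mulr1 mul1r scalerA.
    rewrite !addrA -[_ + _ *: h + _ *: h]addrA -scalerDr half_double.
    by rewrite -rmorphM /= -invfM -natrM.
  move=> yy; move: yw; rewrite yy => yw.
  rewrite addrA; apply: (@addrI _ ((4^-1 : R)%:C%:A)).
  rewrite -scalerDl -rmorphD /=.
  have -> : 4^-1 + 3 / 4 = 1 :> R by field.
  by rewrite (rmorph1 (real_complex R)) scale1r -[RHS]yw addrA [_ + (h * h + h)]addrC.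
have s43 : Num.sqrt (4 / 3 : R) ^+ 2 = 4 / 3 by rewrite sqr_sqrtr// divr_ge0.
have s83 : Num.sqrt (8 / 3 : R) ^+ 2 = 8 / 3 by rewrite sqr_sqrtr// divr_ge0.
have sgt : 1 < Num.sqrt (4 / 3 : R).
  have : Num.sqrt 1 < Num.sqrt (4 / 3 : R) by rewrite ltr_sqrt; lra.
  by rewrite sqrtr1.
have gf : f * g = g * f by apply/esym/cf => //; rewrite cw.
have := @cnorm_le1_pair ((Num.sqrt (4 / 3 : R))%:C *: h)
  ((Num.sqrt (8 / 3 : R))%:C *: f).
rewrite cnormZR ?sqrtr_ge0// => H.
have : Num.sqrt (4 / 3 : R) * cnorm h <= 1.
  apply: H.
  - by rewrite starZR /h starM sg.
  - by rewrite starZR sf.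
  - rewrite -!scalerAl -!scalerAr !scalerA mulrC; congr (_ *: _).
    by rewrite /h -mulrA -gf mulrA -gf mulrA.
  - rewrite -!scalerAl -!scalerAr !scalerA -!rmorphM /= -!expr2 s43 s83.
    have -> : (8 / 3 : R) = 4 / 3 + 4 / 3 by field.
    rewrite rmorphD /= [in X in _ + X]scalerDl -scalerDr -scalerDr E scalerA.
    rewrite -rmorphM /= (_ : 4 / 3 * (3 / 4) = 1 :> R); last by field.
    by rewrite (rmorph1 (real_complex R)) scale1r.
have := cnorm_ge0 h; nra.
Qed.

End Unitaries.

(** * Faithful representations *)

Section LinearFunctions.
Variables (K : nzRingType) (U V : lmodType K) (f : U -> V).
Hypothesis lf : linear f.

Lemma linear_fun0 : f 0 = 0.
Proof.
have := lf 1 0 0; rewrite !scale1r addr0 => H.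
by apply: (@addrI _ (f 0)); rewrite addr0 -H.
Qed.

Lemma linear_funD u v : f (u + v) = f u + f v.
Proof. by have := lf 1 u v; rewrite !scale1r. Qed.

Lemma linear_funZ c u : f (c *: u) = c *: f u.
Proof. by have := lf c u 0; rewrite linear_fun0 !addr0. Qed.

Lemma linear_funN u : f (- u) = - f u.
Proof. by rewrite -scaleN1r linear_funZ scaleN1r. Qed.

Lemma linear_funB u v : f (u - v) = f u - f v.
Proof. by rewrite linear_funD linear_funN. Qed.

Lemma linear_fun_sum (I : Type) (r : seq I) (P : pred I) (F : I -> U) :
  f (\sum_(i <- r | P i) F i) = \sum_(i <- r | P i) f (F i).
Proof. by apply: big_morph; [exact: linear_funD | exact: linear_fun0]. Qed.

End LinearFunctions.

Section HilbertSpace.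
Variables (R : realType) (H : hilbertType R).
Implicit Types u v w : H.

Lemma hdot_rnorm u : hdot u u = (rnorm u ^+ 2)%:C.
Proof. by rewrite hdotxx -rnormE rmorphXn. Qed.

Lemma hdot_conj u v : hdot u v = Num.conj (hdot v u).
Proof. by rewrite hermC /= expr0 mul1r. Qed.

Lemma pythagoras u v : hdot u v = 0 ->
  rnorm (u + v) ^+ 2 = rnorm u ^+ 2 + rnorm v ^+ 2.
Proof.
move=> uv; apply: complexI.
rewrite -hdot_rnorm rmorphD /= -!hdot_rnorm.
by rewrite linearDl /= !linearDr /= uv (hdot_conj v u) uv conjC0 addr0 add0r.
Qed.

Lemma hdotZ c u v : hdot (c *: u) v = c * hdot u v.
Proof. by rewrite linearZl_LR. Qed.

Lemma hdot_residual e u : rnorm e = 1 -> hdot e (u - hdot u e *: e) = 0.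
Proof.
move=> e1; rewrite linearBr /= [X in _ - X]hdot_conj hdotZ.
rewrite hdot_rnorm e1 expr1n (rmorph1 (real_complex R)) mulr1.
by rewrite -hdot_conj subrr.
Qed.

Lemma hdot_split_norm e u : rnorm e = 1 ->
  rnorm u ^+ 2 = rnorm (hdot u e) ^+ 2 + rnorm (u - hdot u e *: e) ^+ 2.
Proof.
move=> e1; have := @pythagoras (hdot u e *: e) (u - hdot u e *: e).
rewrite hdotZ hdot_residual// mulr0 => /(_ erefl).
by rewrite addrC subrK rnormZ e1 mulr1.
Qed.

Lemma rnorm_normalize v : v != 0 -> rnorm ((rnorm v)^-1%:C *: v) = 1.
Proof. by move=> v0; apply: rnorm_scale_inv; apply: contra_neq v0 => /rnorm_eq0. Qed.

Lemma cauchy_schwarz u v : rnorm (hdot u v) <= rnorm u * rnorm v.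
Proof.
have [->|v0] := eqVneq v 0.
  by rewrite linear0r rnorm0 mulr_ge0 ?rnorm_ge0.
have e1 := rnorm_normalize v0; set e := _ *: v in e1.
have -> : v = (rnorm v)%:C *: e.
  rewrite scalerA -rmorphM /= divff ?(rmorph1 (real_complex R)) ?scale1r//.
  by apply: contra_neq v0 => /rnorm_eq0.
rewrite hdot_conj hdotZ rnorm_conj rnormM rnormZ e1 mulr1 mulrC.
rewrite ler_wpM2r ?rnorm_ge0// hdot_conj rnorm_conj.
rewrite -(@ler_pXn2r _ 2%N) ?nnegrE ?rnorm_ge0//.
by rewrite (hdot_split_norm u e1) lerDl sqr_ge0.
Qed.

End HilbertSpace.

Section StarHomomorphisms.
Variables (R : realType) (A : unitalCStarType R).

Lemma automorphism1 (f : A -> A) : is_automorphism f -> f 1 = 1.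
Proof.
move=> [_ fM _ [g _ gK]].
by rewrite -[LHS]mulr1 -{2}(gK 1) -fM mul1r gK.
Qed.

(** After scaling, [h] is the mean of a unitary and its adjoint. This serves both automorphisms and,
    with [p x] the relative size of [rho x v] at a fixed [v], representations. *)
Lemma contraction_of_unitaries (p : A -> R) :
  (forall x y, p (x + y) <= p x + p y) ->
  (forall (r : R) x, 0 <= r -> p (r%:C *: x) <= r * p x) ->
  (forall u, star u * u = 1 -> p u <= 1) ->
  forall h, star h = h -> p h <= cnorm h.
Proof.
move=> pD pZ pu h sh.
have [->|h0] := eqVneq h 0.
  by have := @pZ 0 0 (lexx _); rewrite scaler0 mul0r cnorm0.
have n0 : 0 < cnorm h.
  by rewrite lt_neqAle cnorm_ge0 andbT eq_sym; apply: contra_neq h0 => /cnorm0_eq0.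
have nV : 0 <= (cnorm h)^-1 by rewrite invr_ge0 ltW.
have [||u [u1 u2 hu]] := @selfadjoint_unitary _ _ ((cnorm h)^-1%:C *: h).
- by rewrite starZR sh.
- by rewrite cnormZR// mulVf// gt_eqF.
have E : h = (cnorm h)%:C *: ((2^-1 : R)%:C *: (u + star u)).
  rewrite -hu scalerA -rmorphM /= divff ?gt_eqF//.
  by rewrite (rmorph1 (real_complex R)) scale1r.
rewrite {1}E -[leRHS]mulr1.
apply: (le_trans (pZ _ _ (ltW n0))); rewrite ler_pM2l//.
apply: (le_trans (pZ _ _ _)); first by rewrite invr_ge0.
have := pD u (star u); have := pu u u1; have := pu (star u).
by rewrite starK => /(_ u2); lra.
Qed.

Lemma automorphism_contractive (f : A -> A) a : is_automorphism f ->
  cnorm (f a) <= cnorm a.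
Proof.
move=> af; have [fl fM fs _] := af.
rewrite -(@ler_pXn2r _ 2%N) ?nnegrE ?cnorm_ge0//.
rewrite -!cnorm_star -fs -fM.
apply: (@contraction_of_unitaries (fun x => cnorm (f x))).
- by move=> x y; rewrite linear_funD// cnormD.
- by move=> r x r0; rewrite linear_funZ// cnormZR.
- by move=> u u1; apply: cnorm_isometry; rewrite -fs -fM u1 automorphism1.
- by rewrite starM starK.
Qed.

End StarHomomorphisms.

(** Estimates are carried by this real inequality in place of [opnorm], which lives in the extended
    reals; [opnorm_leP] translates. *)
Definition op_le (R : realType) (K : normedModType R[i]) (T : K -> K) (c : R) :=
  forall x, rnorm (T x) <= c * rnorm x.

Section FaithfulRep.
Variables (R : realType) (A : unitalCStarType R) (H : hilbertType R).
Variables (rho : A -> H -> H) (rep : is_faithful_rep rho).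
Implicit Types (a b g : A) (v w : H).

Lemma repD a b v : rho (a + b) v = rho a v + rho b v.
Proof. by rewrite (linear_funD (rep_linear rep)). Qed.

Lemma repZ c a v : rho (c *: a) v = c *: rho a v.
Proof. by rewrite (linear_funZ (rep_linear rep)). Qed.

Lemma repB a b v : rho (a - b) v = rho a v - rho b v.
Proof. by rewrite (linear_funB (rep_linear rep)). Qed.

Lemma rep0 v : rho 0 v = 0.
Proof. by rewrite (linear_fun0 (rep_linear rep)). Qed.

Lemma rep_sum (I : Type) (r : seq I) (P : pred I) (F : I -> A) v :
  rho (\sum_(i <- r | P i) F i) v = \sum_(i <- r | P i) rho (F i) v.
Proof.
by apply: (big_morph (fun a => rho a v)); [move=> a b; exact: repD | exact: rep0].
Qed.

Lemma rep_mul a b v : rho (a * b) v = rho a (rho b v).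
Proof. by rewrite (repM rep). Qed.

Lemma rep_lin a : linear (rho a).
Proof. exact: (rep_bounded rep a).1. Qed.

(** Since [rho 1] need not be the identity, [<rho u v, rho u v> = <v, rho 1 v>] gives only the bound
    [rnorm v * rnorm (rho 1 v)]. The case [u = 1] first shows that [rho 1] is a contraction. *)
Lemma rep_isometry u v : star u * u = 1 -> rnorm (rho u v) <= rnorm v.
Proof.
have E x w : star x * x = 1 -> rnorm (rho x w) ^+ 2 <= rnorm w * rnorm (rho 1 w).
  move=> x1; have := cauchy_schwarz w (rho 1 w).
  rewrite -{1}x1 rep_mul -(rep_star rep) hdot_rnorm rnorm_real.
  by rewrite ger0_norm// sqr_ge0.
have rep1 w : rnorm (rho 1 w) <= rnorm w.
  have := E 1 w; rewrite star1 mulr1 => /(_ erefl).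
  have := rnorm_ge0 (rho 1 w); rewrite le_eqVlt => /orP[/eqP<-|r0].
    by rewrite rnorm_ge0.
  by rewrite expr2 ler_pM2r.
move=> u1; rewrite -(@ler_pXn2r _ 2%N) ?nnegrE ?rnorm_ge0//.
apply: (le_trans (E u v u1)).
by rewrite expr2 ler_wpM2l ?rnorm_ge0.
Qed.

Lemma rep_contractive a : op_le (rho a) (cnorm a).
Proof.
have sa h v : star h = h -> rnorm (rho h v) <= cnorm h * rnorm v.
  move=> sh; have [->|v0] := eqVneq v 0.
    by rewrite (linear_fun0 (rep_lin h)) rnorm0 mulr0.
  have n0 : 0 < rnorm v.
    by rewrite lt_neqAle rnorm_ge0 andbT eq_sym; apply: contra_neq v0 => /rnorm_eq0.
  rewrite -ler_pdivrMr//.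
  apply: (@contraction_of_unitaries _ _ (fun x => rnorm (rho x v) / rnorm v)) => //.
  - move=> x y; rewrite -mulrDl ler_wpM2r ?invr_ge0 ?rnorm_ge0//.
    by rewrite repD ler_rnormD.
  - by move=> r x r0; rewrite repZ rnormZ rnorm_real ger0_norm// mulrA.
  - by move=> u u1; rewrite ler_pdivrMr// mul1r rep_isometry.
move=> v; rewrite -(@ler_pXn2r _ 2%N) ?nnegrE ?mulr_ge0 ?cnorm_ge0 ?rnorm_ge0//.
have -> : rnorm (rho a v) ^+ 2 = rnorm (hdot v (rho (star a * a) v)).
  rewrite rep_mul -(rep_star rep) hdot_rnorm rnorm_real.
  by rewrite ger0_norm// sqr_ge0.
apply: (le_trans (cauchy_schwarz _ _)).
rewrite exprMn mulrC [in X in _ <= X * _]expr2 -[in leRHS]expr2 -cnorm_star.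
rewrite [rnorm v ^+ 2]expr2 mulrA ler_wpM2r ?rnorm_ge0// sa//.
by rewrite starM starK.
Qed.

(* For [g] self-adjoint of norm 1 with [rho g] of norm at most [1/2], put
   [k = g * g - 1/2] and [s = |k|].  Then [rho (k - s)] is bounded below on
   [rho 1 H], so [(k - s) * (k + s) = 0] forces [k = - s], i.e. [g * g <= 1/2]. *)
Lemma rep_half_sa g : star g = g -> cnorm g = 1 -> ~ op_le (rho g) 2^-1.
Proof.
move=> sg g1 gle.
have gg1 : cnorm (g * g) = 1 by rewrite -{1}sg cnorm_star g1 expr1n.
set k := g * g - (2^-1 : R)%:C%:A.
have sk : star k = k by rewrite /k starB starM sg starZR star1.
have k1 : cnorm k <= 1.
  have -> : k = (2^-1 : R)%:C *: (g * g) - (2^-1 : R)%:C *: (1 - g * g).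
    by rewrite -scalerBr opprB addrA scalerBr half_double.
  apply: (le_trans (cnormB _ _)); rewrite !cnormZR ?invr_ge0// gg1.
  by have := cnorm_1Bsqr sg; rewrite g1 lexx => /(_ isT); lra.
have [y [y2 y1 sy cy]] := cstar_sqrt (cnorm_1Bsqr sk k1).
rewrite subKr in y2.
set s := 1 - y in y2.
have ks : k * s = s * k.
  have comm1B z x : z * x = x * z -> z * (1 - x) = (1 - x) * z.
    by move=> zx; rewrite mulrBr mulr1 mulrBl mul1r zx.
  by apply/comm1B/cy/comm1B; rewrite mulrA.
have prod0 : (k - s) * (k + s) = 0.
  have sqrB (a b : A) : a * b = b * a -> b * b = a * a -> (a - b) * (a + b) = 0.
    by move=> ab bb; rewrite mulrBl !mulrDr bb ab [b * a + _]addrC subrr.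
  exact: sqrB.
have p0 : k + s = 0.
  apply: (rep_inj rep); apply/funext => w; rewrite rep0.
  set v := rho (k + s) w.
  have v1 : rho 1 v = v by rewrite /v -rep_mul mul1r.
  have : rho (k - s) v = 0 by rewrite /v -rep_mul prod0 rep0.
  (* So [rho (g * g + y) v] is [3/2] times [v], while [rho (g * g)] and [rho y] have norms at most
     1/4 and 1; hence [v = 0]. *)
  have -> : k - s = (g * g + y) - (3 / 2 : R)%:C%:A.
    rewrite /k /s opprB addrACA -opprD; congr (_ - _).
    have -> : 3 / 2 = 2^-1 + 1 :> R by field.
    by rewrite rmorphD /= (rmorph1 (real_complex R)) [RHS]scalerDl scale1r.
  rewrite repB repD repZ v1 => /subr0_eq E.
  have := ler_rnormD (rho (g * g) v) (rho y v); rewrite E rnormZ rnorm_real.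
  rewrite ger0_norm ?divr_ge0// rep_mul.
  have := gle (rho g v); have := gle v; have := rep_contractive y v.
  have n0 := rnorm_ge0 v.
  have : cnorm y * rnorm v <= 1 * rnorm v by rewrite ler_wpM2r.
  move=> *; apply: rnorm_eq0; apply/le_anti; rewrite n0 andbT; lra.
(* As [s = 1 - y], the relation [k + s = 0] reads [y = g * g + 1/2]. *)
have : cnorm (g * g) < 1.
  apply: (@cnorm_lt1_of_half _ _ g y) => //; first by rewrite g1.
  move/eqP: p0; rewrite addrA subr_eq0 => /eqP <-.
  rewrite /k -addrA; congr (_ + _).
  by apply/eqP; rewrite addrC subr_eq eq_sym -scalerDr half_double.
by rewrite gg1 ltxx.
Qed.

(** If [cnorm a > 2 * c], then [star a * a] divided by [cnorm a ^+ 2] is self-adjoint of norm 1 and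
    acts with norm at most [c / cnorm a < 1/2], which [rep_half_sa] excludes. *)
Lemma rep_bounded_below a c : 0 <= c -> op_le (rho a) c -> cnorm a <= 2 * c.
Proof.
move=> c0 ac; rewrite leNgt; apply/negP => ca.
have n0 : 0 < cnorm a by lra.
have m0 : 0 <= (cnorm a ^+ 2)^-1 by rewrite invr_ge0 sqr_ge0.
apply: (@rep_half_sa ((cnorm a ^+ 2)^-1%:C *: (star a * a))).
- by rewrite starZR starM starK.
- by rewrite cnormZR// cnorm_star mulVf// expf_neq0// gt_eqF.
move=> v; rewrite repZ rnormZ rnorm_real ger0_norm// rep_mul.
have := rep_contractive (star a) (rho a v); rewrite cnorm_starE => H1.
have H2 := ac v.
apply: (@le_trans _ _ ((cnorm a ^+ 2)^-1 * (cnorm a * (c * rnorm v)))).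
  rewrite ler_wpM2l//; apply: (le_trans H1); rewrite ler_wpM2l//; exact: ltW.
rewrite !mulrA ler_wpM2r ?rnorm_ge0//.
rewrite expr2 invfM -[_ / _ * cnorm a]mulrA mulVf ?gt_eqF// mulr1.
by rewrite ler_pdivrMl//; lra.
Qed.

End FaithfulRep.

(** * Square summable families *)

Section Completeness.
Variable R : realType.

Definition rcomplete (K : normedModType R[i]) := forall u : nat -> K,
  (forall e, 0 < e -> exists N, forall m n, (N <= m)%N -> (N <= n)%N ->
     rnorm (u m - u n) < e) ->
  exists l, forall e, 0 < e -> exists N, forall n, (N <= n)%N ->
     rnorm (u n - l) < e.

Lemma completeNormedMod_rcomplete (H : completeNormedModType R[i]) : rcomplete H.
Proof.
move=> u cu.
have lt_rnorm (v : H) (e : R[i]) : 0 < e -> (`|v| < e) = (rnorm v < complex.Re e).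
  move=> e0; have eE : e = (complex.Re e)%:C.
    by move: e0; case: e => a b; rewrite ltcE /= => /andP[/eqP->].
  by rewrite {1}eE -rnormE ltcR.
have Re_gt0 (e : R[i]) : 0 < e -> 0 < complex.Re e.
  by case: e => a b; rewrite ltcE /= => /andP[].
have : cvg (u @ \oo).
  apply/cauchy_cvgP/cauchy_exP => e e0.
  have [N HN] := cu _ (Re_gt0 _ e0).
  exists (u N), N => // n /= Nn.
  by rewrite -ball_normE /ball_ /= lt_rnorm// HN.
move=> /cvgrPdist_lt ul; exists (lim (u @ \oo)) => e e0.
have [|N _ HN] := ul e%:C; first by rewrite ltcR.
exists N => n Nn; have := HN n Nn.
by rewrite lt_rnorm ?ltcR//= rnormB_sym.
Qed.

End Completeness.

Section L2Theory.
Variables (R : realType) (I : choiceType) (H : normedModType R[i]).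
Implicit Types (x y : l2 I H) (P : seq I).

Lemma l2DE x y s : (x + y) s = x s + y s.
Proof. by []. Qed.

Lemma l2ZE c x s : (c *: x) s = c *: x s.
Proof. by []. Qed.

Lemma l2BE x y s : (x - y) s = x s - y s.
Proof. by []. Qed.

Lemma l2_sumE (J : Type) (r : seq J) (Q : pred J) (F : J -> l2 I H) s :
  (\sum_(j <- r | Q j) F j) s = \sum_(j <- r | Q j) F j s.
Proof. by apply: (big_morph (fun x : l2 I H => x s)). Qed.

Lemma l2P x y : (forall s, x s = y s) -> x = y.
Proof. by move=> xy; apply: val_inj; apply/funext. Qed.

Lemma sum_le_l2_sqnorm (f : I -> H) P : uniq P ->
  ((\sum_(s <- P) rnorm (f s) ^+ 2)%:E <= l2_sqnorm f)%E.
Proof.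
move=> uP; apply: ereal_sup_ubound; exists [set` P]; first by split.
by rewrite -fsbig_seq// sumEFin.
Qed.

Lemma l2_sqnorm_le (f : I -> H) (M : R) :
  (forall P, uniq P -> \sum_(s <- P) rnorm (f s) ^+ 2 <= M) ->
  (l2_sqnorm f <= M%:E)%E.
Proof.
move=> fM; apply: ub_ereal_sup => _ [B [finB _] <-].
by rewrite fsbig_finite//= sumEFin lee_fin fM.
Qed.

Lemma l2_sqr_rnorm x : rnorm x ^+ 2 = fine (l2_sqnorm x).
Proof. by rewrite [rnorm x]/= sqr_sqrtr// l2_fine_ge0. Qed.

Lemma l2_sum_le x P : uniq P -> \sum_(s <- P) rnorm (x s) ^+ 2 <= rnorm x ^+ 2.
Proof.
move=> uP; rewrite l2_sqr_rnorm -lee_fin fineK ?l2_sqnorm_fin//.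
exact: sum_le_l2_sqnorm.
Qed.

Lemma l2_rnorm_le x c : 0 <= c ->
  (forall P, uniq P -> \sum_(s <- P) rnorm (x s) ^+ 2 <= c ^+ 2) -> rnorm x <= c.
Proof.
move=> c0 xc; rewrite -(@ler_pXn2r _ 2%N) ?nnegrE ?rnorm_ge0//.
by rewrite l2_sqr_rnorm -lee_fin fineK ?l2_sqnorm_fin// l2_sqnorm_le.
Qed.

Lemma l2_eval_le x s : rnorm (x s) <= rnorm x.
Proof.
rewrite -(@ler_pXn2r _ 2%N) ?nnegrE ?rnorm_ge0//.
by have := @l2_sum_le x [:: s] isT; rewrite big_seq1.
Qed.

Lemma l2_insubd (f : I -> H) (M : R) :
  (forall P, uniq P -> \sum_(s <- P) rnorm (f s) ^+ 2 <= M) ->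
  (insubd (0 : l2 I H) f : I -> H) = f.
Proof.
move=> fM; rewrite insubdK// unfold_in; apply/asboolP.
by rewrite (le_lt_trans (l2_sqnorm_le fM))// ltry.
Qed.

Definition l2_delta (r : I) (v : H) : l2 I H :=
  insubd (0 : l2 I H) (fun s => if s == r then v else 0).

Lemma l2_deltaE r v s : l2_delta r v s = if s == r then v else 0.
Proof.
rewrite /l2_delta (@l2_insubd _ (rnorm v ^+ 2))// => P uP.
rewrite (bigID (pred1 r))/= [X in _ + X]big1 ?addr0; last first.
  by move=> i /negbTE ->; rewrite rnorm0 expr0n.
rewrite (eq_bigr (fun=> rnorm v ^+ 2)); last by move=> i ->.
by rewrite big_const_seq count_uniq_mem//; case: (_ \in _); rewrite /= ?addr0// sqr_ge0.
Qed.

Lemma rnorm_sum_delta (J : finType) (r : J -> I) (v : J -> H) : injective r ->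
  rnorm (\sum_j l2_delta (r j) (v j)) ^+ 2 <= \sum_j rnorm (v j) ^+ 2.
Proof.
move=> rI; have S0 : 0 <= \sum_j rnorm (v j) ^+ 2.
  by apply: sumr_ge0 => j _; exact: sqr_ge0.
rewrite -[leRHS]sqr_sqrtr// ler_pXn2r ?nnegrE ?rnorm_ge0 ?sqrtr_ge0//.
apply: l2_rnorm_le; rewrite ?sqrtr_ge0// sqr_sqrtr// => P uP.
apply: (@le_trans _ _ (\sum_(s <- P) \sum_(j | r j == s) rnorm (v j) ^+ 2)).
  apply: ler_sum => s _; rewrite l2_sumE.
  have [j /eqP rj|nj] := pickP (fun j => r j == s).
    rewrite (bigD1 j)//= big1 ?addr0; last first.
      move=> i ij; rewrite l2_deltaE -rj (inj_eq rI) eq_sym.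
      by rewrite (negbTE ij).
    rewrite l2_deltaE rj eqxx (bigD1 j) ?rj//= lerDl.
    by apply: sumr_ge0 => i _; exact: sqr_ge0.
  rewrite big1 ?rnorm0 ?expr0n/=; last first.
    by move=> j _; rewrite l2_deltaE eq_sym nj.
  by apply: sumr_ge0 => i _; exact: sqr_ge0.
rewrite (exchange_big_dep xpredT)//=; apply: ler_sum => j _.
rewrite -big_filter big_const_seq count_predT size_filter.
have : (count (fun s => r j == s) P <= 1)%N.
  have := count_uniq_mem (r j) uP; rewrite (eq_count (a2 := pred1 (r j))).
    by move=> ->; case: (_ \in _).
  by move=> s /=; rewrite eq_sym.
by case: count => [|[|]]//= _; rewrite ?addr0// sqr_ge0.
Qed.

Lemma rnorm_delta r v : rnorm (l2_delta r v) <= rnorm v.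
Proof.
have := @rnorm_sum_delta unit (fun=> r) (fun=> v).
rewrite !(big_pred1 tt); try by case.
rewrite ler_pXn2r ?nnegrE ?rnorm_ge0//; apply.
by case=> [] [].
Qed.

Lemma l2_rcomplete : rcomplete H -> rcomplete (l2 I H).
Proof.
move=> cH u cu.
have ptw s : exists l, forall e, 0 < e -> exists N, forall n, (N <= n)%N ->
    rnorm (u n s - l) < e.
  apply: cH => e /cu[N HN]; exists N => m n Nm Nn.
  by apply: le_lt_trans (HN m n Nm Nn); rewrite -l2BE l2_eval_le.
have [f fl] := choice ptw.
have unif P d : 0 < d -> exists N, forall n, (N <= n)%N ->
    forall s, s \in P -> rnorm (u n s - f s) < d.
  move=> d0; elim: P => [|t P [N HN]]; first by exists 0%N.
  have [N' HN'] := fl t d d0; exists (maxn N N') => n.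
  rewrite geq_max => /andP[Nn N'n] s; rewrite in_cons => /orP[/eqP->|sP].
    exact: HN'.
  exact: HN.
(* On a finite [P], compare with some [u m] already uniformly close to [f] there: [m] depends on
   [P], the bound does not. Each of the two differences contributes [2 * e ^+ 2]. *)
have tail e : 0 < e -> exists N, forall n, (N <= n)%N -> forall P, uniq P ->
    \sum_(s <- P) rnorm (u n s - f s) ^+ 2 <= (2 * e) ^+ 2.
  move=> e0; have [N HN] := cu e e0; exists N => n Nn P uP.
  have sz0 : 0 < (size P).+1%:R :> R by rewrite ltr0n.
  have d0 : 0 < e / (size P).+1%:R by apply: divr_gt0.
  have [N' HN'] := unif P _ d0.
  set m := maxn N N'.
  apply: (@le_trans _ _ (\sum_(s <- P) (2 * rnorm (u n s - u m s) ^+ 2 +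
     2 * (e / (size P).+1%:R) ^+ 2))).
    rewrite big_seq [leRHS]big_seq; apply: ler_sum => s sP.
    have := HN' m (leq_maxr _ _) s sP.
    have := ler_rnormD (u n s - u m s) (u m s - f s); rewrite subrKA.
    set a := rnorm (u n s - u m s); set b := rnorm (u m s - f s).
    set c := rnorm _; set d := e / _.
    have : 0 <= a by exact: rnorm_ge0.
    have : 0 <= b by exact: rnorm_ge0.
    have : 0 <= c by exact: rnorm_ge0.
    have := sqr_ge0 (a - b); nra.
  rewrite big_split /= -mulr_sumr big_const_seq count_predT iter_addr_0.
  have S1 : \sum_(s <- P) rnorm (u n s - u m s) ^+ 2 <= e ^+ 2.
    apply: (le_trans (l2_sum_le (u n - u m) uP)).
    by rewrite ler_pXn2r ?nnegrE ?rnorm_ge0 ?ltW// HN// leq_maxl.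
  have S2 : (e / (size P).+1%:R) ^+ 2 *+ size P <= e ^+ 2.
    rewrite expr_div_n -mulr_natr -mulrA ler_piMr ?sqr_ge0//.
    rewrite mulrC ler_pdivrMr ?exprn_gt0// mul1r -natrX ler_nat.
    by rewrite (leq_trans (leqnSn _))// -{1}(expn1 (size P).+1) leq_pexp2l.
  have -> : (2 * e) ^+ 2 = 2 * e ^+ 2 + 2 * e ^+ 2 by ring.
  by rewrite -mulrnAr lerD// ler_wpM2l.
have [N HN] := tail 1 ltr01.
(* 8 is twice the bound [(2 * 1) ^+ 2] given by [tail] at [e = 1]. *)
have fin P : uniq P -> \sum_(s <- P) rnorm (f s) ^+ 2 <= 8 + 2 * rnorm (u N) ^+ 2.
  move=> uP; apply: (@le_trans _ _ (\sum_(s <- P) (2 * rnorm (u N s - f s) ^+ 2 +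
      2 * rnorm (u N s) ^+ 2))).
    apply: ler_sum => s _.
    have := ler_rnormD (f s - u N s) (u N s); rewrite subrK rnormB_sym.
    set a := rnorm (u N s - f s); set b := rnorm (u N s); set c := rnorm _.
    have : 0 <= a by exact: rnorm_ge0.
    have : 0 <= b by exact: rnorm_ge0.
    have : 0 <= c by exact: rnorm_ge0.
    have := sqr_ge0 (a - b); nra.
  rewrite big_split /= -!mulr_sumr.
  by have := HN N (leqnn _) P uP; have := l2_sum_le (u N) uP; lra.
exists (insubd (0 : l2 I H) f) => e e0.
have [|N' HN'] := tail (e / 3); first by apply: divr_gt0.
exists N' => n Nn; apply: (@le_lt_trans _ _ (2 * (e / 3))); last by lra.
apply: l2_rnorm_le => [|P uP]; first lra.
apply: le_trans (HN' n Nn P uP).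
by under eq_bigr do rewrite l2BE (l2_insubd fin).
Qed.

End L2Theory.

(** * Operator norms and sums of operators *)

Section Operators.
Variables (R : realType) (K : normedModType R[i]).
Implicit Types (S T : K -> K) (c d : R).

Lemma fct_addE S T x : (S + T) x = S x + T x. Proof. by []. Qed.
Lemma fct_subE S T x : (S - T) x = S x - T x. Proof. by []. Qed.
Lemma fct_scaleE (a : R[i]) T x : (a *: T) x = a *: T x. Proof. by []. Qed.

Lemma fct_sum_applyE (J : Type) (r : seq J) (P : pred J) (F : J -> K -> K) x :
  (\sum_(i <- r | P i) F i) x = \sum_(i <- r | P i) F i x.
Proof. by apply: (big_morph (fun T : K -> K => T x)). Qed.

Lemma linear_fct0 : linear (0 : K -> K).
Proof. by move=> a u v /=; rewrite scaler0 addr0. Qed.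

Lemma linear_fctD S T : linear S -> linear T -> linear (S + T).
Proof.
move=> lS lT a u v; rewrite !fct_addE lS lT scalerDr -!addrA; congr (_ + _).
by rewrite addrCA.
Qed.

Lemma linear_fctZ (a : R[i]) T : linear T -> linear (a *: T).
Proof.
move=> lT b u v; rewrite !fct_scaleE lT scalerDr !scalerA; congr (_ *: _ + _).
exact: mulrC.
Qed.

Lemma linear_fctN T : linear T -> linear (- T).
Proof. by move=> lT; rewrite -scaleN1r; exact: linear_fctZ. Qed.

Lemma linear_fctB S T : linear S -> linear T -> linear (S - T).
Proof. by move=> lS lT; apply: linear_fctD => //; exact: linear_fctN. Qed.

Lemma linear_fct_sum (J : Type) (r : seq J) (P : pred J) (F : J -> K -> K) :
  (forall j, P j -> linear (F j)) -> linear (\sum_(i <- r | P i) F i).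
Proof.
move=> lF; elim/big_ind : _ => //; first exact: linear_fct0.
by move=> S T; exact: linear_fctD.
Qed.

Lemma op_le0 : op_le (0 : K -> K) 0.
Proof. by move=> x; rewrite rnorm0 mul0r. Qed.

Lemma op_leW T c d : c <= d -> op_le T c -> op_le T d.
Proof.
by move=> cd Tc x; apply: (le_trans (Tc x)); rewrite ler_wpM2r ?rnorm_ge0.
Qed.

Lemma op_leD S T c d : op_le S c -> op_le T d -> op_le (S + T) (c + d).
Proof.
move=> Sc Td x; rewrite fct_addE mulrDl.
by apply: (le_trans (ler_rnormD _ _)); exact: lerD.
Qed.

Lemma op_leN T c : op_le T c -> op_le (- T) c.
Proof. by move=> Tc x; rewrite rnormN. Qed.

Lemma op_leB S T c d : op_le S c -> op_le T d -> op_le (S - T) (c + d).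
Proof. by move=> Sc /op_leN; exact: op_leD. Qed.

Lemma op_leB_sym S T c : op_le (S - T) c -> op_le (T - S) c.
Proof. by move=> /op_leN; rewrite opprB. Qed.

Lemma op_leB_trans S T U c d :
  op_le (S - T) c -> op_le (T - U) d -> op_le (S - U) (c + d).
Proof. by move=> ST TU; rewrite -(subrKA T); exact: op_leD. Qed.

Lemma op_leZ (a : R[i]) T c : op_le T c -> op_le (a *: T) (rnorm a * c).
Proof.
move=> Tc x; rewrite fct_scaleE rnormZ -mulrA ler_wpM2l ?rnorm_ge0//.
Qed.

Lemma op_le_sum (J : Type) (r : seq J) (P : pred J) (F : J -> K -> K) (c : J -> R) :
  (forall j, P j -> op_le (F j) (c j)) ->
  op_le (\sum_(i <- r | P i) F i) (\sum_(i <- r | P i) c i).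
Proof.
move=> Fc; elim/big_rec2 : _ => [|j S d Pj Sd]; first exact: op_le0.
by apply: op_leD => //; exact: Fc.
Qed.

Lemma op_le_eq S T : (forall e, 0 < e -> op_le (S - T) e) -> S = T.
Proof.
move=> ST; apply/funext => x; apply/subr0_eq/rnorm_eq0/le_anti.
rewrite rnorm_ge0 andbT; apply/ler_addgt0Pr => e e0; rewrite add0r.
have x1 : 0 < rnorm x + 1 by have := rnorm_ge0 x; lra.
have /(_ x) H := ST _ (divr_gt0 e0 x1).
apply: (le_trans H); rewrite mulrAC ler_pdivrMr// ler_pM2l//; lra.
Qed.

Lemma opnorm_leP T c : linear T -> 0 <= c ->
  (opnorm T <= c%:E)%E <-> op_le T c.
Proof.
move=> lT c0; split=> [Tc x|Tc].
  have [/rnorm_eq0->|x0] := eqVneq (rnorm x) 0.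
    by rewrite linear_fun0// rnorm0 mulr0.
  have : ((rnorm (T ((rnorm x)^-1%:C *: x)))%:E <= c%:E)%E.
    apply: le_trans Tc; apply: ereal_sup_ubound; exists ((rnorm x)^-1%:C *: x) => //=.
    by rewrite rnorm_scale_inv.
  rewrite lee_fin linear_funZ// rnormZ rnorm_real ger0_norm ?invr_ge0 ?rnorm_ge0//.
  by rewrite ler_pdivrMl ?lt_neqAle ?rnorm_ge0 1?eq_sym ?x0// mulrC.
apply: ub_ereal_sup => _ [x /= x1 <-]; rewrite lee_fin.
by apply: (le_trans (Tc x)); rewrite -[leRHS]mulr1 ler_wpM2l.
Qed.

Lemma opnorm_ge0 T : linear T -> (0 <= opnorm T)%E.
Proof.
move=> lT; apply: ereal_sup_ubound; exists 0 => /=; first by rewrite rnorm0 ler01.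
by rewrite linear_fun0// rnorm0.
Qed.

Lemma bounded_opP T : bounded_op T <-> linear T /\ exists2 c, 0 <= c & op_le T c.
Proof.
split=> [[lT Tfin]|[lT [c c0 Tc]]]; split=> //.
  have fn : opnorm T \is a fin_num by rewrite ge0_fin_numE ?opnorm_ge0.
  exists (fine (opnorm T)); first by rewrite fine_ge0 ?opnorm_ge0.
  by apply/opnorm_leP; rewrite ?fine_ge0 ?opnorm_ge0// fineK.
by apply: (@le_lt_trans _ _ c%:E); [exact/opnorm_leP|rewrite ltry].
Qed.

Lemma op_has_sumP (G : choiceType) (u : G -> K -> K) T :
  (forall s, linear (u s)) ->
  op_has_sum u T <-> bounded_op T /\
   forall e : R, 0 < e -> exists F0 : {fset G}, forall F : {fset G},
    (F0 `<=` F)%fset -> op_le (T - \sum_(s <- F) u s) e.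
Proof.
move=> lu; split=> -[bT H]; split=> // e e0; have [F0 HF] := H e e0;
  exists F0 => F F0F; have [lT _] := bT; have H0 := HF F F0F.
- apply/opnorm_leP; [|exact: ltW|exact: H0].
  by apply: linear_fctB => //; exact: linear_fct_sum.
- apply/opnorm_leP; [|exact: ltW|exact: H0].
  by apply: linear_fctB => //; exact: linear_fct_sum.
Qed.

Lemma op_has_sum_uniq (G : choiceType) (u : G -> K -> K) T T' :
  (forall s, linear (u s)) -> op_has_sum u T -> op_has_sum u T' -> T = T'.
Proof.
move=> lu /op_has_sumP-/(_ lu)[_ H] /op_has_sumP-/(_ lu)[_ H'].
apply: op_le_eq => e e0; have e2 : 0 < e / 2 by apply: divr_gt0.
have [F HF] := H _ e2; have [F' HF'] := H' _ e2.
rewrite [e]splitr; apply: (op_leB_trans (HF _ (fsubsetUl F F'))).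
exact/op_leB_sym/HF'/fsubsetUr.
Qed.

Lemma op_sumE (G : choiceType) (u : G -> K -> K) T :
  (forall s, linear (u s)) -> op_has_sum u T -> op_sum u = T.
Proof.
move=> lu uT; apply: xget_unique => // T' uT'; exact: op_has_sum_uniq uT' uT.
Qed.

Lemma op_has_sum_finite (G : choiceType) (u : G -> K -> K) (F0 : {fset G}) :
  (forall s, bounded_op (u s)) -> (forall s, s \notin F0 -> u s = 0) ->
  op_has_sum u (\sum_(s <- F0) u s).
Proof.
move=> bu u0; apply/op_has_sumP => [s|]; first by case: (bu s).
split.
  apply/bounded_opP; split; first by apply: linear_fct_sum => s _; case: (bu s).
  have /choice[c Hc] : forall s, exists c, 0 <= c /\ op_le (u s) c.
    by move=> s; have /bounded_opP[_ [c c0 uc]] := bu s; exists c.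
  exists (\sum_(s <- F0) c s); first by apply: sumr_ge0 => s _; case: (Hc s).
  by apply: op_le_sum => s _; case: (Hc s).
move=> e e0; exists F0 => F F0F; apply: op_leW (ltW e0) _.
rewrite (fset_sum_split _ F0F) [X in _ - (_ + X)]big1 ?addr0; first by rewrite subrr; exact: op_le0.
by move=> s /u0.
Qed.

(** The rate is kept in the conclusion because [op_has_sum_summable] compares the limit with one
    prescribed partial sum. *)
Lemma op_rcomplete (T_ : nat -> K -> K) : rcomplete K ->
  (forall n, linear (T_ n)) -> (exists c, op_le (T_ 0%N) c) ->
  (forall m n : nat, op_le (T_ m - T_ n) (m.+1%:R^-1 + n.+1%:R^-1)) ->
  exists T, linear T /\ forall n : nat, op_le (T_ n - T) (n.+1%:R^-1).
Proof.
move=> cK lT [c0 T0] cT.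
have small (r : R) : 0 < r -> exists N : nat, forall n, (N <= n)%N -> n.+1%:R^-1 < r.
  move=> r0; have [N HN] := ltr_add_invr (y := 0) (x := r) r0.
  exists N => n Nn; rewrite add0r in HN; apply: le_lt_trans HN.
  by rewrite lef_pV2 ?posrE ?ltr0n// ler_nat.
have ptw x : exists l, forall e, 0 < e -> exists N, forall n, (N <= n)%N ->
    rnorm (T_ n x - l) < e.
  apply: cK => e e0; have x1 : 0 < rnorm x + 1 by have := rnorm_ge0 x; lra.
  have r0 : 0 < e / 2 / (rnorm x + 1) by rewrite !divr_gt0.
  have [N HN] := small _ r0; exists N => m n Nm Nn.
  have := cT m n x; rewrite fct_subE => /le_lt_trans; apply.
  have Sm := HN m Nm; have Sn := HN n Nn.
  apply: (@le_lt_trans _ _ ((m.+1%:R^-1 + n.+1%:R^-1) * (rnorm x + 1))).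
    by rewrite ler_wpM2l ?addr_ge0 ?invr_ge0//; lra.
  move: Sm Sn; rewrite !(ltr_pdivlMr _ _ x1) [in X in _ -> _ -> X]mulrDl.
  by move=> Sm Sn; rewrite [e]splitr; exact: ltrD.
have [T HT] := choice ptw; exists T.
have near x y z e : 0 < e -> exists n, [/\ rnorm (T_ n x - T x) < e,
    rnorm (T_ n y - T y) < e & rnorm (T_ n z - T z) < e].
  move=> e0; have [N1 H1] := HT x e e0; have [N2 H2] := HT y e e0.
  have [N3 H3] := HT z e e0; exists (maxn N1 (maxn N2 N3)); split.
  - by rewrite H1// leq_maxl.
  - by rewrite H2// leq_max leq_maxl orbT.
  - by rewrite H3// !leq_max leqnn !orbT.
split.
  move=> a x y; apply/subr0_eq/rnorm_eq0/le_anti; rewrite rnorm_ge0 andbT.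
  apply/ler_addgt0Pr => e e0; rewrite add0r.
  have c1 : 0 < rnorm a + 2 by have := rnorm_ge0 a; lra.
  have [n [n1 n2 n3]] := near (a *: x + y) x y _ (divr_gt0 e0 c1).
  have -> : T (a *: x + y) - (a *: T x + T y) =
      - (T_ n (a *: x + y) - T (a *: x + y)) + (a *: (T_ n x - T x) + (T_ n y - T y)).
    rewrite scalerBr addrACA -lT opprB -opprD.
    by rewrite addrA subrK.
  apply: (le_trans (ler_rnormD _ _)); rewrite rnormN.
  have := ler_rnormD (a *: (T_ n x - T x)) (T_ n y - T y); rewrite rnormZ.
  have : rnorm a * rnorm (T_ n x - T x) <= rnorm a * (e / (rnorm a + 2)).
    by rewrite ler_wpM2l ?rnorm_ge0 ?ltW.
  have : (rnorm a + 2) * (e / (rnorm a + 2)) = e.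
    by rewrite mulrC divfK// gt_eqF.
  rewrite mulrDl; lra.
move=> n x; rewrite fct_subE; apply/ler_addgt0Pr => e e0.
have [N HN] := HT x (e / 2) ltac:(by rewrite divr_gt0).
have x1 : 0 < rnorm x + 1 by have := rnorm_ge0 x; lra.
have [N' HN'] := small (e / 2 / (rnorm x + 1)) ltac:(by rewrite !divr_gt0).
set m := maxn N N'.
have := ler_rnormD (T_ n x - T_ m x) (T_ m x - T x); rewrite subrKA => /le_trans; apply.
have := HN m (leq_maxl _ _); have := HN' m (leq_maxr _ _).
have := cT n m x; rewrite fct_subE ltr_pdivlMr//.
set p := m.+1%:R^-1 in HN' *; set q := n.+1%:R^-1 => A B C.
have : p * rnorm x <= p * (rnorm x + 1).
  by rewrite ler_wpM2l ?invr_ge0//; lra.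
by move: A; rewrite mulrDl => A D; clearbody p q; lra.
Qed.

End Operators.

Section Summable.
Variables (R : realType) (K : normedModType R[i]).

(** [F_ n] exhausts the total of the [c s] up to [1/(n+1)]; two such partial sums are compared
    through the union of their index sets. *)
Lemma op_has_sum_summable (G : choiceType) (u : G -> K -> K) (c : G -> R) (M : R) :
  rcomplete K -> (forall s, linear (u s)) -> (forall s, 0 <= c s) ->
  (forall s, op_le (u s) (c s)) ->
  (forall F : {fset G}, \sum_(s <- F) c s <= M) -> exists T, op_has_sum u T.
Proof.
move=> cK lu c0 uc cM.
set E := [set \sum_(s <- F) c s | F in [set: {fset G}]].
have supE : has_sup E.
  split; first by exists (\sum_(s <- fset0) c s); exists fset0.
  by exists M => _ [F _ <-].
have /choice[F_ HF] : forall n : nat, exists F : {fset G}, forall F', (F `<=` F')%fset ->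
    op_le (\sum_(s <- F') u s - \sum_(s <- F) u s) n.+1%:R^-1.
  move=> n; have n0 : 0 < n.+1%:R^-1 :> R by rewrite invr_gt0 ltr0n.
  have [_ [F _ <-] sF] := sup_adherent n0 supE.
  exists F => F' FF'; rewrite (fset_sum_split u FF') addrC addKr.
  apply: (@op_leW _ _ _ (\sum_(s <- F' | s \notin F) c s)); last first.
    by apply: op_le_sum => s _.
  have : \sum_(s <- F') c s <= sup E by apply: sup_upper_bound => //; exists F'.
  rewrite (fset_sum_split c FF'); move: sF; set n1 := n.+1%:R^-1; clearbody n1; lra.
have lS (F : {fset G}) : linear (\sum_(s <- F) u s) by apply: linear_fct_sum.
have [|||T [lT HT]] := @op_rcomplete _ _ (fun n => \sum_(s <- F_ n) u s) cK.
- by [].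
- by exists (\sum_(s <- F_ 0%N) c s); apply: op_le_sum => s _.
- move=> m n; apply: (@op_leB_trans _ _ _ (\sum_(s <- (F_ m `|` F_ n)%fset) u s)).
    exact/op_leB_sym/HF/fsubsetUl.
  exact/HF/fsubsetUr.
exists T; apply/op_has_sumP => //; split.
  apply/bounded_opP; split=> //; exists (1 + \sum_(s <- F_ 0%N) c s).
    by rewrite addr_ge0// sumr_ge0.
  rewrite -[T](subrK (\sum_(s <- F_ 0%N) u s)); apply: op_leD.
    by have := op_leB_sym (HT 0%N); rewrite invr1.
  by apply: op_le_sum => s _.
move=> e e0; have [N HN] := ltr_add_invr (y := 0) (x := e / 2) ltac:(by rewrite divr_gt0).
exists (F_ N) => F FF; apply: (@op_leW _ _ _ (N.+1%:R^-1 + N.+1%:R^-1)).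
  by rewrite [e]splitr lerD// ltW// -[_^-1]add0r.
apply: (@op_leB_trans _ _ _ (\sum_(s <- F_ N) u s)); first exact/op_leB_sym/HT.
exact/op_leB_sym/HF.
Qed.

End Summable.

(** * Matrices of operators and complete boundedness *)

Section MatrixNorms.
Variables (R : realType) (K : normedModType R[i]).

(** The index is any finite type: the passage from maps to multipliers uses matrices indexed by
    [J * P], with [P] a finite part of [G]. Squares on both sides keep square roots out of the
    estimates. *)
Definition mx_le (J : finType) (T : J -> J -> K -> K) (b : R) :=
  forall v : J -> K,
    \sum_i rnorm (\sum_k T i k (v k)) ^+ 2 <= b ^+ 2 * \sum_k rnorm (v k) ^+ 2.

Lemma sumr_sqr_ge0 (J : finType) (f : J -> R) : 0 <= \sum_j f j ^+ 2.
Proof. by apply: sumr_ge0 => j _; exact: sqr_ge0. Qed.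

Lemma colnorm_ge0 n (v : 'I_n -> K) : 0 <= colnorm v.
Proof. exact: sqrtr_ge0. Qed.

Lemma colnorm_sqr n (v : 'I_n -> K) : colnorm v ^+ 2 = \sum_i rnorm (v i) ^+ 2.
Proof. by rewrite sqr_sqrtr// sumr_sqr_ge0. Qed.

Lemma colnormZ n (a : R[i]) (v : 'I_n -> K) :
  colnorm (fun i => a *: v i) = rnorm a * colnorm v.
Proof.
rewrite /colnorm; under eq_bigr do rewrite rnormZ exprMn.
by rewrite -mulr_sumr sqrtrM ?sqr_ge0// sqrtr_sqr ger0_norm ?rnorm_ge0.
Qed.

Lemma colnorm_eq0 n (v : 'I_n -> K) i : colnorm v = 0 -> v i = 0.
Proof.
move=> v0; have := colnorm_sqr v; rewrite v0 expr0n /= => /esym/eqP.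
rewrite psumr_eq0 => [/allP/(_ i)|j _]; last exact: sqr_ge0.
by rewrite mem_index_enum => /(_ isT); rewrite sqrf_eq0 => /eqP/rnorm_eq0.
Qed.

Lemma mxnorm_leP n (T : 'M[K -> K]_n) b : (forall i k, linear (T i k)) -> 0 <= b ->
  (mxnorm T <= b%:E)%E <-> mx_le (fun i k => T i k) b.
Proof.
move=> lT b0; split=> [Tb v|Tb].
  set w := fun i => \sum_k T i k (v k).
  suff : colnorm w <= b * colnorm v.
    rewrite -(@ler_pXn2r _ 2%N) ?nnegrE ?mulr_ge0 ?colnorm_ge0//.
    by rewrite exprMn !colnorm_sqr.
  have [v0|v0] := eqVneq (colnorm v) 0.
    have -> : w = fun=> 0.
      apply/funext => i; rewrite /w big1// => k _.
      by rewrite (colnorm_eq0 k v0) linear_fun0.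
    rewrite v0 mulr0 -(@ler_pXn2r _ 2%N) ?nnegrE ?colnorm_ge0//.
    by rewrite colnorm_sqr big1// => i _; rewrite rnorm0 expr0n.
  have vp : 0 < colnorm v by rewrite lt_neqAle eq_sym v0 colnorm_ge0.
  have : ((colnorm (fun i => \sum_k T i k ((colnorm v)^-1%:C *: v k)))%:E <= b%:E)%E.
    apply: le_trans Tb; apply: ereal_sup_ubound.
    exists (fun k => (colnorm v)^-1%:C *: v k) => //=.
    by rewrite colnormZ rnorm_real ger0_norm ?invr_ge0 ?colnorm_ge0// mulVf.
  rewrite lee_fin.
  have -> : (fun i => \sum_k T i k ((colnorm v)^-1%:C *: v k)) =
      (fun i => (colnorm v)^-1%:C *: w i).
    apply/funext => i; rewrite scaler_sumr; apply: eq_bigr => k _.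
    by rewrite linear_funZ.
  rewrite colnormZ rnorm_real ger0_norm ?invr_ge0 ?colnorm_ge0//.
  by rewrite ler_pdivrMl// mulrC.
apply: ub_ereal_sup => _ [v /= v1 <-]; rewrite lee_fin.
rewrite -(@ler_pXn2r _ 2%N) ?nnegrE ?colnorm_ge0// colnorm_sqr.
apply: (le_trans (Tb v)); rewrite -colnorm_sqr -[leRHS]mulr1 ler_wpM2l ?sqr_ge0//.
by rewrite expr_le1 ?colnorm_ge0.
Qed.

Lemma mxnorm_ge0 n (T : 'M[K -> K]_n) : (forall i k, linear (T i k)) -> (0 <= mxnorm T)%E.
Proof.
move=> lT; apply: (@le_trans _ _ (colnorm (fun i => \sum_k T i k 0))%:E).
  by rewrite lee_fin colnorm_ge0.
apply: ereal_sup_ubound; exists (fun=> 0) => //=.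
by rewrite /colnorm big1 ?sqrtr0// => i _; rewrite rnorm0 expr0n.
Qed.

Lemma mx_leW (J : finType) (T : J -> J -> K -> K) b c : 0 <= b -> b <= c ->
  mx_le T b -> mx_le T c.
Proof.
move=> b0 bc Tb v; apply: (le_trans (Tb v)); rewrite ler_wpM2r ?sumr_sqr_ge0//.
by rewrite ler_pXn2r ?nnegrE//; exact: le_trans bc.
Qed.

Lemma mx_le_scale (J : finType) (T : J -> J -> K -> K) (a : R[i]) b :
  mx_le T b -> mx_le (fun i k => a *: T i k) (rnorm a * b).
Proof.
move=> Tb v; rewrite exprMn -mulrA.
apply: le_trans (_ : rnorm a ^+ 2 * \sum_i rnorm (\sum_k T i k (v k)) ^+ 2 <= _).
  rewrite mulr_sumr; apply: ler_sum => i _.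
  by rewrite -exprMn -rnormZ scaler_sumr.
by rewrite ler_wpM2l ?sqr_ge0.
Qed.

Lemma mx_le_reindex (J : finType) (T : J -> J -> K -> K) b :
  mx_le T b <->
  mx_le (fun i k : 'I_#|J| => T (enum_val i) (enum_val k)) b.
Proof.
have re (V : nmodType) (f : J -> V) :
    \sum_(i < #|J|) f (enum_val i) = \sum_j f j.
  by rewrite -big_enum_val.
split=> Tb v.
  have := Tb (fun j => v (enum_rank j)).
  rewrite -!(re R); under eq_bigr do rewrite -re.
  under eq_bigr do under eq_bigr do rewrite enum_valK.
  by under [X in _ * X]eq_bigr do rewrite enum_valK.
have := Tb (fun i => v (enum_val i)).
under eq_bigr do rewrite (re K (fun j => T _ j (v j))).
by rewrite (re R (fun i => rnorm (\sum_j T i j (v j)) ^+ 2)) (re R (fun j => rnorm (v j) ^+ 2)).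
Qed.

Lemma mx_le_op (T : K -> K) b : 0 <= b ->
  mx_le (fun _ _ : unit => T) b <-> op_le T b.
Proof.
move=> b0; split=> Tb v.
  have := Tb (fun=> v); rewrite !(big_pred1 tt); try by case.
  by rewrite -exprMn ler_pXn2r ?nnegrE ?mulr_ge0 ?rnorm_ge0.
rewrite !(big_pred1 tt); try by case.
by rewrite -exprMn ler_pXn2r ?nnegrE ?mulr_ge0 ?rnorm_ge0.
Qed.

(** Minkowski's inequality, from [(p + q)^2 <= (1 + t) p^2 + (1 + 1/t) q^2] with the optimal
    [t = b / a]; vanishing [a] or [b] is treated apart. *)
Lemma sum_add_sqr_le (J : finType) (x y : J -> K) (a b : R) : 0 <= a -> 0 <= b ->
  \sum_j rnorm (x j) ^+ 2 <= a ^+ 2 -> \sum_j rnorm (y j) ^+ 2 <= b ^+ 2 ->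
  \sum_j rnorm (x j + y j) ^+ 2 <= (a + b) ^+ 2.
Proof.
move=> a0 b0 xa yb.
have key t : 0 < t -> \sum_j rnorm (x j + y j) ^+ 2 <=
    (1 + t) * a ^+ 2 + (1 + t^-1) * b ^+ 2.
  move=> t0; apply: (@le_trans _ _ (\sum_j ((1 + t) * rnorm (x j) ^+ 2 +
      (1 + t^-1) * rnorm (y j) ^+ 2))).
    apply: ler_sum => j _.
    apply: (@le_trans _ _ ((rnorm (x j) + rnorm (y j)) ^+ 2)).
      by rewrite ler_pXn2r ?nnegrE ?addr_ge0 ?rnorm_ge0// ler_rnormD.
    set p := rnorm (x j); set q := rnorm (y j); rewrite -subr_ge0.
    suff -> : (1 + t) * p ^+ 2 + (1 + t^-1) * q ^+ 2 - (p + q) ^+ 2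
        = t * (p - t^-1 * q) ^+ 2 by rewrite mulr_ge0 ?sqr_ge0 ?ltW.
    by field; rewrite gt_eqF.
  rewrite big_split/= -!mulr_sumr; apply: lerD; apply: ler_wpM2l => //.
    by rewrite addr_ge0 ?ltW.
  by rewrite addr_ge0 ?invr_ge0 ?ltW.
have zero (z : J -> K) : \sum_j rnorm (z j) ^+ 2 <= 0 -> forall j, z j = 0.
  move=> z0 j; apply: rnorm_eq0; apply/eqP; rewrite -sqrf_eq0 eq_le sqr_ge0 andbT.
  apply: le_trans z0; rewrite (bigD1 j)//= lerDl sumr_ge0// => i _; exact: sqr_ge0.
move: a0; rewrite le_eqVlt => /orP[/eqP a0|a0].
  move: xa; rewrite -a0 expr0n /= add0r => /zero x0.
  by under eq_bigr do rewrite x0 add0r.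
move: b0; rewrite le_eqVlt => /orP[/eqP b0|b0].
  move: yb; rewrite -b0 expr0n /= addr0 => /zero y0.
  by under eq_bigr do rewrite y0 addr0.
apply: (le_trans (key _ (divr_gt0 b0 a0))).
suff -> : (1 + b / a) * a ^+ 2 + (1 + (b / a)^-1) * b ^+ 2 = (a + b) ^+ 2 by [].
by field; rewrite !gt_eqF.
Qed.

Lemma mx_leD (J : finType) (S T : J -> J -> K -> K) b c : 0 <= b -> 0 <= c ->
  mx_le S b -> mx_le T c -> mx_le (fun i k => S i k + T i k) (b + c).
Proof.
move=> b0 c0 Sb Tc v.
under eq_bigr do under eq_bigr do rewrite fct_addE.
under eq_bigr do rewrite big_split /=.
set M := \sum_k rnorm (v k) ^+ 2.
have M0 : 0 <= M by exact: sumr_sqr_ge0.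
rewrite -(sqr_sqrtr M0) -exprMn mulrDl; apply: sum_add_sqr_le.
- by rewrite mulr_ge0 ?sqrtr_ge0.
- by rewrite mulr_ge0 ?sqrtr_ge0.
- by rewrite exprMn sqr_sqrtr.
- by rewrite exprMn sqr_sqrtr.
Qed.

(** The crude constant is affordable: it will multiply entrywise errors that are chosen after
    [J]. *)
Lemma mx_le_entry (J : finType) (T : J -> J -> K -> K) (c : R) : 0 <= c ->
  (forall i k, op_le (T i k) c) -> mx_le T ((#|J| ^ 2)%:R * c).
Proof.
move=> c0 Tc v; set M := \sum_k rnorm (v k) ^+ 2.
have M0 : 0 <= M by exact: sumr_sqr_ge0.
have step i : rnorm (\sum_k T i k (v k)) ^+ 2 <= (#|J|%:R * c) ^+ 2 * M.
  rewrite -[in leRHS](sqr_sqrtr M0) -exprMn.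
  rewrite ler_pXn2r ?nnegrE ?mulr_ge0 ?rnorm_ge0 ?sqrtr_ge0//.
  apply: (le_trans (rnorm_sum _ _ _)); rewrite -mulrA mulr_natl -sumr_const.
  apply: ler_sum => k _; apply: (le_trans (Tc i k _)); rewrite ler_wpM2l//.
  rewrite -(@ler_pXn2r _ 2%N) ?nnegrE ?rnorm_ge0 ?sqrtr_ge0// sqr_sqrtr//.
  by rewrite /M (bigD1 k)//= lerDl sumr_ge0// => i' _; exact: sqr_ge0.
apply: (@le_trans _ _ (\sum_(i : J) (#|J|%:R * c) ^+ 2 * M)).
  by apply: ler_sum => i _.
rewrite sumr_const -[X in X <= _]mulr_natl mulrA ler_wpM2r// !exprMn mulrA ler_wpM2r ?sqr_ge0//.
rewrite -!natrX -natrM ler_nat -expnM -expnS.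
by case: #|J| => // m; rewrite leq_pexp2l.
Qed.

End MatrixNorms.

Section CompletelyBounded.
Variables (R : realType) (K : normedModType R[i]) (X : lmodType R[i]).
Variables (j : X -> K -> K) (D : set X).
Implicit Type phi : X -> X.

(** Homogeneous form of a bound on [cbnorm], over all finite index types. Normalisation to [b = 1]
    happens once, in [cbnorm_leP], by dividing by [b]. *)
Definition cb_le phi (C : R) := forall (J : finType) (x : J -> J -> X) (b : R),
  0 < b -> (forall i k, D (x i k)) -> mx_le (fun i k => j (x i k)) b ->
  mx_le (fun i k => j (phi (x i k))) (C * b).

Hypotheses (lj : linear j) (jl : forall x, D x -> linear (j x)).
Hypotheses (D0 : D 0) (DZ : forall c x, D x -> D (c *: x)).

Lemma linear_onZ phi c x : linear_on D phi -> D x -> phi (c *: x) = c *: phi x.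
Proof.
move=> [_ lphi] Dx; have phi0 : phi 0 = 0.
  have := lphi 1 0 0 D0 D0; rewrite !scale1r addr0 => E.
  by apply: (@addrI _ (phi 0)); rewrite addr0 -E.
by have := lphi c x 0 Dx D0; rewrite phi0 !addr0.
Qed.

Lemma cbnorm_leP phi C : linear_on D phi -> 0 <= C ->
  (cbnorm j D phi <= C%:E)%E <-> cb_le phi C.
Proof.
move=> lphi C0; have [Dphi _] := lphi; split=> [phiC J x b b0 Dx xb|phiC].
  apply/mx_le_reindex.
  pose y : 'M[X]_#|J| := \matrix_(i, k) (b^-1%:C *: x (enum_val i) (enum_val k)).
  have Dy i k : D (y i k) by rewrite mxE; exact: DZ.
  have yC : (mxnorm (map_mx j (map_mx phi y)) <= C%:E)%E.
    apply: le_trans phiC; apply: ereal_sup_ubound; exists #|J|, y; split=> //.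
    apply/mxnorm_leP => // [i k|]; first by rewrite mxE; exact: jl.
    have := mx_le_scale (b^-1%:C) ((mx_le_reindex _ _).1 xb).
    rewrite rnorm_real ger0_norm ?invr_ge0 ?ltW// mulVf ?gt_eqF//.
    move=> H v; have := H v; congr (_ <= _); apply: eq_bigr => i _.
    congr (rnorm _ ^+ 2); apply: eq_bigr => k _.
    by rewrite !mxE (linear_funZ lj).
  have ly i k : linear (map_mx j (map_mx phi y) i k).
    by rewrite 2!mxE; exact/jl/Dphi/Dy.
  have /(mx_le_scale b%:C) := (mxnorm_leP ly C0).1 yC.
  rewrite rnorm_real ger0_norm ?ltW// mulrC => H v; have := H v.
  congr (_ <= _); apply: eq_bigr => i _.
  congr (rnorm _ ^+ 2); apply: eq_bigr => k _.
  rewrite !mxE linear_onZ// (linear_funZ lj) scalerA -rmorphM /=.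
  by rewrite divff ?gt_eqF// (rmorph1 (real_complex R)) scale1r.
apply: ub_ereal_sup => _ [n [x [Dx x1 ->]]].
have jx i k : linear (map_mx j x i k) by rewrite mxE; exact: jl.
apply/mxnorm_leP => // [i k|]; first by rewrite !mxE; exact/jl/Dphi.
have /(phiC _ _ _ ltr01 Dx) : mx_le (fun i k => j (x i k)) 1.
  have := (mxnorm_leP jx ler01).1 x1 => H v; have := H v.
  congr (_ <= _); apply: eq_bigr => i _.
  congr (rnorm _ ^+ 2); apply: eq_bigr => k _.
  by rewrite !mxE.
rewrite mulr1 => H v; have := H v.
congr (_ <= _); apply: eq_bigr => i _.
congr (rnorm _ ^+ 2); apply: eq_bigr => k _.
by rewrite !mxE.
Qed.

Lemma cbnorm_ge0 phi : linear_on D phi -> (0 <= cbnorm j D phi)%E.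
Proof.
move=> [Dphi _].
(* The 0 x 0 matrix is admissible, so the supremum is not that of the empty set. *)
apply: (@le_trans _ _ (mxnorm (map_mx j (map_mx phi (0 : 'M[X]_0))))).
  by apply: mxnorm_ge0; case.
apply: ereal_sup_ubound; exists 0%N, 0; split=> //; first by case.
apply/mxnorm_leP => //; first by case.
by move=> v; rewrite !big_ord0 mulr0.
Qed.

Lemma cb_mapP phi : cb_map j D phi <->
  linear_on D phi /\ exists2 C, 0 <= C & cb_le phi C.
Proof.
split=> [[lphi fin]|[lphi [C C0 phiC]]]; split=> //.
  have fn : cbnorm j D phi \is a fin_num by rewrite ge0_fin_numE ?cbnorm_ge0.
  exists (fine (cbnorm j D phi)); first by rewrite fine_ge0 ?cbnorm_ge0.
  by apply/cbnorm_leP; rewrite ?fine_ge0 ?cbnorm_ge0// fineK.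
by apply: (@le_lt_trans _ _ C%:E); [exact/cbnorm_leP|rewrite ltry].
Qed.

Lemma cb_le_op phi C x b : 0 <= C -> cb_le phi C -> D x -> 0 < b -> op_le (j x) b ->
  op_le (j (phi x)) (C * b).
Proof.
move=> C0 phiC Dx b0 xb.
apply/mx_le_op; first by rewrite mulr_ge0// ltW.
by apply: phiC => //; apply/mx_le_op => //; exact: ltW.
Qed.

End CompletelyBounded.

(** * Scalar matrices acting on vectors, and complete bounds for vector functionals *)

Section ScalarMatrices.
Variables (R : realType) (J : finType).

Definition scalar_mx_le (m : J -> J -> R[i]) (b : R) := forall c : J -> R[i],
  \sum_i rnorm (\sum_k m i k * c k) ^+ 2 <= b ^+ 2 * \sum_k rnorm (c k) ^+ 2.

(* Splitting off a unit vector [e] spanned by one of the [z k] reduces the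
   bound on [H] to the scalar one and to a family with one more zero. *)
Lemma scalar_mx_hilbert (H : hilbertType R) (m : J -> J -> R[i]) b (z : J -> H) :
  scalar_mx_le m b ->
  \sum_i rnorm (\sum_k m i k *: z k) ^+ 2 <= b ^+ 2 * \sum_k rnorm (z k) ^+ 2.
Proof.
move=> mb; suff gen (r : seq J) : forall z : J -> H, (forall k, k \notin r -> z k = 0) ->
    \sum_i rnorm (\sum_k m i k *: z k) ^+ 2 <= b ^+ 2 * \sum_k rnorm (z k) ^+ 2.
  by apply: (gen (index_enum J)) => k; rewrite mem_index_enum.
elim: r => [|k0 r IH] {}z z0.
  rewrite big1; first by apply: mulr_ge0; [exact: sqr_ge0|exact: sumr_sqr_ge0].
  by move=> i _; rewrite big1 ?rnorm0 ?expr0n// => k _; rewrite z0 ?scaler0.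
have [zk0|zk0] := eqVneq (z k0) 0.
  apply: IH => k kr; have [->//|kk0] := eqVneq k k0.
  by rewrite z0// in_cons negb_or kk0.
have [e [e1 zE]] : exists e, rnorm e = 1 /\ z k0 = (rnorm (z k0))%:C *: e.
  exists ((rnorm (z k0))^-1%:C *: z k0); split; first exact: rnorm_normalize.
  rewrite scalerA -rmorphM /= divff ?(rmorph1 (real_complex R)) ?scale1r//.
  by apply: contra_neq zk0 => /rnorm_eq0.
pose c k := hdot (z k) e; pose z' k := z k - c k *: e.
have z'0 k : k \notin r -> z' k = 0.
  move=> kr; rewrite /z' /c; have [->|kk0] := eqVneq k k0; last first.
    by rewrite z0 ?in_cons ?negb_or ?kk0// linear0l scale0r subrr.
  rewrite zE hdotZ hdot_rnorm e1 expr1n (rmorph1 (real_complex R)) mulr1.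
  by rewrite subrr.
have ez' k : hdot e (z' k) = 0.
  exact: hdot_residual.
have split_i i : rnorm (\sum_k m i k *: z k) ^+ 2 =
    rnorm (\sum_k m i k * c k) ^+ 2 + rnorm (\sum_k m i k *: z' k) ^+ 2.
  have -> : \sum_k m i k *: z k = (\sum_k m i k * c k) *: e + \sum_k m i k *: z' k.
    rewrite scaler_suml -big_split /=; apply: eq_bigr => k _.
    by rewrite /z' scalerBr [m i k *: (c k *: e)]scalerA addrC subrK.
  rewrite pythagoras ?rnormZ ?e1 ?mulr1//.
  rewrite hdotZ linear_sumr /= [X in _ * X]big1 ?mulr0// => k _.
  by rewrite hdot_conj hdotZ [hdot (z' k) e]hdot_conj ez' conjC0 mulr0 conjC0.
have split_k k : rnorm (z k) ^+ 2 = rnorm (c k) ^+ 2 + rnorm (z' k) ^+ 2.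
  exact: hdot_split_norm.
rewrite (eq_bigr _ (fun i _ => split_i i)) (eq_bigr _ (fun k _ => split_k k)).
by rewrite !big_split /= mulrDr lerD// IH.
Qed.

End ScalarMatrices.

Section L2Matrices.
Variables (R : realType) (I : choiceType) (J : finType).

Lemma l2_sum_sqr_le (H : normedModType R[i]) (u : J -> l2 I H) (M : R) :
  (forall P, uniq P -> \sum_(s <- P) \sum_i rnorm (u i s) ^+ 2 <= M) ->
  \sum_i rnorm (u i) ^+ 2 <= M.
Proof.
move=> uM; under eq_bigr do rewrite l2_sqr_rnorm.
rewrite -lee_fin -sumEFin; under eq_bigr do rewrite fineK ?l2_sqnorm_fin//.
rewrite /l2_sqnorm -esum_sum; last by move=> i s _ _; rewrite lee_fin sqr_ge0.
apply: ub_ereal_sup => _ [B [finB _] <-].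
rewrite fsbig_finite//=; under eq_bigr do rewrite sumEFin.
by rewrite sumEFin lee_fin uM.
Qed.

Variable H : hilbertType R.
Local Notation K := (l2 I H).

Lemma scalar_mx_l2 (m : J -> J -> R[i]) b (z : J -> K) : scalar_mx_le m b ->
  \sum_i rnorm (\sum_k m i k *: z k) ^+ 2 <= b ^+ 2 * \sum_k rnorm (z k) ^+ 2.
Proof.
move=> mb; apply: l2_sum_sqr_le => P uP.
apply: (@le_trans _ _ (\sum_(s <- P) b ^+ 2 * \sum_k rnorm (z k s) ^+ 2)).
  apply: ler_sum => s _; apply: le_trans (scalar_mx_hilbert _ mb).
  by under eq_bigr do rewrite l2_sumE.
rewrite -mulr_sumr ler_wpM2l ?sqr_ge0// exchange_big /=.
by apply: ler_sum => k _; exact: l2_sum_le.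
Qed.

(** Entrywise, a vector functional turns a matrix of operators into a scalar matrix of norm at most
    [rnorm xi * rnorm w * b], as one sees by letting [Y] act on multiples of the single vector [xi].
    A scalar matrix keeps its bound when it acts on vectors, so the usual bound of this rank one map
    is also a complete one. *)
Lemma vector_functional_mx_le (Y : J -> J -> K -> K) b (xi : K) s (w : H)
    (d : K -> K) c : (forall i k, linear (Y i k)) -> mx_le Y b -> op_le d c -> 0 <= c ->
  mx_le (fun i k => hdot (Y i k xi s) w *: d) (rnorm xi * rnorm w * c * b).
Proof.
move=> lY Yb dc c0 v.
have : scalar_mx_le (fun i k => hdot (Y i k xi s) w) (rnorm xi * rnorm w * b).
  move=> a; apply: (@le_trans _ _
      (\sum_i rnorm w ^+ 2 * rnorm (\sum_k Y i k (a k *: xi)) ^+ 2)).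
    apply: ler_sum => i _.
    have -> : \sum_k hdot (Y i k xi s) w * a k = hdot ((\sum_k Y i k (a k *: xi)) s) w.
      rewrite l2_sumE linear_sumlz; apply: eq_bigr => k _.
      by rewrite (linear_funZ (lY i k)) l2ZE mulrC; exact/esym/hdotZ.
    rewrite -exprMn ler_pXn2r ?nnegrE ?mulr_ge0 ?rnorm_ge0//.
    apply: (le_trans (cauchy_schwarz _ _)); rewrite mulrC ler_wpM2l ?rnorm_ge0//.
    exact: l2_eval_le.
  rewrite -mulr_sumr; apply: (le_trans (ler_wpM2l (sqr_ge0 _) (Yb _))).
  under [X in _ * (_ * X)]eq_bigr do rewrite rnormZ exprMn.
  by rewrite -mulr_suml !exprMn; lra.
move=> /(@scalar_mx_l2 _ _ (fun k => d (v k))) H1; apply: (le_trans H1).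
rewrite (_ : rnorm xi * rnorm w * c * b = rnorm xi * rnorm w * b * c); last by ring.
rewrite [X in _ <= X * _]exprMn -[leRHS]mulrA ler_wpM2l ?sqr_ge0// mulr_sumr.
apply: ler_sum => k _; rewrite -exprMn.
by rewrite ler_pXn2r ?nnegrE ?mulr_ge0 ?rnorm_ge0.
Qed.

End L2Matrices.

(** * The reduced crossed product *)

Section OpHasSumLinear.
Variables (R : realType) (K : normedModType R[i]) (G : choiceType).

Lemma op_has_sum_linear (u w : G -> K -> K) (S T : K -> K) (a : R[i]) :
  (forall s, linear (u s)) -> (forall s, linear (w s)) ->
  op_has_sum u S -> op_has_sum w T ->
  op_has_sum (fun s => a *: u s + w s) (a *: S + T).
Proof.
move=> lu lw /op_has_sumP-/(_ lu)[bS HS] /op_has_sumP-/(_ lw)[bT HT].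
have lcomb (U W : K -> K) : linear U -> linear W -> linear (a *: U + W).
  by move=> lU lW; apply: linear_fctD => //; exact: linear_fctZ.
apply/op_has_sumP => [s|]; first exact: lcomb.
move/bounded_opP: bS => [lS [c c0 Sc]]; move/bounded_opP: bT => [lT [d d0 Td]].
split.
  apply/bounded_opP; split; first exact: lcomb.
  exists (rnorm a * c + d); first by rewrite addr_ge0// mulr_ge0 ?rnorm_ge0.
  by apply: op_leD => //; exact: op_leZ.
move=> e e0; have a1 : 0 < rnorm a + 1 by have := rnorm_ge0 a; lra.
have [F HF] := HS _ (divr_gt0 e0 a1); have [F' HF'] := HT _ (divr_gt0 e0 a1).
exists (F `|` F')%fset => F1; rewrite fsubUset => /andP[FF FF'].
rewrite big_split /= -scaler_sumr opprD addrACA -scalerBr.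
apply: (@op_leW _ _ _ (rnorm a * (e / (rnorm a + 1)) + e / (rnorm a + 1))).
  by rewrite -[X in _ + X]mul1r -mulrDl mulrC divfK// gt_eqF.
by apply: op_leD; [apply: op_leZ; exact: HF|exact: HF'].
Qed.

End OpHasSumLinear.

Section CrossedProductTheory.
Variables (R : realType) (A : unitalCStarType R) (G : groupType).
Variables (alpha : G -> A -> A) (H : hilbertType R) (rho : A -> H -> H).
Hypotheses (act : is_action alpha) (rep : is_faithful_rep rho).
Local Notation K := (l2 G H).
Local Notation integrated := (integrated alpha rho).
Local Notation crossed := (crossed_product alpha rho).
Local Notation l1_image := (l1_image alpha rho).
Implicit Types (f g : G -> A) (a b : A) (s t r : G) (xi : K) (v : H) (y : K -> K).

Lemma actME s t a : alpha (s * t)%g a = alpha s (alpha t a).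
Proof. by rewrite (actionM act). Qed.

Lemma act1 a : alpha 1%g a = a.
Proof.
have [_ _ _ [h hK _]] := action_automorphism act 1%g.
by apply: (can_inj hK); rewrite -actME mulg1.
Qed.

Lemma act_lin t : linear (alpha t).
Proof. by have [] := action_automorphism act t. Qed.

Lemma act_le t a : cnorm (alpha t a) <= cnorm a.
Proof. exact/automorphism_contractive/(action_automorphism act). Qed.

Lemma rep_act_le s a v : rnorm (rho (alpha s a) v) <= cnorm a * rnorm v.
Proof.
apply: (le_trans (rep_contractive rep _ _)).
by rewrite ler_wpM2r ?rnorm_ge0 ?act_le.
Qed.

Lemma pi_repE a xi s : pi_rep alpha rho a xi s = rho (alpha s^-1%g a) (xi s).
Proof.
rewrite /pi_rep /to_l2 (@l2_insubd _ _ _ _ (cnorm a ^+ 2 * rnorm xi ^+ 2))// => P uP.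
apply: (@le_trans _ _ (cnorm a ^+ 2 * \sum_(s <- P) rnorm (xi s) ^+ 2)).
  rewrite mulr_sumr; apply: ler_sum => i _.
  by rewrite -exprMn ler_pXn2r ?nnegrE ?mulr_ge0 ?cnorm_ge0 ?rnorm_ge0// rep_act_le.
by rewrite ler_wpM2l ?sqr_ge0 ?l2_sum_le.
Qed.

Lemma lambda_repE t xi s : lambda_rep t xi s = xi (t^-1 * s)%g.
Proof.
rewrite /lambda_rep /to_l2 (@l2_insubd _ _ _ _ (rnorm xi ^+ 2))// => P uP.
rewrite -(big_map (fun s => (t^-1 * s)%g) xpredT (fun s => rnorm (xi s) ^+ 2)).
by apply: l2_sum_le; rewrite map_inj_uniq//; exact: mulgI.
Qed.

Definition pilam t a : K -> K := pi_rep alpha rho a \o lambda_rep t.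

Lemma pilamE t a xi s : pilam t a xi s = rho (alpha s^-1%g a) (xi (t^-1 * s)%g).
Proof. by rewrite /pilam /= pi_repE lambda_repE. Qed.

Lemma pilam_lin t a : linear (pilam t a).
Proof.
move=> c x y; apply: l2P => s.
by rewrite l2DE l2ZE !pilamE l2DE l2ZE (rep_lin rep).
Qed.

Lemma pilam_linear t : linear (pilam t).
Proof.
move=> c a b; apply/funext => xi; apply: l2P => s.
rewrite fct_addE fct_scaleE l2DE l2ZE !pilamE (act_lin _ c).
by rewrite (repD rep) (repZ rep).
Qed.

Lemma pilam_le t a : op_le (pilam t a) (cnorm a).
Proof.
move=> xi; apply: l2_rnorm_le; first by rewrite mulr_ge0 ?cnorm_ge0 ?rnorm_ge0.
move=> P uP.
apply: (@le_trans _ _ (cnorm a ^+ 2 * \sum_(s <- P) rnorm (lambda_rep t xi s) ^+ 2)).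
  rewrite mulr_sumr; apply: ler_sum => i _; rewrite pilamE lambda_repE.
  by rewrite -exprMn ler_pXn2r ?nnegrE ?mulr_ge0 ?cnorm_ge0 ?rnorm_ge0// rep_act_le.
rewrite exprMn ler_wpM2l ?sqr_ge0//.
under eq_bigr do rewrite lambda_repE.
rewrite -(big_map (fun s => (t^-1 * s)%g) xpredT (fun s => rnorm (xi s) ^+ 2)).
by apply: l2_sum_le; rewrite map_inj_uniq//; exact: mulgI.
Qed.

Lemma pilam_bounded t a : bounded_op (pilam t a).
Proof.
apply/bounded_opP; split; first exact: pilam_lin.
by exists (cnorm a); [exact: cnorm_ge0|exact: pilam_le].
Qed.

Lemma pilam0 t : pilam t 0 = 0.
Proof. exact/(linear_fun0 (pilam_linear t)). Qed.

Lemma l1_bound f : l1 f -> exists M, forall P, uniq P -> \sum_(s <- P) cnorm (f s) <= M.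
Proof.
move=> l1f; exists (fine (\esum_(s in setT) (cnorm (f s))%:E)) => P uP.
rewrite -lee_fin fineK; last first.
  rewrite ge0_fin_numE; first exact: l1f.
  by apply: esum_ge0 => s _; rewrite lee_fin cnorm_ge0.
apply: ereal_sup_ubound; exists [set` P]; first by split=> //; exact: finite_seq.
by rewrite -fsbig_seq// sumEFin.
Qed.

Lemma bound_l1 f M : (forall P, uniq P -> \sum_(s <- P) cnorm (f s) <= M) -> l1 f.
Proof.
move=> fM; apply: (@le_lt_trans _ _ M%:E); last by rewrite ltry.
apply: ub_ereal_sup => _ [B [finB _] <-].
by rewrite fsbig_finite//= sumEFin lee_fin; apply: fM; exact: fset_uniq.
Qed.

Lemma l1_linear (c : R[i]) f g : l1 f -> l1 g -> l1 (c *: f + g).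
Proof.
move=> /l1_bound[M fM] /l1_bound[N gN].
apply: (@bound_l1 _ (rnorm c * M + N)) => P uP.
apply: (@le_trans _ _ (\sum_(s <- P) (rnorm c * cnorm (f s) + cnorm (g s)))).
  apply: ler_sum => s _; apply: (le_trans (cnormD _ _)).
  by rewrite -cnormZ.
by rewrite big_split /= -mulr_sumr lerD ?gN// ler_wpM2l ?rnorm_ge0 ?fM.
Qed.

Lemma l1_finite f (F : {fset G}) : (forall s, s \notin F -> f s = 0) -> l1 f.
Proof.
move=> f0; apply: (@bound_l1 _ (\sum_(s <- F) cnorm (f s))) => P uP.
rewrite (bigID (fun s => s \in F))/= [X in _ + X]big1 ?addr0; last first.
  by move=> s /f0->; rewrite cnorm0.
rewrite -big_filter; apply: ler_sum_subset; rewrite ?filter_uniq ?fset_uniq//.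
  by move=> s; rewrite mem_filter => /andP[].
by move=> s; exact: cnorm_ge0.
Qed.

Lemma l1_summable f : rcomplete H -> l1 f ->
  exists T, op_has_sum (fun s => pilam s (f s)) T.
Proof.
move=> cH /l1_bound[M fM].
apply: (@op_has_sum_summable _ _ _ _ (fun s => cnorm (f s)) M).
- exact: l2_rcomplete.
- by move=> s; exact: pilam_lin.
- by move=> s; exact: cnorm_ge0.
- by move=> s; exact: pilam_le.
- by move=> F; apply: fM; exact: fset_uniq.
Qed.

Lemma integrated_has_sum f : l1 f -> op_has_sum (fun s => pilam s (f s)) (integrated f).
Proof.
move=> /(l1_summable (@completeNormedMod_rcomplete _ H))[T HT].
by rewrite /integrated (op_sumE _ HT)// => s; exact: pilam_lin.
Qed.

Lemma integrated_unique f T : op_has_sum (fun s => pilam s (f s)) T -> integrated f = T.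
Proof. by apply: op_sumE => s; exact: pilam_lin. Qed.

Lemma integrated_finite f (F : {fset G}) : (forall s, s \notin F -> f s = 0) ->
  integrated f = \sum_(s <- F) pilam s (f s).
Proof.
move=> f0; apply/integrated_unique/op_has_sum_finite.
  by move=> s; exact: pilam_bounded.
by move=> s /f0->; rewrite pilam0.
Qed.

Lemma integrated_linear (c : R[i]) f g : l1 f -> l1 g ->
  integrated (c *: f + g) = c *: integrated f + integrated g.
Proof.
move=> l1f l1g; apply: integrated_unique.
have := @op_has_sum_linear _ _ _ _ _ _ _ c (fun s => pilam_lin s (f s))
  (fun s => pilam_lin s (g s)) (integrated_has_sum l1f) (integrated_has_sum l1g).
congr (op_has_sum _ _); apply/funext => s.
by rewrite -(pilam_linear s).
Qed.

Lemma l1_0 : l1 (0 : G -> A).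
Proof. exact: (@l1_finite _ fset0). Qed.

Lemma integrated0 : integrated 0 = 0.
Proof. by rewrite (@integrated_finite _ fset0)// big_seq_fset0. Qed.

Lemma integrated_approx f e : l1 f -> 0 < e -> exists F0 : {fset G},
  forall F : {fset G}, (F0 `<=` F)%fset ->
  op_le (integrated f - \sum_(s <- F) pilam s (f s)) e.
Proof.
move=> /integrated_has_sum/op_has_sumP[|_ H1 e0]; first by move=> s; exact: pilam_lin.
exact: H1.
Qed.

(* The matrix of an element of the crossed product in the canonical
   decomposition of [l2 G H] is constant, up to the action, on each diagonal
   [s * r^-1 = t]; [c t] is the coefficient of [lambda t]. *)
Definition has_coef y (c : G -> A) := forall s r v,
  y (l2_delta r v) s = rho (alpha s^-1%g (c (s * r^-1)%g)) v.

Lemma pilam_sum_coef (F : {fset G}) f s r v :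
  (\sum_(t <- F) pilam t (f t)) (l2_delta r v) s =
  if (s * r^-1)%g \in F then rho (alpha s^-1%g (f (s * r^-1)%g)) v else 0.
Proof.
rewrite fct_sum_applyE l2_sumE.
have E t : pilam t (f t) (l2_delta r v) s =
    if t == (s * r^-1)%g then rho (alpha s^-1%g (f t)) v else 0.
  rewrite pilamE l2_deltaE.
  have -> : (t^-1 * s == r)%g = (t == (s * r^-1)%g).
    apply/eqP/eqP => [rE|tE].
      by rewrite -[in RHS](mulVKg t s) rE mulgK.
    by rewrite -[in LHS](mulgVK r s) -tE mulKg.
  by case: eqP => // _; rewrite (linear_fun0 (rep_lin rep _)).
rewrite (eq_bigr _ (fun t _ => E t)); case: ifPn => [sF|sF].
  rewrite (bigD1_seq _ sF) ?fset_uniq//= eqxx big1 ?addr0// => t /negbTE->.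
  by [].
rewrite big1_seq// => t /andP[_ tF]; case: eqP => // ts.
by rewrite -ts tF in sF.
Qed.

Lemma integrated_coef f : l1 f -> has_coef (integrated f) f.
Proof.
move=> l1f s r v; apply/subr0_eq/rnorm_eq0/le_anti; rewrite rnorm_ge0 andbT.
apply/ler_addgt0Pr => e e0; rewrite add0r.
have v1 : 0 < rnorm v + 1 by have := rnorm_ge0 v; lra.
have [F0 HF] := integrated_approx l1f (divr_gt0 e0 v1).
have /(_ (l2_delta r v)) := HF _ (fsubsetUl F0 [fset (s * r^-1)%g]%fset).
have := l2_eval_le ((integrated f - \sum_(t <- (F0 `|` [fset (s * r^-1)%g])%fset)
   pilam t (f t)) (l2_delta r v)) s.
rewrite fct_subE l2BE pilam_sum_coef in_fsetU in_fset1 eqxx orbT.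
move=> h1 h2; apply: (le_trans h1); apply: (le_trans h2).
apply: (@le_trans _ _ (e / (rnorm v + 1) * rnorm v)).
  by rewrite ler_wpM2l ?rnorm_delta// ltW// divr_gt0.
by rewrite mulrAC ler_pdivrMr// ler_pM2l//; lra.
Qed.

(** In row 1 and column [t^-1] the action is that of the unit, so the entry is [rho (c t)] itself.
    Uniqueness and the norm bound of coefficients are read off there. *)
Lemma has_coef_eval y c t v : has_coef y c -> y (l2_delta t^-1%g v) 1%g = rho (c t) v.
Proof. by move=> ->; rewrite invg1 act1 invgK mul1g. Qed.

Lemma has_coef_uniq y c c' : has_coef y c -> has_coef y c' -> c = c'.
Proof.
move=> yc yc'; apply/funext => t; apply: (rep_inj rep); apply/funext => v.
by rewrite -(has_coef_eval _ _ yc) (has_coef_eval _ _ yc').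
Qed.

Lemma has_coef_le y c (b : R) t : has_coef y c -> 0 <= b -> op_le y b -> cnorm (c t) <= 2 * b.
Proof.
move=> yc b0 yb; apply: (rep_bounded_below rep) => // v.
rewrite -(has_coef_eval _ _ yc); apply: (le_trans (l2_eval_le _ _)).
by apply: (le_trans (yb _)); rewrite ler_wpM2l ?rnorm_delta.
Qed.

Lemma has_coef_linear (k : R[i]) y z c d : has_coef y c -> has_coef z d ->
  has_coef (k *: y + z) (k *: c + d).
Proof.
move=> yc zd s r v; rewrite fct_addE fct_scaleE l2DE l2ZE yc zd.
by rewrite (act_lin _ k) (repD rep) (repZ rep).
Qed.

Lemma has_coefB y z c d : has_coef y c -> has_coef z d -> has_coef (y - z) (c - d).
Proof.
move=> yc zd; have := has_coef_linear (-1) zd yc.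
by rewrite !scaleN1r ![- _ + _]addrC.
Qed.

Lemma integrated_bounded f : l1 f -> bounded_op (integrated f).
Proof. by move=> /integrated_has_sum[]. Qed.

Lemma l1_image_crossed : l1_image `<=` crossed.
Proof.
move=> _ [f l1f <-]; split; first exact: integrated_bounded.
move=> e e0; exists (integrated f); first by exists f.
rewrite subrr; apply/opnorm_leP; [exact: linear_fct0|exact: ltW|].
by apply: op_leW (ltW e0) _; exact: op_le0.
Qed.

Lemma crossed_linear y : crossed y -> linear y.
Proof. by move=> [[]]. Qed.

Lemma crossed_approx y e : crossed y -> 0 < e ->
  exists2 f, l1 f & op_le (y - integrated f) e.
Proof.
move=> [[ly _] yD] e0; have [_ [f l1f <-] yf] := yD e e0; exists f => //.
apply/opnorm_leP; [|exact: ltW|exact: yf].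
by apply: linear_fctB => //; have [] := integrated_bounded l1f.
Qed.

Lemma approx_crossed y : bounded_op y ->
  (forall e, 0 < e -> exists2 f, l1 f & op_le (y - integrated f) e) -> crossed y.
Proof.
move=> by_ H1; split=> // e e0; have [f l1f yf] := H1 e e0.
exists (integrated f); first by exists f.
apply/opnorm_leP => //; last exact: ltW.
by apply: linear_fctB; [case: by_|have [] := integrated_bounded l1f].
Qed.

Lemma l1_image0 : l1_image 0.
Proof. by exists 0; [exact: l1_0|exact: integrated0]. Qed.

Lemma l1_image_lin (k : R[i]) y z : l1_image y -> l1_image z -> l1_image (k *: y + z).
Proof.
move=> [f l1f <-] [g l1g <-]; exists (k *: f + g); first exact: l1_linear.
exact: integrated_linear.
Qed.

Lemma crossed0 : crossed 0.
Proof. exact/l1_image_crossed/l1_image0. Qed.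

Lemma crossed_lin (k : R[i]) y z : crossed y -> crossed z -> crossed (k *: y + z).
Proof.
move=> Dy Dz; apply: approx_crossed.
  have /bounded_opP[ly [c c0 yc]] := Dy.1; have /bounded_opP[lz [d d0 zd]] := Dz.1.
  apply/bounded_opP; split; first by apply: linear_fctD => //; exact: linear_fctZ.
  exists (rnorm k * c + d); first by rewrite addr_ge0// mulr_ge0 ?rnorm_ge0.
  by apply: op_leD => //; exact: op_leZ.
move=> e e0; have k1 : 0 < rnorm k + 1 by have := rnorm_ge0 k; lra.
have [f l1f yf] := crossed_approx Dy (divr_gt0 e0 k1).
have [g l1g zg] := crossed_approx Dz (divr_gt0 e0 k1).
exists (k *: f + g); first exact: l1_linear.
rewrite integrated_linear// opprD addrACA -scalerBr.
apply: (@op_leW _ _ _ (rnorm k * (e / (rnorm k + 1)) + e / (rnorm k + 1))).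
  by rewrite -[X in _ + X]mul1r -mulrDl mulrC divfK// gt_eqF.
by apply: op_leD; [exact: op_leZ yf|exact: zg].
Qed.

Lemma crossedZ (k : R[i]) y : crossed y -> crossed (k *: y).
Proof. by move=> Dy; have := crossed_lin k Dy crossed0; rewrite addr0. Qed.

Lemma l1_imageZ (k : R[i]) y : l1_image y -> l1_image (k *: y).
Proof. by move=> Dy; have := l1_image_lin k Dy l1_image0; rewrite addr0. Qed.

Lemma crossedB y z : crossed y -> crossed z -> crossed (y - z).
Proof.
by move=> Dy Dz; have := crossed_lin (-1) Dz Dy; rewrite scaleN1r addrC.
Qed.

Lemma pilam_integrated t a :
  exists f, [/\ l1 f, integrated f = pilam t a & f t = a].
Proof.
pose f s := if s == t then a else 0.
have f0 s : s \notin [fset t]%fset -> f s = 0.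
  by rewrite in_fset1 /f => /negbTE ->.
exists f; split; [exact: l1_finite f0| |by rewrite /f eqxx].
by rewrite (integrated_finite f0) big_seq_fset1 /f eqxx.
Qed.

Lemma pilam_l1_image t a : l1_image (pilam t a).
Proof. by have [f [l1f <- _]] := pilam_integrated t a; exists f. Qed.

Lemma inv_nat_small (e : R) : 0 < e -> exists n : nat, n.+1%:R^-1 < e.
Proof.
by move=> e0; have [n] := ltr_add_invr (y := 0) (x := e) e0; rewrite add0r; exists n.
Qed.

Lemma inv_nat_gt0 (n : nat) : 0 < n.+1%:R^-1 :> R.
Proof. by rewrite invr_gt0 ltr0n. Qed.

Lemma inv_nat_anti (m n : nat) : (m <= n)%N -> n.+1%:R^-1 <= m.+1%:R^-1 :> R.
Proof. by move=> mn; rewrite lef_pV2 ?posrE ?ltr0n// ler_nat. Qed.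

(** Coefficients are known for [l1] sums. By [has_coef_le] those of a sequence of approximants are
    Cauchy at each [t], and their limits serve for [y]. *)
Lemma crossed_has_coef y : crossed y -> exists c, has_coef y c.
Proof.
move=> Dy.
have /choice[f_ Hf] : forall n : nat, exists f,
    l1 f /\ op_le (y - integrated f) n.+1%:R^-1.
  by move=> n; have [f l1f yf] := crossed_approx Dy (inv_nat_gt0 n); exists f.
have ff m n t : cnorm (f_ m t - f_ n t) <= 2 * (m.+1%:R^-1 + n.+1%:R^-1).
  have := has_coefB (integrated_coef (Hf m).1) (integrated_coef (Hf n).1).
  move=> /(@has_coef_le _ _ _ t); apply.
    by rewrite addr_ge0 ?ltW ?inv_nat_gt0.
  exact: op_leB_trans (op_leB_sym (Hf m).2) (Hf n).2.
have /choice[c Hc] : forall t, exists l, forall e, 0 < e -> exists N,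
    forall n, (N <= n)%N -> cnorm (f_ n t - l) < e.
  move=> t; apply: cnorm_complete => e e0.
  have [N HN] := @inv_nat_small (e / 4) ltac:(by rewrite divr_gt0).
  exists N => m n Nm Nn; apply: (le_lt_trans (ff m n t)).
  have := inv_nat_anti Nm; have := inv_nat_anti Nn; move: HN.
  by move: (m.+1%:R^-1) (n.+1%:R^-1) (N.+1%:R^-1) => p q w; lra.
exists c => s r v; apply/subr0_eq/rnorm_eq0/le_anti; rewrite rnorm_ge0 andbT.
apply/ler_addgt0Pr => e e0; rewrite add0r.
set t := (s * r^-1)%g.
have v1 : 0 < rnorm v + 1 by have := rnorm_ge0 v; lra.
have e2 : 0 < e / 2 / (rnorm v + 1) by rewrite !divr_gt0.
have [N1 H1] := Hc t _ e2; have [N2 H2] := inv_nat_small e2.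
set n := maxn N1 N2.
have hn := H1 n (leq_maxl _ _).
have hn2 := le_lt_trans (inv_nat_anti (leq_maxr N1 N2)) H2.
rewrite -(subrKA (integrated (f_ n) (l2_delta r v) s)).
apply: (le_trans (ler_rnormD _ _)); rewrite [e]splitr; apply: lerD.
  rewrite -l2BE -fct_subE; apply: (le_trans (l2_eval_le _ _)).
  apply: (le_trans ((Hf n).2 _)).
  apply: (@le_trans _ _ (e / 2 / (rnorm v + 1) * (rnorm v + 1))).
    apply: ler_pM; rewrite ?rnorm_ge0//.
    - exact: ltW.
    - by apply: (le_trans (rnorm_delta _ _)); lra.
  by rewrite divfK// gt_eqF.
rewrite (integrated_coef (Hf n).1) -/t -(repB rep).
rewrite -(linear_funB (act_lin _)); apply: (le_trans (rep_act_le _ _ _)).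
apply: (@le_trans _ _ (e / 2 / (rnorm v + 1) * (rnorm v + 1))).
  apply: ler_pM; rewrite ?rnorm_ge0 ?cnorm_ge0//; first exact: ltW.
  lra.
by rewrite divfK// gt_eqF.
Qed.

(** By [has_coef_uniq] the choice is canonical wherever coefficients exist; the default 0 is taken
    only elsewhere. *)
Definition coef y : G -> A := xget 0 [set c | has_coef y c].

Lemma coefP y : crossed y -> has_coef y (coef y).
Proof.
move=> /crossed_has_coef[c yc].
by apply: (@xgetPex _ 0 [set c | has_coef y c]); exists c.
Qed.

Lemma coefE y c : has_coef y c -> coef y = c.
Proof. by move=> yc; apply: xget_unique => // c' yc'; exact: has_coef_uniq yc' yc. Qed.

Lemma coef_lin (k : R[i]) y z : crossed y -> crossed z ->
  coef (k *: y + z) = k *: coef y + coef z.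
Proof. by move=> Dy Dz; apply/coefE/has_coef_linear; exact: coefP. Qed.

Lemma coef_integrated f : l1 f -> coef (integrated f) = f.
Proof. by move=> l1f; apply/coefE/integrated_coef. Qed.

End CrossedProductTheory.

(** * From multipliers to maps on the crossed product *)

Section CbLimits.
Variables (R : realType) (K : normedModType R[i]).

Lemma mx_le_lim (J : finType) (T : J -> J -> K -> K) b : 0 <= b ->
  (forall e, 0 < e -> mx_le T (b + e)) -> mx_le T b.
Proof.
move=> b0 Te v; set M := \sum_k rnorm (v k) ^+ 2.
have M0 : 0 <= M by exact: sumr_sqr_ge0.
apply/ler_addgt0Pr => d d0.
have c0 : 0 < (2 * b + 1) * M + 1 by nra.
(* For [e <= 1] the square [(b + e) ^+ 2] exceeds [b ^+ 2] by at most [(2 * b + 1) * e]. *)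
pose e := Num.min 1 (d / ((2 * b + 1) * M + 1)).
have e0 : 0 < e by rewrite lt_min ltr01 divr_gt0.
have e1 : e <= 1 by rewrite ge_min lexx.
have ed : e * ((2 * b + 1) * M + 1) <= d.
  by rewrite -ler_pdivlMr// ge_min lexx orbT.
apply: (le_trans (Te e e0 v)); rewrite -/M.
have : e * e * M <= e * M by rewrite ler_wpM2r// ger_pMl.
nra.
Qed.

Lemma mx_le0 (J : finType) : mx_le (fun _ _ : J => (0 : K -> K)) 0.
Proof.
move=> v; rewrite expr0n mul0r big1// => i _.
by rewrite big1 ?rnorm0 ?expr0n.
Qed.

Lemma mx_le_sum (J I : finType) (S : I -> J -> J -> K -> K) (b : I -> R) :
  (forall i, 0 <= b i) -> (forall i, mx_le (S i) (b i)) ->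
  mx_le (fun k l => \sum_i S i k l) (\sum_i b i).
Proof.
move=> b0 Sb; have [//] : mx_le (fun k l => \sum_i S i k l) (\sum_i b i) /\ 0 <= \sum_i b i.
rewrite (_ : (fun k l => \sum_i S i k l) = \sum_i S i); last first.
  apply/funext => k; apply/funext => l.
  by elim/big_rec2 : _ => // i x y _ ->.
elim/big_rec2 : _ => [|i x U _ [Ux x0]]; first by split; [exact: mx_le0|].
by split; [exact: mx_leD|exact: addr_ge0].
Qed.

Lemma mx_le_ext (J : finType) (S U : J -> J -> K -> K) b :
  (forall k l, S k l = U k l) -> mx_le S b -> mx_le U b.
Proof.
by move=> SU; have -> : U = S by apply/funext => k; apply/funext => l.
Qed.

Lemma finite_rank_sum (X : lmodType R[i]) (D : set X) (I : Type) (r : seq I)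
    (phi : I -> X -> X) : (forall i, finite_rank D (phi i)) ->
  finite_rank D (fun x => \sum_(i <- r) phi i x).
Proof.
move=> fr; elim: r => [|i r [n [b Hb]]].
  by exists 0%N, (fun=> 0) => x Dx; exists (fun=> 0); rewrite big_nil big_ord0.
have [m [a Ha]] := fr i.
exists (m + n)%N, (fun k => match fintype.split k with inl k1 => a k1 | inr k2 => b k2 end).
move=> x Dx; have [c cE] := Ha x Dx; have [d dE] := Hb x Dx.
exists (fun k => match fintype.split k with inl k1 => c k1 | inr k2 => d k2 end).
rewrite big_cons cE dE big_split_ord /=; congr (_ + _); apply: eq_bigr => k _.
  by rewrite (unsplitK (inl k)).
by rewrite (unsplitK (inr k)).
Qed.

Lemma directed_fin (I : Type) (le : I -> I -> Prop) (T : eqType) (r : seq T)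
    (P : T -> I -> Prop) : directed le ->
  (forall t, t \in r -> exists i0, forall i, le i0 i -> P t i) ->
  exists i0, forall i, le i0 i -> forall t, t \in r -> P t i.
Proof.
move=> [[k0] _ letr ledir]; elim: r => [|t r IH] H1; first by exists k0.
have [i1 H2] := H1 t (mem_head _ _).
have [|i2 H3] := IH; first by move=> t' t'r; apply: H1; rewrite in_cons t'r orbT.
have [i0 [i01 i02]] := ledir i1 i2.
exists i0 => k ik t'; rewrite in_cons => /orP[/eqP->|t'r].
  by apply: H2; exact: letr ik.
by apply: H3 => //; exact: letr ik.
Qed.

End CbLimits.

Section Multipliers.
Variables (R : realType) (A : unitalCStarType R) (G : groupType).
Variables (alpha : G -> A -> A) (H : hilbertType R) (rho : A -> H -> H).
Hypotheses (act : is_action alpha) (rep : is_faithful_rep rho).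
Local Notation K := (l2 G H).
Local Notation integrated := (integrated alpha rho).
Local Notation crossed := (crossed_product alpha rho).
Local Notation l1_image := (l1_image alpha rho).
Local Notation pilam := (pilam alpha rho).
Local Notation coef := (coef alpha rho).
Implicit Types (f g : G -> A) (a : A) (s t r : G) (y : K -> K) (S : (K -> K) -> (K -> K)).

Lemma linear_id (X : lmodType R[i]) : linear (id : X -> X).
Proof. by []. Qed.

Lemma l1_image_linear y : l1_image y -> linear y.
Proof. by move=> /(l1_image_crossed act rep)/crossed_linear. Qed.

Lemma crossed_cb_mapP S : cb_map id crossed S <->
  linear_on crossed S /\ exists2 C, 0 <= C & cb_le id crossed S C.
Proof.
apply: cb_mapP; first exact: linear_id.
- by move=> y; exact: crossed_linear.
- exact: crossed0.
- by move=> c y; exact: crossedZ.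
Qed.

Lemma crossed_cbnorm_leP S C : linear_on crossed S -> 0 <= C ->
  (cbnorm id crossed S <= C%:E)%E <-> cb_le id crossed S C.
Proof.
apply: cbnorm_leP; first exact: linear_id.
- by move=> y; exact: crossed_linear.
- exact: crossed0.
- by move=> c y; exact: crossedZ.
Qed.

Lemma l1_image_cb_mapP S : cb_map id l1_image S <->
  linear_on l1_image S /\ exists2 C, 0 <= C & cb_le id l1_image S C.
Proof.
apply: cb_mapP; first exact: linear_id.
- exact: l1_image_linear.
- exact: l1_image0.
- by move=> c y; exact: l1_imageZ.
Qed.

Lemma rho_cb_mapP (phi : A -> A) : cb_map rho setT phi <->
  linear_on setT phi /\ exists2 C, 0 <= C & cb_le rho setT phi C.
Proof.
apply: cb_mapP => //; first exact: rep_linear rep.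
by move=> a _; exact: rep_lin.
Qed.

(** The 1 x 1 case of complete boundedness, carried back to [cnorm] by [rep_bounded_below]. *)
Lemma rho_cb_bounded (phi : A -> A) : cb_map rho setT phi ->
  linear phi /\ exists2 C, 0 <= C & forall a, cnorm (phi a) <= C * cnorm a.
Proof.
move=> /rho_cb_mapP[[_ lphi] [C C0 phiC]].
have lp : linear phi by move=> c x y; exact: lphi.
split=> //; exists (2 * C); first by rewrite mulr_ge0.
move=> a; have := cnorm_ge0 a; rewrite le_eqVlt => /orP[/eqP a0|a0].
  have -> : a = 0 by exact/cnorm0_eq0/esym.
  by rewrite linear_fun0// cnorm0 mulr0.
rewrite -mulrA; apply: (rep_bounded_below rep); first by rewrite mulr_ge0 ?cnorm_ge0.
exact: (cb_le_op C0 phiC _ a0 (rep_contractive rep a)).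
Qed.

Lemma crossed_cb_op S C y b : 0 <= C -> cb_le id crossed S C -> crossed y ->
  0 < b -> op_le y b -> op_le (S y) (C * b).
Proof. by move=> C0 SC Dy b0 yb; exact: (cb_le_op C0 SC Dy b0 yb). Qed.

Lemma linear_onB (X : lmodType R[i]) (D : set X) phi x x' :
  linear_on D phi -> D x -> D x' -> phi (x - x') = phi x - phi x'.
Proof.
by move=> [_ lphi] Dx Dx'; rewrite addrC -scaleN1r lphi// scaleN1r addrC.
Qed.

Section FiniteSupport.
Variables (F : G -> A -> A) (Q : {fset G}).
Hypotheses (FQ : forall t, t \notin Q -> F t = 0) (lF : forall t, linear (F t)).

Definition finite_mult y : K -> K := \sum_(t <- Q) pilam t (F t (coef y t)).

Lemma finite_mult_l1_image y : l1_image (finite_mult y).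
Proof.
pose f t := if t \in Q then F t (coef y t) else 0.
have f0 t : t \notin Q -> f t = 0 by rewrite /f => /negbTE ->.
exists f; first exact: l1_finite f0.
rewrite (integrated_finite act rep f0) /finite_mult.
by apply: eq_big_seq => t tQ; rewrite /f tQ.
Qed.

Lemma finite_mult_crossed y : crossed (finite_mult y).
Proof. exact/(l1_image_crossed act rep)/finite_mult_l1_image. Qed.

Lemma finite_mult_lin c y z : crossed y -> crossed z ->
  finite_mult (c *: y + z) = c *: finite_mult y + finite_mult z.
Proof.
move=> Dy Dz; rewrite /finite_mult scaler_sumr -big_split /=.
apply: eq_bigr => t _; rewrite (coef_lin act rep)//.
rewrite (lF t c (coef y t)).
exact: (pilam_linear act rep).
Qed.

Lemma finite_mult_linear_on : linear_on crossed finite_mult.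
Proof.
by split=> *; [exact: finite_mult_crossed|exact: finite_mult_lin].
Qed.

Lemma finite_mult_linear_on_l1 : linear_on l1_image finite_mult.
Proof.
split=> [y _|c y z Dy Dz]; first exact: finite_mult_l1_image.
by apply: finite_mult_lin; exact: (l1_image_crossed act rep).
Qed.

Lemma finite_mult_integrated f : l1 f ->
  finite_mult (integrated f) = integrated (pw_act F f).
Proof.
move=> l1f; rewrite (@integrated_finite _ _ _ _ _ _ act rep (pw_act F f) Q).
  by rewrite /finite_mult (coef_integrated act rep).
by move=> t /FQ Ft; rewrite /pw_act Ft.
Qed.

Lemma finite_mult_op (M : G -> R) : (forall t, 0 <= M t) ->
  (forall t a, cnorm (F t a) <= M t * cnorm a) ->
  exists2 C, 0 <= C & forall y b, crossed y -> 0 <= b -> op_le y b ->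
    op_le (finite_mult y) (C * b).
Proof.
move=> M0 FM; exists (\sum_(t <- Q) M t * 2).
  by apply: sumr_ge0 => t _; rewrite mulr_ge0.
move=> y b Dy b0 yb; rewrite mulr_suml; apply: op_le_sum => t _.
apply: op_leW (pilam_le act rep _ _); apply: (le_trans (FM _ _)).
rewrite -mulrA ler_wpM2l//.
exact: (has_coef_le act rep _ (coefP act rep Dy)).
Qed.

Hypothesis FM : exists M : G -> R, (forall t, 0 <= M t) /\
  (forall t a, cnorm (F t a) <= M t * cnorm a).

(** A Herz-Schur bound is given on [l1_image] and has to reach the closure with the same [C]. The
    entries are moved into [l1_image] by at most [d]; the errors involve the square of the size of
    [J] and the crude operator bound [C'], both fixed before [d]. *)
Lemma finite_mult_extend C : 0 <= C -> cb_le id l1_image finite_mult C ->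
  cb_le id crossed finite_mult C.
Proof.
move=> C0 FC J x b b0 Dx xb.
have [M [M0 FM']] := FM; have [C' C'0 FC'] := finite_mult_op M0 FM'.
apply: mx_le_lim => [|e e0]; first by rewrite mulr_ge0// ltW.
set N : R := (#|J| ^ 2)%:R; have N0 : 0 <= N by rewrite ler0n.
have c0 : 0 < C * N + N * C' + 1 by have := mulr_ge0 C0 N0; have := mulr_ge0 N0 C'0; lra.
set d := e / (C * N + N * C' + 1); have d0 : 0 < d by exact: divr_gt0.
have /choice[z_ Hz] : forall ik : J * J, exists z,
    l1_image z /\ op_le (x ik.1 ik.2 - z) d.
  move=> [i k]; have [f l1f xf] := crossed_approx act rep (Dx i k) d0.
  by exists (integrated f); split=> //; exists f.
pose z i k := z_ (i, k).
have Dz i k : l1_image (z i k) by case: (Hz (i, k)).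
have Dzc i k : crossed (z i k) by exact: (l1_image_crossed act rep).
have xz i k : op_le (x i k - z i k) d by case: (Hz (i, k)).
have zb : mx_le (fun i k => z i k) (b + N * d).
  have := mx_leD (ltW b0) (mulr_ge0 N0 (ltW d0)) xb
    (mx_le_entry (ltW d0) (fun i k => op_leB_sym (xz i k))).
  move=> H1 v; apply: le_trans (H1 v); rewrite le_eqVlt; apply/orP; left; apply/eqP.
  apply: eq_bigr => i _; congr (rnorm _ ^+ 2); apply: eq_bigr => k _.
  by rewrite addrC subrK.
have b1 : 0 < b + N * d by rewrite ltr_wpDr// mulr_ge0// ltW.
have Fz := FC J z _ b1 Dz zb.
have Fxz i k : op_le (finite_mult (x i k - z i k)) (C' * d).
  by apply: FC' => //; [exact: (crossedB act rep)|exact: ltW].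
have CN0 : 0 <= C * (b + N * d) by exact: mulr_ge0 C0 (ltW b1).
have C'd0 : 0 <= C' * d by exact: mulr_ge0 C'0 (ltW d0).
have H1 := mx_leD CN0 (mulr_ge0 N0 C'd0) Fz (mx_le_entry C'd0 Fxz).
apply: (@mx_leW _ _ _ _ (C * (b + N * d) + N * (C' * d))).
- by rewrite addr_ge0// mulr_ge0.
- have : d * (C * N + N * C' + 1) = e by rewrite divfK// gt_eqF.
  lra.
- move=> v; apply: le_trans (H1 v); rewrite le_eqVlt; apply/orP; left; apply/eqP.
  apply: eq_bigr => i _; congr (rnorm _ ^+ 2); apply: eq_bigr => k _.
  by rewrite (linear_onB finite_mult_linear_on)// addrC subrK.
Qed.

Lemma is_S_on_finite_mult C : 0 <= C -> cb_le id l1_image finite_mult C ->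
  is_S_on alpha rho crossed F finite_mult.
Proof.
move=> C0 FC; split; last exact: finite_mult_integrated.
apply/crossed_cb_mapP; split; first exact: finite_mult_linear_on.
by exists C => //; exact: finite_mult_extend.
Qed.

(** [S_ext] is an arbitrary choice among extensions, so it has to be identified: two bounded maps
    that agree on [l1] sums agree on their closure. *)
Lemma is_S_on_unique S y : is_S_on alpha rho crossed F S -> crossed y ->
  S y = finite_mult y.
Proof.
move=> [/crossed_cb_mapP[lS [C C0 SC]] SF] Dy.
have [M [M0 FM']] := FM; have [C' C'0 FC'] := finite_mult_op M0 FM'.
apply: op_le_eq => e e0.
have c0 : 0 < C + C' + 1 by lra.
have d0 : 0 < e / (C + C' + 1) by exact: divr_gt0.
have [f l1f yf] := crossed_approx act rep Dy d0.
have Df : crossed (integrated f) by apply: (l1_image_crossed act rep); exists f.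
have Dyf := crossedB act rep Dy Df.
have -> : S y - finite_mult y = S (y - integrated f) - finite_mult (y - integrated f).
  rewrite (linear_onB lS)// (linear_onB finite_mult_linear_on)//.
  by rewrite SF// finite_mult_integrated// opprB [RHS]addrA subrK.
apply: (@op_leW _ _ _ (C * (e / (C + C' + 1)) + C' * (e / (C + C' + 1)))).
  have : (C + C' + 1) * (e / (C + C' + 1)) = e by rewrite mulrC divfK// gt_eqF.
  by move: d0; set d := e / _; lra.
apply: op_leB; first exact: (crossed_cb_op C0 SC).
by apply: FC' => //; exact: ltW.
Qed.

Lemma S_extE C y : 0 <= C -> cb_le id l1_image finite_mult C -> crossed y ->
  S_ext alpha rho F y = finite_mult y.
Proof.
move=> C0 FC Dy; apply: is_S_on_unique; last exact: Dy.
apply: (@xgetPex _ 0 [set S | is_S_on alpha rho crossed F S]).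
by exists finite_mult; exact: (is_S_on_finite_mult C0).
Qed.

End FiniteSupport.

Lemma herz_schur_finite (F : G -> A -> A) : herz_schur alpha rho F ->
  finite_set [set t | F t <> 0] -> exists Q : {fset G},
  [/\ forall t, t \notin Q -> F t = 0, forall t, linear (F t),
      exists M : G -> R, (forall t, 0 <= M t) /\
        (forall t a, cnorm (F t a) <= M t * cnorm a)
    & exists2 C, 0 <= C & cb_le id l1_image (finite_mult F Q) C].
Proof.
move=> [[cbF _] [S [/l1_image_cb_mapP[lS [C C0 SC]] SF]]] finF.
exists (fset_set [set t | F t <> 0]).
have FQ t : t \notin fset_set [set t | F t <> 0] -> F t = 0.
  move=> tQ; apply: contrapT => Ft.
  by move: tQ; rewrite in_fset_set//= => /negP; apply; exact/mem_set.
have lF t : linear (F t) by have [] := rho_cb_bounded (cbF t).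
split=> //.
  have /choice[M HM] : forall t, exists M, 0 <= M /\ forall a, cnorm (F t a) <= M * cnorm a.
    by move=> t; have [_ [M M0 HM]] := rho_cb_bounded (cbF t); exists M.
  by exists M; split=> t; case: (HM t).
exists C => // J x b b0 Dx xb v; apply: le_trans (SC J x b b0 Dx xb v).
rewrite le_eqVlt; apply/orP; left; apply/eqP.
apply: eq_bigr => i _; congr (rnorm _ ^+ 2); apply: eq_bigr => k _.
have [f l1f <-] := Dx i k.
by rewrite SF// finite_mult_integrated.
Qed.

(** The constant passes unchanged because [HSnorm] is by definition the [cbnorm] of [S_ext]. What
    remains is finite rank, and convergence on the whole crossed product, which follows from that of
    each [F i t a] and the uniform bound. *)
Lemma wa_cbap_with C : weakly_amenable_with alpha rho C -> cbap_with crossed C.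
Proof.
move=> [I [le [F [dir HF Fa CE Cfin]]]].
have /choice[Q HQ] := fun i => let: And3 hs fin _ := HF i in herz_schur_finite hs fin.
have SE i y : crossed y -> S_ext alpha rho (F i) y = finite_mult (F i) (Q i) y.
  by have [FQ lF FM [C0 C00 FC]] := HQ i; move=> Dy; exact: (S_extE FQ lF FM C00 FC).
have isS i : is_S_on alpha rho crossed (F i) (S_ext alpha rho (F i)).
  have [FQ lF FM [C0 C00 FC]] := HQ i.
  apply: (@xgetPex _ 0 [set S | is_S_on alpha rho crossed (F i) S]).
  by exists (finite_mult (F i) (Q i)); exact: (is_S_on_finite_mult FQ lF FM C00 FC).
exists I, le, (fun i => S_ext alpha rho (F i)); split; [exact: dir| | |exact: CE|exact: Cfin].
  move=> i; split; first by case: (isS i).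
  have [_ _ fr] := HF i.
  have [n [bb Hb]] := @finite_rank_sum R _ crossed G (Q i)
    (fun t y => pilam t (F i t (coef y t))) (fun t => ltac:(
      have [n [b Hb]] := fr t; exists n, (fun k => pilam t (b k)) => y _;
      have [c ->] := Hb (coef y t) Logic.I; exists c;
      rewrite (linear_fun_sum (pilam_linear act rep t));
      by apply: eq_bigr => k _; rewrite (linear_funZ (pilam_linear act rep t)))).
  by exists n, bb => y Dy; rewrite SE//; exact: Hb.
have [c c0 HC] : exists2 c, 0 <= c & forall i, cb_le id crossed (S_ext alpha rho (F i)) c.
  have C0 : (0 <= C)%E.
    have [[k] _ _ _] := dir; rewrite CE.
    apply: (@le_trans _ _ (HSnorm alpha rho (F k))); last first.
      by apply: ereal_sup_ubound; exists k.
    by have [[lS _] _] := isS k; exact: cbnorm_ge0.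
  have Cf : C \is a fin_num by rewrite ge0_fin_numE.
  exists (fine C); first exact: fine_ge0.
  move=> i; have [[lS _] _] := isS i.
  apply/(crossed_cbnorm_leP lS); first exact: fine_ge0.
  by rewrite fineK// CE; apply: ereal_sup_ubound; exists i.
move=> y Dy e e0.
have c4 : 0 < 8 * (c + 1) by lra.
(* Sized for the final estimate: the two error terms [c * (2 * d)] and [2 * d] make [e / 4], the
   finite sum adds [e / 4], and the total [e / 2] leaves room for the strict inequality. *)
set d := e / (8 * (c + 1)); have d0 : 0 < d by exact: divr_gt0.
have cd : (c + 1) * d = e / 8.
  by rewrite /d; field; rewrite gt_eqF//; lra.
have [f l1f yf] := crossed_approx act rep Dy d0.
have [F0 HF0] := integrated_approx act rep l1f d0.
have {}HF0 := HF0 F0 (fsubset_refl _).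
set z := \sum_(t <- F0) pilam t (f t) in HF0.
(* After truncation to [F0], convergence amounts to finitely many conditions on [i], which
   directedness satisfies at once. *)
pose f' t := if t \in F0 then f t else 0.
have f'0 t : t \notin F0 -> f' t = 0 by rewrite /f' => /negbTE ->.
have zE : integrated f' = z.
  rewrite (integrated_finite act rep f'0); apply: eq_big_seq => t tF0.
  by rewrite /f' tF0.
have l1f' := l1_finite f'0.
have Dz : crossed z by apply: (l1_image_crossed act rep); exists f'.
have SzE i : S_ext alpha rho (F i) z = \sum_(t <- F0) pilam t (F i t (f t)).
  have [_ lF _ _] := HQ i.
  rewrite -zE; have [_ ->//] := isS i.
  rewrite (@integrated_finite _ _ _ _ _ _ act rep (pw_act (F i) f') F0).
    by apply: eq_big_seq => t tF0; rewrite /pw_act /f' tF0.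
  by move=> t /f'0 ft; rewrite /pw_act ft linear_fun0.
(* The successor keeps the divisor positive when [F0] is empty. *)
set n := (size F0).+1%:R : R; have n0 : 0 < n by rewrite ltr0n.
have [i0 Hi0] := @directed_fin I le G F0
  (fun t i => cnorm (F i t (f t) - f t) < e / 4 / n) dir (fun t _ => ltac:(
   have [i0 Hi0] := Fa t (f t) (e / 4 / n) ltac:(by rewrite !divr_gt0);
   by exists i0 => k /Hi0; rewrite lte_fin)).
exists i0 => i /Hi0 Hi.
apply: (@le_lt_trans _ _ (e / 2)%:E); last by rewrite lte_fin; lra.
have [[lS _] _] := isS i.
have yz : op_le (y - z) (2 * d).
  by rewrite [2 * d]mulrDl mul1r; exact: op_leB_trans yf HF0.
have Dyz := crossedB act rep Dy Dz.
have lSyy : linear (S_ext alpha rho (F i) y - y).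
  by apply: linear_fctB; apply: crossed_linear; [exact: lS.1 Dy|exact: Dy].
apply/(opnorm_leP lSyy); first by rewrite divr_ge0// ltW.
have -> : S_ext alpha rho (F i) y - y =
    S_ext alpha rho (F i) (y - z) + (S_ext alpha rho (F i) z - z) - (y - z).
  by rewrite (linear_onB lS Dy Dz) subrKA opprB subrKA.
apply: (@op_leW _ _ _ (c * (2 * d) + e / 4 + 2 * d)).
  have : c * (2 * d) + 2 * d = 2 * (e / 8) by rewrite -cd; ring.
  by clearbody d; lra.
apply: op_leB; last exact: yz.
apply: op_leD.
  by apply: (crossed_cb_op c0 (HC i) Dyz _ yz); rewrite mulr_gt0.
rewrite SzE /z -sumrB.
apply: (@op_leW _ _ _ (\sum_(t <- F0) e / 4 / n)).
  rewrite big_const_seq count_predT iter_addr_0 -[X in X <= _]mulr_natr.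
  rewrite mulrAC ler_pdivrMr// ler_wpM2l ?divr_ge0 ?ltW//.
  by rewrite /n ltr_nat.
rewrite big_seq [X in op_le _ X]big_seq.
apply: op_le_sum => t tF0; rewrite -(linear_funB (pilam_linear act rep t)).
exact: op_leW (ltW (Hi t tF0)) (pilam_le act rep _ _).
Qed.

End Multipliers.

(** * From maps on the crossed product to multipliers *)

Section FiniteRankMaps.
Variables (R : realType) (A : unitalCStarType R) (G : groupType).
Variables (alpha : G -> A -> A) (H : hilbertType R) (rho : A -> H -> H).
Hypotheses (act : is_action alpha) (rep : is_faithful_rep rho).
Local Notation K := (l2 G H).
Local Notation integrated := (integrated alpha rho).
Local Notation crossed := (crossed_product alpha rho).
Local Notation pilam := (pilam alpha rho).
Implicit Types (f g : G -> A) (a : A) (s t r : G) (y : K -> K) (T : (K -> K) -> (K -> K)).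

(** For [p = (s, xi, w)] this is the matrix coefficient of [y] between [xi] and the vector [w]
    placed at [s]. *)
Definition vector_functional (p : G * K * H) (y : K -> K) : R[i] :=
  hdot (y p.1.2 p.1.1) p.2.

Lemma vector_functional_lin p : linear (vector_functional p : (K -> K) -> (R[i])^o).
Proof.
move=> c y z; rewrite /vector_functional fct_addE fct_scaleE l2DE l2ZE.
by rewrite linearDl /=; congr (_ + _); exact: hdotZ.
Qed.

Lemma vector_functional_sum p (J : finType) (c : J -> R[i]) (y : J -> K -> K) :
  vector_functional p (\sum_j c j *: y j) = \sum_j c j * vector_functional p (y j).
Proof.
rewrite (linear_fun_sum (vector_functional_lin p)); apply: eq_bigr => j _.
exact: (linear_funZ (vector_functional_lin p)).
Qed.

Lemma vector_functional_sep y : (forall p, vector_functional p y = 0) -> y = 0.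
Proof.
move=> y0; apply/funext => xi; apply: l2P => s; apply: rnorm_eq0.
have := y0 (s, xi, y xi s); rewrite /vector_functional /= hdot_rnorm.
by move=> /complexI/eqP; rewrite sqrf_eq0 => /eqP.
Qed.

Lemma crossed_sum (J : finType) (c : J -> R[i]) (x : J -> K -> K) :
  (forall j, crossed (x j)) -> crossed (\sum_j c j *: x j).
Proof.
move=> Dx; elim/big_rec : _ => [|j y _ Dy]; first exact: (crossed0 act rep).
exact: (crossed_lin act rep _ (Dx j) Dy).
Qed.

Lemma linear_on_sum T (J : finType) (c : J -> R[i]) (x : J -> K -> K) :
  linear_on crossed T -> (forall j, crossed (x j)) ->
  T (\sum_j c j *: x j) = \sum_j c j *: T (x j).
Proof.
move=> lT Dx.
suff [] : crossed (\sum_j c j *: x j) /\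
  T (\sum_j c j *: x j) = \sum_j c j *: T (x j) by [].
elim/big_rec2 : _ => [|j y z _ [Dz TE]].
  split; first exact: (crossed0 act rep).
  have D0 := crossed0 act rep.
  by rewrite -(scale0r (0 : K -> K)) (linear_onZ D0 0 lT D0) !scale0r.
split; first exact: (crossed_lin act rep _ (Dx j) Dz).
by rewrite (lT.2 _ _ _ (Dx j) Dz) TE.
Qed.

(* A maximal invertible matrix of values of vector functionals on the range
   replaces a choice of a basis of the range and of a dual basis of bounded
   functionals. *)
Lemma finite_rank_basis T : linear_on crossed T -> finite_rank crossed T ->
  exists m (x : 'I_m -> K -> K) (p : 'I_m -> G * K * H) (N : 'M[R[i]]_m),
  (forall j, crossed (x j)) /\
  forall y, crossed y -> T y =
    \sum_j (\sum_i N j i * vector_functional (p i) (T y)) *: T (x j).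
Proof.
move=> lT [n [b Tb]].
pose M m (x : 'I_m -> K -> K) (p : 'I_m -> G * K * H) : 'M[R[i]]_m :=
  \matrix_(i, j) vector_functional (p i) (T (x j)).
pose P m := exists (x : 'I_m -> K -> K) (p : 'I_m -> G * K * H),
  (forall j, crossed (x j)) /\ M m x p \in unitmx.
have P0 : exists m, `[< P m >].
  exists 0%N; apply/asboolP; exists (fun=> 0), (fun=> (1%g, 0, 0)); split; first by case.
  by rewrite unitmxE det_mx00 unitr1.
(* [M] factors through the [n] coordinates on the range of [T], so its rank is at most [n]. *)
have Pn m : `[< P m >] -> (m <= n)%N.
  move=> /asboolP[x [p [Dx Mu]]].
  have /choice[c Hc] j := Tb (x j) (Dx j).
  have ME : M m x p = (\matrix_(i, k) vector_functional (p i) (b k)) *m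
      (\matrix_(k, j) c j k).
    apply/matrixP => i j; rewrite !mxE Hc vector_functional_sum.
    by apply: eq_bigr => k _; rewrite !mxE mulrC.
  by rewrite -(mxrank_unit Mu) ME mulmx_max_rank.
have [m /asboolP[x [p [Dx Mu]]] mmax] := ex_maxnP P0 Pn.
exists m, x, p, (invmx (M m x p)); split; first exact: Dx.
move=> y Dy.
set N := invmx _.
pose c j := \sum_i N j i * vector_functional (p i) (T y).
pose y' := y - \sum_j c j *: x j.
have Dcx : crossed (\sum_j c j *: x j) by exact: crossed_sum.
have Dy' : crossed y' by exact: (crossedB act rep Dy Dcx).
have Ty' : T y' = T y - \sum_j c j *: T (x j).
  by rewrite (linear_onB lT Dy Dcx) (linear_on_sum _ lT Dx).
apply/subr0_eq; rewrite -/(c _) -Ty'; apply: vector_functional_sep => p0.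
have piy' i : vector_functional (p i) (T y') = 0.
  rewrite Ty' (linear_funB (vector_functional_lin _)) vector_functional_sum.
  apply/eqP; rewrite subr_eq0; apply/eqP.
  pose u : 'cV[R[i]]_m := \col_i vector_functional (p i) (T y).
  have cE j : c j = (N *m u) j 0.
    by rewrite mxE; apply: eq_bigr => k _; rewrite mxE.
  transitivity (u i 0); first by rewrite mxE.
  rewrite -[u]mul1mx -(mulmxV Mu) -mulmxA mxE.
  by apply: eq_bigr => j _; rewrite cE mxE mulrC.
(* Adjoining [y'] and [p0] would enlarge [M] to an invertible block triangular matrix: the new
   corner is nonzero, and the block above it vanishes by [piy']. *)
apply: contrapT => /eqP p0y'.
have : (m + 1 <= m)%N; last by rewrite addn1 ltnn.
apply: mmax; apply/asboolP.
exists (fun k => match fintype.split k with inl j => x j | inr _ => y' end).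
exists (fun k => match fintype.split k with inl j => p j | inr _ => p0 end).
split; first by move=> k; case: fintype.split.
suff -> : M (m + 1)%N (fun k => match fintype.split k with inl j => x j | inr _ => y' end)
    (fun k => match fintype.split k with inl j => p j | inr _ => p0 end) =
    block_mx (M m x p) 0 (\row_j vector_functional p0 (T (x j)))
      (vector_functional p0 (T y'))%:M.
  rewrite unitmxE det_lblock unitrM -unitmxE Mu det_scalar1 /=.
  by rewrite unitfE.
apply/matrixP => i j; rewrite !mxE; case: (fintype.split i) => i1; rewrite !mxE;
  case: (fintype.split j) => j1; rewrite ?mxE//.
by rewrite !ord1 eqxx.
Qed.

Lemma crossed_approx_finite y e : crossed y -> 0 < e ->
  exists f (Q : {fset G}), (forall t, t \notin Q -> f t = 0) /\
    op_le (y - integrated f) e.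
Proof.
move=> Dy e0; have e2 : 0 < e / 2 by apply: divr_gt0.
have [f l1f yf] := crossed_approx act rep Dy e2.
have [Q HQ] := integrated_approx act rep l1f e2.
pose f' t := if t \in Q then f t else 0.
have f'0 t : t \notin Q -> f' t = 0 by rewrite /f' => /negbTE ->.
exists f', Q; split; first exact: f'0.
rewrite [e]splitr; apply: (op_leB_trans yf).
rewrite (integrated_finite act rep f'0).
have -> : \sum_(t <- Q) pilam t (f' t) = \sum_(t <- Q) pilam t (f t).
  by apply: eq_big_seq => t tQ; rewrite /f' tQ.
exact/HQ/fsubset_refl.
Qed.

(** [T y] is written in terms of the [T (x j)], with coordinates given by vector functionals, and
    each [T (x j)] is replaced by a finitely supported sum. The difference is a finite sum of rank
    one maps. The constant [kappa] of the coordinates is known before the approximation, so a small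
    enough [d] brings the sum of their complete bounds below [eta]. *)
Lemma finite_rank_perturb T C eta : linear_on crossed T -> finite_rank crossed T ->
  0 <= C -> cb_le id crossed T C -> 0 < eta ->
  exists m (phi : 'I_m -> (K -> K) -> R[i]) (f : 'I_m -> G -> A) (Q : {fset G}) (B : R),
  [/\ forall j t, t \notin Q -> f j t = 0,
      forall j (c : R[i]) y z, crossed y -> crossed z ->
        phi j (c *: y + z) = c * phi j y + phi j z,
      0 <= B /\ forall j y b, crossed y -> 0 < b -> op_le y b -> rnorm (phi j y) <= B * b,
      cb_le id crossed (fun y => \sum_j phi j y *: integrated (f j)) (C + eta)
    & forall y b, crossed y -> 0 < b -> op_le y b ->
        op_le (T y - \sum_j phi j y *: integrated (f j)) (eta * b)].
Proof.
move=> lT frT C0 TC eta0.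
have [m [x [p [N [Dx TE]]]]] := finite_rank_basis lT frT.
pose kap i := rnorm (p i).1.2 * rnorm (p i).2.
have kap0 i : 0 <= kap i by rewrite mulr_ge0 ?rnorm_ge0.
pose kappa := \sum_j \sum_i rnorm (N j i) * kap i.
have kappa0 : 0 <= kappa.
  by apply: sumr_ge0 => j _; apply: sumr_ge0 => i _; rewrite mulr_ge0 ?rnorm_ge0.
have D0 : 0 < kappa * C + 1 by have := mulr_ge0 kappa0 C0; lra.
(* The factor [C] appears because the functionals are evaluated at [T y] and not at [y]; the 1 keeps
   the divisor positive. *)
set d := eta / (kappa * C + 1); have d0 : 0 < d by exact: divr_gt0.
have DT y : crossed y -> crossed (T y) by case: lT => H1 _; exact: H1.
have /choice[f_ Hf] : forall j, exists fQ : (G -> A) * {fset G},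
    (forall t, t \notin fQ.2 -> fQ.1 t = 0) /\ op_le (T (x j) - integrated fQ.1) d.
  move=> j; have [f [Q [f0 Tf]]] := crossed_approx_finite (DT _ (Dx j)) d0.
  by exists (f, Q).
pose f j := (f_ j).1.
have l1f j : l1 (f j) by exact: l1_finite (Hf j).1.
have lint j : linear (integrated (f j)).
  by have [] := integrated_bounded act rep (l1f j).
pose phi j y := \sum_i N j i * vector_functional (p i) (T y).
pose T' y := \sum_j phi j y *: integrated (f j).
have TT' y : crossed y -> T y - T' y =
    \sum_j \sum_i N j i *: (vector_functional (p i) (T y) *: (T (x j) - integrated (f j))).
  move=> Dy; rewrite {1}(TE _ Dy) -sumrB; apply: eq_bigr => j _.
  rewrite -scalerBr scaler_suml; apply: eq_bigr => i _.
  by rewrite scalerA.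
have cbTT' : cb_le id crossed (fun y => T y - T' y) eta.
  move=> J y b b0 Dy yb; have TyCb := TC J y b b0 Dy yb.
  apply: (@mx_le_ext _ _ _ (fun k l => \sum_j \sum_i
     N j i *: (vector_functional (p i) (T (y k l)) *: (T (x j) - integrated (f j))))).
    by move=> k l; rewrite TT'.
  have cd0 : 0 <= d * (C * b) by rewrite mulr_ge0 ?(ltW d0)// mulr_ge0// ltW.
  apply: (@mx_leW _ _ _ _ (\sum_j \sum_i rnorm (N j i) * (kap i * d * (C * b)))).
  - by apply: sumr_ge0 => j _; apply: sumr_ge0 => i _; rewrite mulr_ge0 ?rnorm_ge0// -mulrA mulr_ge0.
  - have -> : \sum_j \sum_i rnorm (N j i) * (kap i * d * (C * b)) = kappa * (d * (C * b)).
      rewrite mulr_suml; apply: eq_bigr => j _; rewrite mulr_suml.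
      by apply: eq_bigr => i _; rewrite !mulrA.
    have : d * (kappa * C + 1) = eta by rewrite divfK// gt_eqF.
    move=> <-; have -> : kappa * (d * (C * b)) = d * b * (kappa * C) by ring.
    have -> : d * (kappa * C + 1) * b = d * b * (kappa * C + 1) by ring.
    by rewrite ler_wpM2l ?lerDl// mulr_ge0 ?ltW.
  - apply: mx_le_sum => [j|j].
      by apply: sumr_ge0 => i _; rewrite mulr_ge0 ?rnorm_ge0// -mulrA mulr_ge0.
    apply: mx_le_sum => [i|i]; first by rewrite mulr_ge0 ?rnorm_ge0// -mulrA mulr_ge0.
    apply: mx_le_scale.
    apply: (@vector_functional_mx_le R G J H (fun k l => T (y k l)) (C * b)
      (p i).1.2 (p i).1.1 (p i).2 (T (x j) - integrated (f j)) d).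
    + by move=> k l; apply/crossed_linear/DT.
    + exact: TyCb.
    + exact: (Hf j).2.
    + exact: ltW.
exists m, phi, f, (seq_fset tt (flatten [seq ((f_ j).2 : seq G) | j <- enum 'I_m])), (C * kappa).
split.
- move=> j t tQ; apply: (Hf j).1; apply: contraNN tQ => tj.
  rewrite seq_fsetE; apply/flattenP; exists ((f_ j).2 : seq G) => //.
  by apply/mapP; exists j; rewrite ?mem_enum.
- move=> j c y z Dy Dz; rewrite /phi mulr_sumr -big_split /=; apply: eq_bigr => i _.
  rewrite (lT.2 _ _ _ Dy Dz) (vector_functional_lin (p i) c) mulrDr; congr (_ + _).
  by rewrite mulrCA.
- split; first by rewrite mulr_ge0.
  move=> j y b Dy b0 yb; apply: (le_trans (rnorm_sum _ _ _)).
  apply: (@le_trans _ _ (\sum_i rnorm (N j i) * (kap i * (C * b)))).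
    apply: ler_sum => i _; rewrite rnormM ler_wpM2l ?rnorm_ge0//.
    apply: (le_trans (cauchy_schwarz _ _)).
    rewrite /kap mulrAC ler_wpM2r ?rnorm_ge0//.
    apply: (le_trans (l2_eval_le _ _)).
    by apply: (le_trans (crossed_cb_op C0 TC Dy b0 yb _)); rewrite mulrC.
  have -> : C * kappa * b = \sum_j0 \sum_i rnorm (N j0 i) * (kap i * (C * b)).
    rewrite mulrAC mulr_sumr; apply: eq_bigr => j0 _; rewrite mulr_sumr.
    by apply: eq_bigr => i _; ring.
  rewrite [leRHS](bigD1 j)//= lerDl; apply: sumr_ge0 => j0 _; apply: sumr_ge0 => i _.
  by rewrite mulr_ge0 ?rnorm_ge0// mulr_ge0// mulr_ge0// ltW.
- move=> J y b b0 Dy yb.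
  apply: (@mx_le_ext _ _ _ (fun k l => T (y k l) + (- (T (y k l) - T' (y k l))))).
    by move=> k l; rewrite opprB addrC subrK.
  rewrite mulrDl; apply: mx_leD.
  + by rewrite mulr_ge0// ltW.
  + by rewrite mulr_ge0// ltW.
  + exact: TC.
  + have := mx_le_scale (-1) (cbTT' J y b b0 Dy yb).
    rewrite rnormN rnorm1 mul1r; apply: mx_le_ext => k l.
    by rewrite scaleN1r.
- by move=> y b Dy b0 yb; exact: (crossed_cb_op (ltW eta0) cbTT' Dy b0 yb).
Qed.

End FiniteRankMaps.

Lemma l2_sum_inj_le (R : realType) (I : choiceType) (H : normedModType R[i])
    (x : l2 I H) (I' : eqType) (k : I' -> I) (W : seq I') : uniq W -> injective k ->
  \sum_(u <- W) rnorm (x (k u)) ^+ 2 <= rnorm x ^+ 2.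
Proof.
move=> uW kI; rewrite -(big_map k xpredT (fun s => rnorm (x s) ^+ 2)).
by apply: l2_sum_le; rewrite map_inj_uniq.
Qed.

(** * Diagonals of an operator as matrices over finite subsets of the group *)

Section Transfer.
Variables (R : realType) (A : unitalCStarType R) (G : groupType).
Variables (alpha : G -> A -> A) (H : hilbertType R) (rho : A -> H -> H).
Hypotheses (act : is_action alpha) (rep : is_faithful_rep rho).
Local Notation K := (l2 G H).
Local Notation integrated := (integrated alpha rho).
Local Notation crossed := (crossed_product alpha rho).
Local Notation pilam := (pilam alpha rho).
Local Notation coef := (coef alpha rho).
Local Notation has_coef := (has_coef alpha rho).
Implicit Types (f g : G -> A) (a : A) (y : K -> K).

(** Right translation by [q] leaves [(s * q) * (r * q)^-1 = s * r^-1], so the same coefficients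
    occur for every [q] and only the action on them changes. *)
Lemma crossed_delta_sum y (P : {fset G}) (z : P -> H) (q s : G) : crossed y ->
  y (\sum_r l2_delta (val r * q)%g (z r)) (s * q)%g =
  \sum_(r : P) rho (alpha (s * q)^-1%g (coef y (s * (val r)^-1)%g)) (z r).
Proof.
move=> Dy; rewrite (linear_fun_sum (crossed_linear Dy)) l2_sumE.
apply: eq_bigr => r _; rewrite (coefP act rep Dy).
by rewrite mulgKA.
Qed.

(* For fixed [q], the column [r |-> zeta (l, r) (r * q)] is read as the vector
   [\sum_r delta_(r q)] of [l2 G H]; the matrix of diagonals then acts on it as
   [x k l] does, and the squared norms are summed over [q]. *)
Lemma diagonals_mx_le (J : finType) (P : {fset G}) (x : J -> J -> K -> K) b :
  (forall k l, crossed (x k l)) -> mx_le x b ->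
  mx_le (fun ks lr : J * P => pilam (val ks.2 * (val lr.2)^-1)%g
    (coef (x ks.1 lr.1) (val ks.2 * (val lr.2)^-1)%g)) b.
Proof.
move=> Dx xb zeta; apply: l2_sum_sqr_le => W uW.
pose om q l : K := \sum_(r : P) l2_delta (val r * q)%g (zeta (l, r) (val r * q)%g).
pose h (s : P) q := \sum_k rnorm ((\sum_l x k l (om q l)) (val s * q)%g) ^+ 2.
have h0 s q : 0 <= h s q by exact: sumr_sqr_ge0.
(* At coordinate [u] take [q = s^-1 * u]: then the row [s * q] is [u], and [pilam] at [s * r^-1]
   reads [zeta (l, r)] exactly at [r * q]. *)
have E k (s : P) u : (\sum_(lr : J * P) pilam (val s * (val lr.2)^-1)%g
    (coef (x k lr.1) (val s * (val lr.2)^-1)%g) (zeta lr)) u =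
    (\sum_l x k l (om ((val s)^-1 * u)%g l)) u.
  rewrite [LHS]l2_sumE [RHS]l2_sumE sum_prod_type /=.
  apply: eq_bigr => l _.
  have := crossed_delta_sum (fun r => zeta (l, r) (val r * ((val s)^-1 * u))%g)
    ((val s)^-1 * u)%g (val s) (Dx k l).
  rewrite mulVKg => ->; apply: eq_bigr => r _.
  by rewrite (pilamE act rep) invgF -mulgA.
have Eu u : \sum_(ks : J * P) rnorm ((\sum_(lr : J * P) pilam (val ks.2 * (val lr.2)^-1)%g
    (coef (x ks.1 lr.1) (val ks.2 * (val lr.2)^-1)%g) (zeta lr)) u) ^+ 2 =
    \sum_(s : P) h s ((val s)^-1 * u)%g.
  rewrite sum_prod_type exchange_big /=; apply: eq_bigr => s _.
  by rewrite /h mulVKg; apply: eq_bigr => k _; rewrite E.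
rewrite (eq_bigr _ (fun u _ => Eu u)) exchange_big /=.
(* All the [q] met while [u] runs over [W]. Enlarging the inner sums to this common set allows the
   sums over [s] and [q] to be exchanged. *)
pose Qs := undup [seq ((val s)^-1 * u)%g | s <- enum {: P}, u <- W].
have QsP (s : P) u : u \in W -> ((val s)^-1 * u)%g \in Qs.
  by move=> uW'; rewrite mem_undup; apply: allpairs_f => //; rewrite mem_enum.
have uQ : uniq Qs by exact: undup_uniq.
apply: (@le_trans _ _ (\sum_(s : P) \sum_(q <- Qs) h s q)).
  apply: ler_sum => s _; apply: (ler_sum_inj (h := h s)) => //.
    exact: mulgI.
  by move=> u uW'; exact: QsP.
rewrite exchange_big /=.
apply: (@le_trans _ _ (\sum_(q <- Qs) b ^+ 2 *
    \sum_l \sum_(r : P) rnorm (zeta (l, r) (val r * q)%g) ^+ 2)).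
  apply: ler_sum => q _; rewrite /h exchange_big /=.
  apply: (@le_trans _ _ (\sum_k rnorm (\sum_l x k l (om q l)) ^+ 2)).
    apply: ler_sum => k _.
    apply: (l2_sum_inj_le _ (k := fun s : P => (val s * q)%g)).
      exact: index_enum_uniq.
    by move=> s s' /mulIg/val_inj.
  apply: (le_trans (xb _)); rewrite ler_wpM2l ?sqr_ge0//.
  apply: ler_sum => l _; apply: rnorm_sum_delta.
  by move=> s s' /mulIg/val_inj.
rewrite -mulr_sumr ler_wpM2l ?sqr_ge0// exchange_big /=.
rewrite [leRHS]sum_prod_type /=.
apply: ler_sum => l _; rewrite exchange_big /=; apply: ler_sum => r _.
by apply: (l2_sum_inj_le _ (k := fun q => (val r * q)%g)) => //; exact: mulgI.
Qed.

(** The substitution is [r = t^-1 * s]; the other elements of [P] correspond to [t] outside [Q] and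
    contribute 0. *)
Lemma sum_diagonal (V : nmodType) (Q P : {fset G}) (s : G) (h : G -> G -> V) :
  (forall t r, t \notin Q -> h t r = 0) ->
  (forall t, t \in Q -> (t^-1 * s)%g \in P) ->
  \sum_(t <- Q) h t (t^-1 * s)%g = \sum_(r : P) h (s * (val r)^-1)%g (val r).
Proof.
move=> h0 QP; rewrite -(big_seq_fsetE _ _ xpredT (fun r => h (s * r^-1)%g r)) /=.
rewrite [RHS](bigID (fun r => (s * r^-1)%g \in Q))/= [X in _ = _ + X]big1 ?addr0; last first.
  by move=> r /h0.
rewrite (eq_bigr (fun t => h (s * (t^-1 * s)^-1)%g (t^-1 * s)%g)); last first.
  by move=> t _; congr (h _ _); rewrite -{1}(mulVKg t s) mulgK.
rewrite -(big_map (fun t => (t^-1 * s)%g) xpredT (fun r => h (s * r^-1)%g r)).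
rewrite -[RHS]big_filter; apply: perm_big; apply: uniq_perm.
- by rewrite map_inj_uniq ?fset_uniq// => t t' /mulIg/invg_inj.
- by rewrite filter_uniq ?fset_uniq.
move=> r; rewrite mem_filter; apply/mapP/andP => [[t tQ ->]|[rQ rP]].
  by rewrite QP//; split=> //; rewrite -{1}(mulVKg t s) mulgK.
by exists (s * r^-1)%g => //; rewrite invgF -mulgA mulVg mulg1.
Qed.

(** The bound on [T] is applied to matrices indexed by [J * P], where [P] depends on the finite set
    of coordinates being tested; complete boundedness makes [C] independent of [P]. Nothing is lost
    besides, since evaluation at a coordinate and [l2_delta] are contractions. *)
Lemma transfer_cb_le (T : (K -> K) -> (K -> K)) (F : G -> A -> A) (Q : {fset G}) C :
  0 <= C -> cb_le id crossed T C -> (forall t, t \notin Q -> F t = 0) ->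
  (forall t a, exists2 c, has_coef (T (pilam t a)) c & c t = F t a) ->
  cb_le id crossed (finite_mult alpha rho F Q) C.
Proof.
move=> C0 TC FQ TF J x b b0 Dx xb v; apply: l2_sum_sqr_le => P0 uP0.
(* Besides [P0], this contains the coordinates [t^-1 * s] of [v] that [finite_mult] reads at [s];
   they are finitely many because [t] stays in [Q]. *)
pose P : {fset G} := seq_fset tt (P0 ++ [seq (t^-1 * s)%g | t <- Q, s <- P0]).
have P0P : {subset P0 <= P} by move=> s sP; rewrite seq_fsetE mem_cat sP.
have QP0 s t : s \in P0 -> t \in Q -> (t^-1 * s)%g \in P.
  move=> sP tQ; rewrite seq_fsetE mem_cat; apply/orP; right.
  exact: (allpairs_f (fun t s => (t^-1 * s)%g)) tQ sP.
pose x' (ks lr : J * P) := pilam (val ks.2 * (val lr.2)^-1)%g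
    (coef (x ks.1 lr.1) (val ks.2 * (val lr.2)^-1)%g).
have Dx' ks lr : crossed (x' ks lr).
  exact/(l1_image_crossed act rep)/(pilam_l1_image act rep).
have Tx' := TC _ x' b b0 Dx' (diagonals_mx_le Dx xb).
have E k s : s \in P0 -> forall sP : s \in P,
    (\sum_l finite_mult alpha rho F Q (x k l) (v l)) s =
    (\sum_(lr : J * P) T (x' (k, [` sP]%fset) lr) (l2_delta (val lr.2) (v lr.1 (val lr.2)))) s.
  move=> sP0 sP; rewrite [LHS]l2_sumE [RHS]l2_sumE.
  rewrite [RHS]sum_prod_type /=.
  apply: eq_bigr => l _; rewrite /finite_mult fct_sum_applyE l2_sumE.
  pose h t r := rho (alpha s^-1%g (F t (coef (x k l) t))) (v l r).
  transitivity (\sum_(t <- Q) h t (t^-1 * s)%g).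
    by apply: eq_bigr => t _; rewrite (pilamE act rep).
  rewrite (@sum_diagonal _ Q P s h).
  - apply: eq_bigr => r _; rewrite /x' /=.
    have [c Tc cF] := TF (s * (val r)^-1)%g (coef (x k l) (s * (val r)^-1)%g).
    by rewrite Tc cF.
  - by move=> t r tQ; rewrite /h FQ//= (linear_fun0 (act_lin act _)) (rep0 rep).
  - by move=> t tQ; exact: QP0.
apply: (@le_trans _ _ (\sum_(s : P) \sum_k
    rnorm ((\sum_(lr : J * P) T (x' (k, s) lr) (l2_delta (val lr.2) (v lr.1 (val lr.2))))
      (val s)) ^+ 2)).
  pose h s := \sum_k rnorm ((\sum_l finite_mult alpha rho F Q (x k l) (v l)) s) ^+ 2.
  rewrite (eq_big_seq (fun s => if s \in P0 then h s else 0)); last first.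
    by move=> s sP0 /=; rewrite sP0.
  apply: (@le_trans _ _ (\sum_(s <- P) if s \in P0 then h s else 0)).
    apply: ler_sum_subset => //.
    by move=> s; case: ifP => // _; exact: sumr_sqr_ge0.
  rewrite big_seq_fsetE /=; apply: ler_sum => s _.
  case: ifPn => [sP0|_]; last exact: sumr_sqr_ge0.
  apply: ler_sum => k _; have sP := fsvalP s.
  rewrite (E k _ sP0 sP).
  by rewrite (_ : [` sP]%fset = s)//; exact: val_inj.
apply: (@le_trans _ _ (\sum_(ks : J * P)
    rnorm (\sum_lr T (x' ks lr) (l2_delta (val lr.2) (v lr.1 (val lr.2)))) ^+ 2)).
  rewrite exchange_big /= [leRHS]sum_prod_type /=.
  apply: ler_sum => k _; apply: ler_sum => s _.
  by rewrite ler_pXn2r ?nnegrE ?rnorm_ge0// l2_eval_le.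
apply: (le_trans (Tx' _)); rewrite ler_wpM2l ?sqr_ge0//.
rewrite [leLHS]sum_prod_type /=.
apply: ler_sum => l _.
apply: (@le_trans _ _ (\sum_(r : P) rnorm (v l (val r)) ^+ 2)).
  by apply: ler_sum => r _; rewrite ler_pXn2r ?nnegrE ?rnorm_ge0// rnorm_delta.
by apply: (l2_sum_inj_le _ (k := val)); [exact: index_enum_uniq|exact: val_inj].
Qed.

End Transfer.

(** * Complete bounds for rank one maps on the coefficient algebra *)

Section BoundedFunctionals.
Variable R : realType.

Lemma real_cauchy_schwarz (J : finType) (x y : J -> R) :
  \sum_i x i * y i <= Num.sqrt (\sum_i x i ^+ 2) * Num.sqrt (\sum_i y i ^+ 2).
Proof.
set X := Num.sqrt (\sum_i x i ^+ 2); set Y := Num.sqrt (\sum_i y i ^+ 2).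
have X2 : X ^+ 2 = \sum_i x i ^+ 2 by rewrite sqr_sqrtr ?sumr_sqr_ge0.
have Y2 : Y ^+ 2 = \sum_i y i ^+ 2 by rewrite sqr_sqrtr ?sumr_sqr_ge0.
have zero (z : J -> R) : 0 = \sum_i z i ^+ 2 -> forall i, z i = 0.
  move=> /esym/eqP; rewrite psumr_eq0 => [/allP H i|j _]; last exact: sqr_ge0.
  by have := H i (mem_index_enum _); rewrite sqrf_eq0 => /eqP.
have X0 : 0 <= X by exact: sqrtr_ge0.
have Y0 : 0 <= Y by exact: sqrtr_ge0.
move: X0; rewrite le_eqVlt => /orP[/eqP X0|X0].
  move: X2; rewrite -X0 expr0n => /zero x0.
  by rewrite big1 ?mul0r// => i _; rewrite x0 mul0r.
move: Y0; rewrite le_eqVlt => /orP[/eqP Y0|Y0].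
  move: Y2; rewrite -Y0 expr0n => /zero y0.
  by rewrite big1 ?mulr0// => i _; rewrite y0 mulr0.
apply: (@le_trans _ _ (\sum_i (X * Y) / 2 * (x i ^+ 2 / X ^+ 2 + y i ^+ 2 / Y ^+ 2))).
  apply: ler_sum => i _; rewrite -subr_ge0.
  have -> : X * Y / 2 * (x i ^+ 2 / X ^+ 2 + y i ^+ 2 / Y ^+ 2) - x i * y i =
      X * Y / 2 * (x i / X - y i / Y) ^+ 2 by field; rewrite !gt_eqF.
  by rewrite mulr_ge0 ?sqr_ge0// divr_ge0// mulr_ge0 ?ltW.
rewrite -mulr_sumr big_split /= -!mulr_suml -X2 -Y2 !divff ?expf_neq0 ?gt_eqF//.
lra.
Qed.

Variables (A : unitalCStarType R) (H : hilbertType R) (rho : A -> H -> H).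
Hypothesis rep : is_faithful_rep rho.

(* Testing the scalar matrix against the conjugate of its own value [z] at [c]
   turns [\sum_i `|z i| ^+ 2] into a single value of [psi]. *)
Lemma bounded_functional_scalar_mx (psi : A -> R[i]) (B : R) (J : finType)
    (x : J -> J -> A) b : 0 <= B -> 0 <= b ->
  (forall c a a', psi (c *: a + a') = c * psi a + psi a') ->
  (forall a, rnorm (psi a) <= B * cnorm a) ->
  mx_le (fun i k => rho (x i k)) b ->
  scalar_mx_le (fun i k => psi (x i k)) (2 * B * b).
Proof.
move=> B0 b0 lpsi psiB xb c.
have lp : linear (psi : A -> (R[i])^o) by move=> k a a'; exact: lpsi.
set N := \sum_k rnorm (c k) ^+ 2; have N0 : 0 <= N by exact: sumr_sqr_ge0.
pose z i := \sum_k psi (x i k) * c k.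
set D := \sum_i rnorm (z i) ^+ 2; have D0 : 0 <= D by exact: sumr_sqr_ge0.
pose d i := Num.conj (z i).
pose a := \sum_i d i *: \sum_k c k *: x i k.
have psia : psi a = D%:C.
  rewrite /a (linear_fun_sum lp) /D rmorph_sum /=; apply: eq_bigr => i _.
  rewrite (linear_funZ lp) (linear_fun_sum lp).
  rewrite (_ : \sum_k psi (c k *: x i k) = z i); last first.
    by apply: eq_bigr => k _; rewrite (linear_funZ lp) mulrC.
  by rewrite rmorphXn /= rnormE normCKC.
have ale : op_le (rho a) (Num.sqrt D * (b * Num.sqrt N)).
  move=> v; rewrite /a (rep_sum rep).
  apply: (le_trans (rnorm_sum _ _ _)).
  pose y i := rnorm (\sum_k rho (x i k) (c k *: v)).
  rewrite (eq_bigr (fun i => rnorm (d i) * y i)); last first.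
    move=> i _; rewrite (repZ rep) rnormZ (rep_sum rep); congr (_ * rnorm _).
    by apply: eq_bigr => k _; rewrite (repZ rep) (linear_funZ (rep_lin rep _)).
  apply: (le_trans (real_cauchy_schwarz _ _)).
  rewrite -mulrA; under eq_bigr do rewrite rnorm_conj.
  rewrite ler_wpM2l ?sqrtr_ge0//.
  rewrite -(@ler_pXn2r _ 2%N) ?nnegrE ?mulr_ge0 ?sqrtr_ge0 ?rnorm_ge0//.
  rewrite sqr_sqrtr ?sumr_sqr_ge0// !exprMn sqr_sqrtr//.
  apply: (le_trans (xb _)); rewrite -mulrA ler_wpM2l ?sqr_ge0//.
  by rewrite mulr_suml; apply: ler_sum => k _; rewrite rnormZ exprMn.
have s0 : 0 <= Num.sqrt D * (b * Num.sqrt N) by rewrite !mulr_ge0 ?sqrtr_ge0.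
have := psiB a; rewrite psia rnorm_real ger0_norm// => DB.
have Da := le_trans DB (ler_wpM2l B0 (rep_bounded_below rep s0 ale)).
rewrite -/D -/N; have D2 := sqr_sqrtr D0; have N2 := sqr_sqrtr N0.
rewrite -D2 -N2 -exprMn ler_pXn2r ?nnegrE ?sqrtr_ge0 ?mulr_ge0 ?sqrtr_ge0//.
have := sqrtr_ge0 D; rewrite le_eqVlt => /orP[/eqP<-|sD].
  by rewrite !mulr_ge0 ?sqrtr_ge0.
rewrite -(ler_pM2l sD) -expr2 D2; apply: (le_trans Da).
by rewrite le_eqVlt; apply/orP; left; apply/eqP; ring.
Qed.

(** Together with [bounded_functional_scalar_mx] this gives complete bounds for the rank one maps
    that make up [F t]. Their functionals pass through [T] and are not given as vector functionals
    of [rho], whence an argument for arbitrary bounded functionals. *)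
Lemma scalar_mx_op (J : finType) (m : J -> J -> R[i]) b (d : H -> H) c : 0 <= c ->
  scalar_mx_le m b -> op_le d c -> mx_le (fun i k => m i k *: d) (b * c).
Proof.
move=> c0 mb dc v; apply: (le_trans (scalar_mx_hilbert (fun k => d (v k)) mb)).
rewrite [X in _ <= X * _]exprMn -[leRHS]mulrA ler_wpM2l ?sqr_ge0// mulr_sumr.
apply: ler_sum => k _; rewrite -exprMn.
by rewrite ler_pXn2r ?nnegrE ?mulr_ge0 ?rnorm_ge0.
Qed.

End BoundedFunctionals.

(** * Multipliers from finite rank maps, and comparison of the constants *)

Section Approximation.
Variables (R : realType) (A : unitalCStarType R) (G : groupType).
Variables (alpha : G -> A -> A) (H : hilbertType R) (rho : A -> H -> H).
Hypotheses (act : is_action alpha) (rep : is_faithful_rep rho).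
Local Notation K := (l2 G H).
Local Notation integrated := (integrated alpha rho).
Local Notation crossed := (crossed_product alpha rho).
Local Notation l1_image := (l1_image alpha rho).
Local Notation pilam := (pilam alpha rho).
Local Notation has_coef := (has_coef alpha rho).
Implicit Types (f : G -> A) (a : A) (y : K -> K) (T : (K -> K) -> (K -> K)).

Lemma has_coef_sum (J : finType) (k : J -> R[i]) (y : J -> K -> K) (c : J -> G -> A) :
  (forall j, has_coef (y j) (c j)) ->
  has_coef (\sum_j k j *: y j) (\sum_j k j *: c j).
Proof.
move=> yc; elim/big_rec2 : _ => [|j y' c' _ yc'].
  rewrite -(integrated0 act rep); apply: (integrated_coef act rep).
  exact: l1_0.
exact: (has_coef_linear act rep _ (yc j) yc').
Qed.

Lemma pilam_coef t a : exists2 c, has_coef (pilam t a) c & c t = a.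
Proof.
have [f [l1f <- fa]] := pilam_integrated act rep t a.
by exists f => //; exact: (integrated_coef act rep l1f).
Qed.

(** [F t a] is the coefficient at [t] of [T' (pilam t a)], hence lies in the span of the finitely
    many [f j t]. The multiplier norm comes from [transfer_cb_le] without loss; only the distance to
    the identity pays the factor 2 of [has_coef_le]. *)
Lemma finite_rank_multiplier T C eta : linear_on crossed T -> finite_rank crossed T ->
  0 <= C -> cb_le id crossed T C -> 0 < eta -> exists F : G -> A -> A,
  [/\ herz_schur alpha rho F, finite_set [set t | F t <> 0],
      forall t, finite_rank setT (F t),
      (HSnorm alpha rho F <= (C + eta)%:E)%E
    & forall t a e, 0 < e -> op_le (T (pilam t a) - pilam t a) e ->
        cnorm (F t a - a) <= 2 * (eta * (cnorm a + 1) + e)].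
Proof.
move=> lT frT C0 TC eta0.
have [m [phi [f [Q [B [f0 lphi [B0 phiB] T'C TT']]]]]] :=
  finite_rank_perturb act rep lT frT C0 TC eta0.
set T' := fun y : K -> K => _ in T'C.
have Dpl t a : crossed (pilam t a).
  exact/(l1_image_crossed act rep)/(pilam_l1_image act rep).
pose psi t j a := phi j (pilam t a).
have lpsi t j c a a' : psi t j (c *: a + a') = c * psi t j a + psi t j a'.
  by rewrite /psi (pilam_linear act rep t c) lphi.
have psiB t j a : rnorm (psi t j a) <= B * cnorm a.
  have := cnorm_ge0 a; rewrite le_eqVlt => /orP[/eqP a0|a0].
    have -> : a = 0 by exact/cnorm0_eq0/esym.
    have := lpsi t j 1 0 0; rewrite scale1r mul1r addr0 => E.
    have -> : psi t j 0 = 0 by apply: (@addrI _ (psi t j 0)); rewrite addr0 -E.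
    by rewrite cnorm0 rnorm0 mulr0.
  exact: (phiB _ _ _ (Dpl t a) a0 (pilam_le act rep t a)).
pose F t a := \sum_j psi t j a *: f j t.
have FQ t : t \notin Q -> F t = 0.
  move=> tQ; apply/funext => a; rewrite /F big1// => j _.
  by rewrite f0// scaler0.
have lF t : linear (F t).
  move=> c a a'; rewrite /F scaler_sumr -big_split /=; apply: eq_bigr => j _.
  by rewrite lpsi scalerDl scalerA.
have TF t a : exists2 c, has_coef (T' (pilam t a)) c & c t = F t a.
  exists (\sum_j psi t j a *: f j).
    apply: has_coef_sum => j; apply: (integrated_coef act rep).
    exact: l1_finite (f0 j).
  exact: (big_morph (fun g : G -> A => g t)).
have C1 : 0 <= C + eta by rewrite addr_ge0// ltW.
have FC : cb_le id crossed (finite_mult alpha rho F Q) (C + eta).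
  exact: (transfer_cb_le act rep C1 T'C FQ TF).
have FC1 : cb_le id l1_image (finite_mult alpha rho F Q) (C + eta).
  move=> J x b b0 Dx xb; apply: FC => // i k.
  exact: (l1_image_crossed act rep (Dx i k)).
(* A bound uniform in [t]: the sum over [Q] dominates each [cnorm (f j t)], and [2 * B] comes from
   [bounded_functional_scalar_mx]. *)
pose Mf := \sum_j 2 * B * \sum_(t <- Q) cnorm (f j t).
have S0 j : 0 <= \sum_(t <- Q) cnorm (f j t).
  by apply: sumr_ge0 => t _; exact: cnorm_ge0.
have Mf0 : 0 <= Mf by apply: sumr_ge0 => j _; rewrite mulr_ge0// mulr_ge0.
have FM t : cb_le rho setT (F t) Mf.
  move=> J x b b0 _ xb; rewrite /Mf mulr_suml.
  apply: (@mx_le_ext _ _ _ (fun k l => \sum_j psi t j (x k l) *: rho (f j t))).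
    move=> k l; apply/funext => v; rewrite fct_sum_applyE (rep_sum rep).
    by apply: eq_bigr => j _; rewrite (repZ rep).
  apply: mx_le_sum => j; first by rewrite mulr_ge0 ?(ltW b0)// mulr_ge0// mulr_ge0.
  rewrite mulrAC; apply: scalar_mx_op => //.
    exact: (bounded_functional_scalar_mx rep B0 (ltW b0) (lpsi t j) (psiB t j) xb).
  apply: op_leW (rep_contractive rep _).
  have [tQ|tQ] := boolP (t \in Q); last by rewrite f0// cnorm0.
  rewrite (bigD1_seq _ tQ) ?fset_uniq//= lerDl sumr_ge0// => s _.
  exact: cnorm_ge0.
have cbF t : cb_map rho setT (F t).
  apply/(rho_cb_mapP rep); split; last by exists Mf.
  by split=> // c a a' _ _; exact: lF.
have FB : exists M : G -> R, (forall t, 0 <= M t) /\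
    forall t a, cnorm (F t a) <= M t * cnorm a.
  have /choice[M HM] : forall t, exists M, 0 <= M /\ forall a, cnorm (F t a) <= M * cnorm a.
    by move=> t; have [_ [M M0 HM]] := rho_cb_bounded rep (cbF t); exists M.
  by exists M; split=> t; case: (HM t).
exists F; split.
- split.
    split; first exact: cbF.
    apply: (@le_lt_trans _ _ Mf%:E); last by rewrite ltry.
    apply: ub_ereal_sup => _ [t _ <-].
    apply/(cbnorm_leP (rep_linear rep)) => //.
    + by move=> a _; exact: rep_lin.
    + by have [] := cbF t.
  exists (finite_mult alpha rho F Q); split; last first.
    by move=> g l1g; exact: (finite_mult_integrated act rep FQ).
  apply/(l1_image_cb_mapP act rep); split.
    exact: (finite_mult_linear_on_l1 act rep Q lF).
  by exists (C + eta).
- apply: sub_finite_set (finite_fset Q) => t /= Ft.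
  by apply: contrapT => /negP/FQ.
- move=> t; exists m, (fun j => f j t) => a _.
  by exists (fun j => psi t j a).
- have SE y : crossed y -> S_ext alpha rho F y = finite_mult alpha rho F Q y.
    exact: (S_extE act rep FQ lF FB C1 FC1).
  have lS : linear_on crossed (S_ext alpha rho F).
    have [fD flin] := finite_mult_linear_on act rep Q lF.
    split=> [y Dy|c y z Dy Dz]; first by rewrite (SE _ Dy); exact: fD.
    by rewrite (SE _ (crossed_lin act rep c Dy Dz)) (SE _ Dy) (SE _ Dz); exact: flin.
  apply/(crossed_cbnorm_leP act rep lS C1).
  move=> J x b b0 Dx xb; apply: mx_le_ext (FC J x b b0 Dx xb) => k l.
  by rewrite (SE _ (Dx k l)).
- move=> t a e e0 Te; have [c Tc cF] := TF t a; have [c0 pc c0a] := pilam_coef t a.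
  (* The estimate of [T - T'] asks for a positive bound; the 1 covers [a = 0]. *)
  have b0 : 0 < cnorm a + 1 by have := cnorm_ge0 a; lra.
  have pb : op_le (pilam t a) (cnorm a + 1).
    by apply: op_leW (pilam_le act rep t a); lra.
  rewrite -cF -[in X in _ - X]c0a.
  apply: (has_coef_le act rep t (has_coefB act rep Tc pc)).
    by rewrite addr_ge0 ?mulr_ge0 ?ltW.
  apply: op_leB_trans Te; apply: op_leB_sym.
  exact: (TT' _ _ (Dpl t a) b0 pb).
Qed.

(** The supremum of the multiplier norms, and not only their limit, has to stay below [C + eps], so
    every perturbation is at most [eps]; it must also tend to 0 along the net for pointwise
    convergence. Hence a net over [I * nat] with perturbation [eps / (n + 1)]. *)
Lemma cbap_wa_with C (eps : R) : 0 < eps -> cbap_with crossed C ->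
  exists2 C', (C' <= C + eps%:E)%E & weakly_amenable_with alpha rho C'.
Proof.
move=> eps0 [I [le [T [dir HT Tb CE Cfin]]]].
have C0 : (0 <= C)%E.
  have [[k] _ _ _] := dir; rewrite CE.
  apply: (@le_trans _ _ (cbnorm id crossed (T k))); last first.
    by apply: ereal_sup_ubound; exists k.
  by have [[lT _] _] := HT k; exact: cbnorm_ge0.
have Cf : C \is a fin_num by rewrite ge0_fin_numE.
have c0 : 0 <= fine C by exact: fine_ge0.
have Tc k : cb_le id crossed (T k) (fine C).
  have [[lT _] _] := HT k; apply/(crossed_cbnorm_leP act rep lT c0).
  by rewrite fineK// CE; apply: ereal_sup_ubound; exists k.
have etan (n : nat) : 0 < eps / n.+1%:R by rewrite divr_gt0// ltr0n.
have /choice[F HF] : forall kn : I * nat, exists F : G -> A -> A,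
    [/\ herz_schur alpha rho F, finite_set [set t | F t <> 0],
      forall t, finite_rank setT (F t),
      (HSnorm alpha rho F <= (fine C + eps / kn.2.+1%:R)%:E)%E
    & forall t a e, 0 < e -> op_le (T kn.1 (pilam t a) - pilam t a) e ->
        cnorm (F t a - a) <= 2 * (eps / kn.2.+1%:R * (cnorm a + 1) + e)].
  move=> [k n]; have [[lT _] fr] := HT k.
  exact: (finite_rank_multiplier lT fr c0 (Tc k) (etan n)).
have Cle : (ereal_sup [set HSnorm alpha rho (F kn) | kn in setT] <= C + eps%:E)%E.
  apply: ub_ereal_sup => _ [kn _ <-]; have [_ _ _ H4 _] := HF kn.
  apply: (le_trans H4); rewrite -[in leRHS](fineK Cf) -EFinD lee_fin lerD2l.
  by rewrite ler_pdivrMr ?ltr0n// ler_pMr// ler1n.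
exists (ereal_sup [set HSnorm alpha rho (F kn) | kn in setT]); first exact: Cle.
exists (I * nat)%type, (fun kn lm => le kn.1 lm.1 /\ (kn.2 <= lm.2)%N), F.
have [[k0] lerr letr ledir] := dir.
split.
- split.
  + exact: (inhabits (k0, 0%N)).
  + by move=> kn; split; [exact: lerr|exact: leqnn].
  + move=> kn lm pq [h1 h2] [h3 h4]; split; first exact: letr h1 h3.
    exact: leq_trans h2 h4.
  + move=> [k n] [l p]; have [q [kq lq]] := ledir k l.
    by exists (q, maxn n p); rewrite /= leq_maxl leq_maxr.
- by move=> kn; have [] := HF kn.
- move=> t a e e0; have a1 : 0 < cnorm a + 1 by have := cnorm_ge0 a; lra.
  have Dpl : crossed (pilam t a).
    exact/(l1_image_crossed act rep)/(pilam_l1_image act rep).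
  (* The bound to be met is twice the sum of two terms of size at most [e / 8], which stays below
     [e]. *)
  have e8 : 0 < e / 8 by apply: divr_gt0.
  have [k1 Hk1] := Tb _ Dpl _ e8.
  have [n1 Hn1] := @inv_nat_small R (e / 8 / (eps * (cnorm a + 1)))
    ltac:(by rewrite divr_gt0// mulr_gt0).
  exists (k1, n1) => -[k n] /= [k1k n1n].
  have [_ _ _ _ H5] := HF (k, n).
  have [[[TD _] _] _] := HT k.
  have lin : linear (T k (pilam t a) - pilam t a).
    by apply: linear_fctB; apply: crossed_linear; [exact: TD Dpl|exact: Dpl].
  have := H5 t a (e / 8) e8 ((opnorm_leP lin (ltW e8)).1 (ltW (Hk1 k k1k))).
  move=> /= Hle; rewrite lte_fin; apply: (le_lt_trans Hle).
  have : eps / n.+1%:R * (cnorm a + 1) <= e / 8.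
    rewrite mulrAC mulrC -ler_pdivlMr ?mulr_gt0//.
    exact: ltW (le_lt_trans (inv_nat_anti R n1n) Hn1).
  by move: (eps / _ * _) => w; lra.
- by [].
- by apply: (le_lt_trans Cle); rewrite lte_add_pinfty// ltry.
Qed.

End Approximation.

Theorem theorem4p3 (R : realType) (A : unitalCStarType R) (G : groupType)
    (alpha : G -> A -> A) (H : hilbertType R) (rho : A -> H -> H)
    (sepA : separable_cstar A) (countG : countable [set: G])
    (sepH : separable_space H)
    (act : is_action alpha) (rep : is_faithful_rep rho) :
  (weakly_amenable alpha rho <-> cbap (crossed_product alpha rho)) /\
  (weakly_amenable alpha rho ->
   Lambda_cb_system alpha rho = Lambda_cb (crossed_product alpha rho)).
Proof.
have to_cbap C : weakly_amenable_with alpha rho C ->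
    cbap_with (crossed_product alpha rho) C.
  exact: (wa_cbap_with act rep).
split.
  split=> [[C waC]|[C cbC]]; first by exists C; exact: to_cbap.
  by have [C' _ waC'] := cbap_wa_with act rep ltr01 cbC; exists C'.
(* One inequality loses an arbitrary [eps]; the other is an inclusion between the sets of admissible
   constants. *)
move=> _; apply/le_anti/andP; split.
  apply: le_ereal_inf_tmp => C cbC; apply/lee_addgt0Pr => e e0.
  have [C' C'le waC'] := cbap_wa_with act rep e0 cbC.
  by apply: le_trans C'le; exact: ereal_inf_lbound.
by apply: le_ereal_inf_tmp => C /to_cbap; exact: ereal_inf_lbound.
Qed.
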